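(* Let $R$ be an essentially of finite type algebra over a field $\Bbbk$ and let $\Delta = (\mathfrak{p}_0, \ldots, \mathfrak{p}_n)$ be a flag of prime ideals of $R$. Then the Krull dimension of the ind-pro completion $C_\Delta R$ of $R$ along $\Delta$ is $$\dim C_\Delta R = \mathrm{ht}\, \mathfrak{p}_0 + \mathrm{ht}(\mathfrak{p}_n/\mathfrak{p}_0) - n.$$
   Context: All rings are commutative with identity. A ring $R$ is an essentially of finite type algebra over a field $\Bbbk$ if $R \cong T^{-1}R'$ for some finite type $\Bbbk$-algebra $R'$ and some multiplicatively closed subset $T \subset R'$. A flag of prime ideals $\Delta = (\mathfrak{p}_0,\ldots,\mathfrak{p}_n)$ of a ring $R$ ($n \ge 0$) is a non-empty finite set of prime ideals with $\mathfrak{p}_i \subsetneq \mathfrak{p}_{i+1}$ for $0 \le i < n$. For a prime $\mathfrak{p}$ of $R$ and an $R$-module (or $R$-algebra) $M$, $S^{-1}_{\mathfrak{p}}M$ denotes the localization of $M$ at $\mathfrak{p}$ (inverting the elements of $R\setminus\mathfrak{p}$), and $C_{\mathfrak{p}}M = \varprojlim_l M/\mathfrak{p}^l M$ denotes the $\mathfrak{p}$-adic completion of $M$. For a Noetherian ring $R$ the ind-pro completion of $R$ along $\Delta$ is the ring $$C_\Delta R = C_{\mathfrak{p}_0}S^{-1}_{\mathfrak{p}_0}\cdots C_{\mathfrak{p}_n}S^{-1}_{\mathfrak{p}_n}R$$ (first localize at and complete along $\mathfrak{p}_n$, ..., last along $\mathfrak{p}_0$). $\mathrm{ht}\,\mathfrak{p}$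 is the height of $\mathfrak{p}$; for primes $\mathfrak{p}\subset\mathfrak{q}$, $\mathrm{ht}(\mathfrak{q}/\mathfrak{p})$ is the supremum of lengths of chains of primes from $\mathfrak{p}$ to $\mathfrak{q}$, i.e. the height of $\mathfrak{q}/\mathfrak{p}$ in $R/\mathfrak{p}$. *)

(* Defs.v *)
From HB Require Import structures.
From mathcomp Require Import all_boot all_order all_algebra.
From mathcomp Require Import generic_quotient ring_quotient.
From mathcomp Require Import boolp classical_sets constructive_ereal ring.

Set Implicit Arguments.
Unset Strict Implicit.
Unset Printing Implicit Defensive.

Import Order.TTheory GRing.Theory Num.Theory.

Local Open Scope classical_set_scope.
Local Open Scope ring_scope.
Local Open Scope quotient_scope.

(* Rings are [comPzRingType]s rather than [comNzRingType]s: localizations and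
   completions are defined for all inputs, so they may a priori be zero. *)

Section Ideals.
Variable A : comPzRingType.

Definition is_ideal (I : set A) : Prop :=
  [/\ I 0, forall x y, I x -> I y -> I (x + y) & forall a x, I x -> I (a * x)].

Record ideal := Ideal { ideal_set :> set A; idealP : is_ideal ideal_set }.

Definition is_prime_ideal (P : set A) : Prop :=
  [/\ is_ideal P, ~ P 1 & forall x y, P (x * y) -> P x \/ P y].

Record prime_ideal := PrimeIdeal {
  prime_ideal_set :> set A;
  prime_idealP : is_prime_ideal prime_ideal_set
}.

Lemma ideal_gen_is_ideal (S : set A) : is_ideal (smallest is_ideal S).
Proof.
split=> [I [[I0 _ _] _] //|x y Sx Sy I IS|a x Sx I IS].
  by have [[_ ID _] _] := IS; apply: ID; [exact: Sx | exact: Sy].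
by have [[_ _ IM] _] := IS; apply: IM; exact: Sx.
Qed.

Definition ideal_gen (S : set A) : ideal := Ideal (ideal_gen_is_ideal S).

Fixpoint ideal_pow (I : set A) (l : nat) : ideal :=
  if l is l'.+1 then
    ideal_gen [set z | exists x y, [/\ I x, (ideal_pow I l' : set A) y & z = x * y]]
  else ideal_gen setT.

End Ideals.

(* [Quotient.quot] is the additive quotient; the library makes it a ring only
   for proper ideals. *)
Section QuotientRing.
Variables (A : comPzRingType) (I : ideal A).

Definition ideal_mem : {pred A} := fun x => `[< (I : set A) x >].

Lemma ideal_mem_zmod : zmod_closed ideal_mem.
Proof.
have [I0 ID IM] := idealP I; split=> [|x y /asboolP Ix /asboolP Iy].
  exact/asboolP.
by apply/asboolP/ID => //; rewrite -mulN1r; apply: IM.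
Qed.
HB.instance Definition _ := GRing.isZmodClosed.Build A ideal_mem ideal_mem_zmod.

Definition quot_ring := Quotient.quot ideal_mem.
HB.instance Definition _ := GRing.Zmodule.on quot_ring.
HB.instance Definition _ := EqQuotient.on quot_ring.

Lemma quot_ringP (x y : A) : \pi_quot_ring x = \pi_quot_ring y <-> (I : set A) (x - y).
Proof.
split=> [/eqP|Ixy].
  by rewrite -(Quotient.idealrBE ideal_mem) => /asboolP.
by apply/eqP; rewrite -(Quotient.idealrBE ideal_mem); apply/asboolP.
Qed.

Definition quot_one : quot_ring := \pi_quot_ring 1.
Definition quot_mul := lift_op2 quot_ring *%R.

Lemma pi_quot_mul (x y : A) :
  quot_mul (\pi_quot_ring x) (\pi_quot_ring y) = \pi_quot_ring (x * y).
Proof.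
have [_ ID IM] := idealP I; unlock quot_mul; apply/quot_ringP.
set x' := repr _; set y' := repr _.
have Ix : (I : set A) (x' - x) by apply/quot_ringP; rewrite reprK.
have Iy : (I : set A) (y' - y) by apply/quot_ringP; rewrite reprK.
have -> : x' * y' - x * y = x' * (y' - y) + y * (x' - x).
  by rewrite !mulrBr [y * x']mulrC [y * x]mulrC addrA subrK.
by apply: ID; apply: IM.
Qed.

Lemma pi_quot_add (x y : A) :
  (\pi_quot_ring x : quot_ring) + \pi_quot_ring y = \pi_quot_ring (x + y).
Proof. by rewrite [RHS](Quotient.pi_add ideal_mem). Qed.

Lemma pi_quot_opp (x : A) :
  - (\pi_quot_ring x : quot_ring) = \pi_quot_ring (- x).
Proof. by rewrite [RHS](Quotient.pi_opp ideal_mem). Qed.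

Lemma quot_mulA : associative quot_mul.
Proof.
by move=> x y z; rewrite -[x]reprK -[y]reprK -[z]reprK !pi_quot_mul mulrA.
Qed.

Lemma quot_mulC : commutative quot_mul.
Proof. by move=> x y; rewrite -[x]reprK -[y]reprK !pi_quot_mul mulrC. Qed.

Lemma quot_mul1 : left_id quot_one quot_mul.
Proof. by move=> x; rewrite -[x]reprK pi_quot_mul mul1r. Qed.

Lemma quot_mulDl : left_distributive quot_mul +%R.
Proof.
move=> x y z; rewrite -[x]reprK -[y]reprK -[z]reprK.
by rewrite pi_quot_add !pi_quot_mul pi_quot_add mulrDl.
Qed.

HB.instance Definition _ := GRing.Zmodule_isComPzRing.Build quot_ring
  quot_mulA quot_mulC quot_mul1 quot_mulDl.

End QuotientRing.

Record filtration (A : comPzRingType) := Filtration {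
  filtration_ideal :> nat -> ideal A;
  filtration_decr : forall l, filtration_ideal l.+1 `<=` filtration_ideal l
}.

(* lim_l A / F l for a decreasing sequence F of ideals: the sequences of
   residue classes x_l in A / F l such that x_(l+1) maps to x_l; a
   representative of the class x_(l+1) serves to compute its image. *)
Section Completion.
Variables (A : comPzRingType) (F : filtration A).

Definition coherent (x : forall l, quot_ring (F l)) : Prop :=
  forall l, \pi_(quot_ring (F l)) (repr (x l.+1)) = x l.

Record completion := Completion {
  completion_val :> forall l, quot_ring (F l);
  completion_valP : `[< coherent completion_val >]
}.
HB.instance Definition _ := [isSub for completion_val].
HB.instance Definition _ := [Choice of completion by <:].

Lemma completionE (x y : completion) : (forall l, x l = y l) -> x = y.
Proof. by move=> xy; apply/val_inj/functional_extensionality_dep. Qed.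

Lemma coherentP (x : forall l, quot_ring (F l)) :
  (forall l, exists a, x l.+1 = \pi_(quot_ring (F l.+1)) a /\
                       x l = \pi_(quot_ring (F l)) a) ->
  `[< coherent x >].
Proof.
move=> xP; apply/asboolP => l; have [a [xSl xl]] := xP l.
rewrite xl; apply/quot_ringP/filtration_decr/quot_ringP.
by rewrite reprK.
Qed.

Lemma completion_repr (x : completion) l :
  exists a, x l.+1 = \pi_(quot_ring (F l.+1)) a /\
            x l = \pi_(quot_ring (F l)) a.
Proof.
by exists (repr (x l.+1)); have /asboolP xP := completion_valP x; rewrite xP reprK.
Qed.

Lemma embed_subproof (a : A) :
  `[< coherent (fun l => \pi_(quot_ring (F l)) a) >].
Proof. by apply: coherentP => l; exists a. Qed.
Definition completion_embed (a : A) : completion := Completion (embed_subproof a).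

Lemma add_subproof (x y : completion) : `[< coherent (fun l => x l + y l) >].
Proof.
apply: coherentP => l; have [a [-> ->]] := completion_repr x l.
by have [b [-> ->]] := completion_repr y l; exists (a + b); rewrite !pi_quot_add.
Qed.
Definition completion_add x y : completion := Completion (add_subproof x y).

Lemma opp_subproof (x : completion) : `[< coherent (fun l => - x l) >].
Proof.
apply: coherentP => l; have [a [-> ->]] := completion_repr x l.
by exists (- a); rewrite !pi_quot_opp.
Qed.
Definition completion_opp x : completion := Completion (opp_subproof x).

Lemma mul_subproof (x y : completion) : `[< coherent (fun l => x l * y l) >].
Proof.
apply: coherentP => l; have [a [-> ->]] := completion_repr x l.
have [b [-> ->]] := completion_repr y l; exists (a * b).
by split; apply: pi_quot_mul.
Qed.
Definition completion_mul x y : completion := Completion (mul_subproof x y).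

Lemma completion_addA : associative completion_add.
Proof. by move=> x y z; apply: completionE => l /=; rewrite addrA. Qed.
Lemma completion_addC : commutative completion_add.
Proof. by move=> x y; apply: completionE => l /=; rewrite addrC. Qed.
Lemma completion_add0 : left_id (completion_embed 0) completion_add.
Proof.
move=> x; apply: completionE => l /=.
by rewrite -[x l]reprK pi_quot_add add0r.
Qed.
Lemma completion_addN :
  left_inverse (completion_embed 0) completion_opp completion_add.
Proof.
move=> x; apply: completionE => l /=.
by rewrite addNr; apply: (addrI (\pi_(quot_ring (F l)) 0)); rewrite pi_quot_add !addr0.
Qed.
HB.instance Definition _ := GRing.isZmodule.Build completion
  completion_addA completion_addC completion_add0 completion_addN.

Lemma completion_mulA : associative completion_mul.
Proof. by move=> x y z; apply: completionE => l /=; rewrite mulrA. Qed.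
Lemma completion_mulC : commutative completion_mul.
Proof. by move=> x y; apply: completionE => l /=; rewrite mulrC. Qed.
Lemma completion_mul1 : left_id (completion_embed 1) completion_mul.
Proof. by move=> x; apply: completionE => l /=; apply: mul1r. Qed.
Lemma completion_mulDl : left_distributive completion_mul completion_add.
Proof. by move=> x y z; apply: completionE => l /=; apply: mulrDl. Qed.
HB.instance Definition _ := GRing.Zmodule_isComPzRing.Build completion
  completion_mulA completion_mulC completion_mul1 completion_mulDl.


Lemma completion_embed_zmod : zmod_morphism completion_embed.
Proof.
move=> a b; apply: completionE => l /=.
by rewrite pi_quot_opp pi_quot_add.
Qed.
Lemma completion_embed_monoid : monoid_morphism completion_embed.
Proof.
split=> // a b; apply: completionE => l /=.
by rewrite -pi_quot_mul.
Qed.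
HB.instance Definition _ := GRing.isZmodMorphism.Build A completion
  completion_embed completion_embed_zmod.
HB.instance Definition _ := GRing.isMonoidMorphism.Build A completion
  completion_embed completion_embed_monoid.

End Completion.

Section Localization.
Variable A : comPzRingType.

Definition is_mult_closed (S : set A) : Prop :=
  S 1 /\ forall x y, S x -> S y -> S (x * y).

Record mult_set := MultSet {
  mult_set_set :> set A;
  mult_setP : is_mult_closed mult_set_set
}.

Variable S : mult_set.

Local Notation fraction := (A * (S : set A))%type.
Implicit Types (x y z : fraction) (s t : (S : set A)).

Lemma den1_subproof : 1 \in (S : set A).
Proof. by apply/mem_set; have [] := mult_setP S. Qed.
Lemma denM_subproof s t : sval s * sval t \in (S : set A).
Proof.
by have [_ SM] := mult_setP S; apply/mem_set/SM; apply/set_mem/valP.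
Qed.
Definition den1 : (S : set A) := exist _ 1 den1_subproof.
Definition denM s t : (S : set A) := exist _ (sval s * sval t) (denM_subproof s t).

Definition loc_equiv : rel fraction := fun x y =>
  `[< exists u, (S : set A) u /\ u * (x.1 * sval y.2) = u * (y.1 * sval x.2) >].

Lemma loc_equivP x y :
  reflect (exists u, (S : set A) u /\ u * (x.1 * sval y.2) = u * (y.1 * sval x.2))
          (loc_equiv x y).
Proof. exact: asboolP. Qed.

Lemma loc_equiv_is_equiv : equiv_class_of loc_equiv.
Proof.
have [S1 SM] := mult_setP S.
split=> [x|x y|y x z].
- by apply/loc_equivP; exists 1.
- by apply/loc_equivP/loc_equivP => -[u [Su xy]]; exists u.
- move=> /loc_equivP[u [Su xy]] /loc_equivP[v [Sv yz]].
  apply/loc_equivP; exists (u * v * sval y.2); split.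
    by apply: (SM); [exact: SM | exact/set_mem/valP].
  have -> : u * v * sval y.2 * (x.1 * sval z.2) = u * (x.1 * sval y.2) * (v * sval z.2).
    by ring.
  rewrite xy.
  have -> : u * (y.1 * sval x.2) * (v * sval z.2) = v * (y.1 * sval z.2) * (u * sval x.2).
    by ring.
  by rewrite yz; ring.
Qed.

Canonical loc_equiv_rel := EquivRelPack loc_equiv_is_equiv.
Canonical loc_enc_mod_rel := defaultEncModRel loc_equiv.

Definition localization := {eq_quot loc_equiv}.
HB.instance Definition _ : EqQuotient _ loc_equiv localization :=
  EqQuotient.on localization.
HB.instance Definition _ := Choice.on localization.

Definition loc_frac a s : localization := \pi_localization (a, s).

Lemma loc_fracP a b s t : loc_frac a s = loc_frac b t <->
  exists u, (S : set A) u /\ u * (a * sval t) = u * (b * sval s).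
Proof.
split=> [/eqmodP /loc_equivP //|ab].
by apply/eqmodP/loc_equivP.
Qed.

Lemma loc_fracE (x : localization) : exists a s, x = loc_frac a s.
Proof.
exists (repr x).1, (repr x).2.
by rewrite /loc_frac -surjective_pairing reprK.
Qed.

Definition loc_add := lift_op2 localization (fun x y =>
  (x.1 * sval y.2 + y.1 * sval x.2, denM x.2 y.2)).
Definition loc_opp := lift_op1 localization (fun x => (- x.1, x.2)).
Definition loc_mul := lift_op2 localization (fun x y =>
  (x.1 * y.1, denM x.2 y.2)).
Definition loc_embed (a : A) : localization := loc_frac a den1.

Lemma repr_frac a s : exists u, (S : set A) u /\
  u * ((repr (loc_frac a s)).1 * sval s) = u * (a * sval (repr (loc_frac a s)).2).
Proof.
by apply/(@loc_fracP _ _ (repr (loc_frac a s)).2);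
  rewrite {1}/loc_frac -surjective_pairing reprK.
Qed.

Lemma loc_addE a b s t : loc_add (loc_frac a s) (loc_frac b t) =
  loc_frac (a * sval t + b * sval s) (denM s t).
Proof.
unlock loc_add; apply/loc_fracP => /=.
have [_ SM] := mult_setP S.
have [u [Su uE]] := repr_frac a s; have [v [Sv vE]] := repr_frac b t.
move: (repr (loc_frac a s)) (repr (loc_frac b t)) uE vE => [a' s'] [b' t'] /= uE vE.
exists (u * v); split; first exact: SM.
transitivity (u * (a' * sval s) * v * sval t * sval t' +
              v * (b' * sval t) * u * sval s * sval s'); first by ring.
by rewrite uE vE; ring.
Qed.

Lemma loc_mulE a b s t :
  loc_mul (loc_frac a s) (loc_frac b t) = loc_frac (a * b) (denM s t).
Proof.
unlock loc_mul; apply/loc_fracP => /=.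
have [_ SM] := mult_setP S.
have [u [Su uE]] := repr_frac a s; have [v [Sv vE]] := repr_frac b t.
move: (repr (loc_frac a s)) (repr (loc_frac b t)) uE vE => [a' s'] [b' t'] /= uE vE.
exists (u * v); split; first exact: SM.
transitivity (u * (a' * sval s) * (v * (b' * sval t))); first by ring.
by rewrite uE vE; ring.
Qed.

Lemma loc_oppE a s : loc_opp (loc_frac a s) = loc_frac (- a) s.
Proof.
unlock loc_opp; apply/loc_fracP => /=.
have [u [Su uE]] := repr_frac a s; exists u; split=> //.
by rewrite !mulNr !mulrN uE.
Qed.

Lemma loc_frac_eq a b s t :
  a * sval t = b * sval s -> loc_frac a s = loc_frac b t.
Proof.
by move=> ab; apply/loc_fracP; exists 1; rewrite ab; split=> //; case: (mult_setP S).
Qed.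

Lemma loc_addA : associative loc_add.
Proof.
move=> x y z; have [a [s ->]] := loc_fracE x; have [b [t ->]] := loc_fracE y.
have [c [u ->]] := loc_fracE z; rewrite !loc_addE; apply: loc_frac_eq => /=.
by ring.
Qed.
Lemma loc_addC : commutative loc_add.
Proof.
move=> x y; have [a [s ->]] := loc_fracE x; have [b [t ->]] := loc_fracE y.
by rewrite !loc_addE; apply: loc_frac_eq => /=; ring.
Qed.
Lemma loc_add0 : left_id (loc_embed 0) loc_add.
Proof.
move=> x; have [a [s ->]] := loc_fracE x.
by rewrite loc_addE; apply: loc_frac_eq => /=; ring.
Qed.
Lemma loc_addN : left_inverse (loc_embed 0) loc_opp loc_add.
Proof.
move=> x; have [a [s ->]] := loc_fracE x.
by rewrite loc_oppE loc_addE; apply: loc_frac_eq => /=; ring.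
Qed.
HB.instance Definition _ := GRing.isZmodule.Build localization
  loc_addA loc_addC loc_add0 loc_addN.

Lemma loc_mulA : associative loc_mul.
Proof.
move=> x y z; have [a [s ->]] := loc_fracE x; have [b [t ->]] := loc_fracE y.
have [c [u ->]] := loc_fracE z; rewrite !loc_mulE; apply: loc_frac_eq => /=.
by ring.
Qed.
Lemma loc_mulC : commutative loc_mul.
Proof.
move=> x y; have [a [s ->]] := loc_fracE x; have [b [t ->]] := loc_fracE y.
by rewrite !loc_mulE; apply: loc_frac_eq => /=; ring.
Qed.
Lemma loc_mul1 : left_id (loc_embed 1) loc_mul.
Proof.
move=> x; have [a [s ->]] := loc_fracE x.
by rewrite loc_mulE; apply: loc_frac_eq => /=; ring.
Qed.
Lemma loc_mulDl : left_distributive loc_mul loc_add.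
Proof.
move=> x y z; have [a [s ->]] := loc_fracE x; have [b [t ->]] := loc_fracE y.
have [c [u ->]] := loc_fracE z; rewrite !(loc_mulE, loc_addE).
by apply: loc_frac_eq => /=; ring.
Qed.
HB.instance Definition _ := GRing.Zmodule_isComPzRing.Build localization
  loc_mulA loc_mulC loc_mul1 loc_mulDl.

Lemma loc_embed_zmod : zmod_morphism loc_embed.
Proof.
move=> a b; rewrite -[RHS]/(loc_add _ (loc_opp _)) loc_oppE loc_addE.
by apply: loc_frac_eq => /=; ring.
Qed.
Lemma loc_embed_monoid : monoid_morphism loc_embed.
Proof.
split=> // a b; rewrite -[RHS]/(loc_mul _ _) loc_mulE.
by apply: loc_frac_eq => /=; ring.
Qed.
HB.instance Definition _ := GRing.isZmodMorphism.Build A localization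
  loc_embed loc_embed_zmod.
HB.instance Definition _ := GRing.isMonoidMorphism.Build A localization
  loc_embed loc_embed_monoid.

End Localization.

(* An algebra over R as a ring with a structure morphism; the library's
   [comAlgType R] excludes the zero algebra. *)
Record pz_algebra (R : comPzRingType) := PzAlgebra {
  pz_algebra_sort :> comPzRingType;
  pz_algebra_map : {rmorphism R -> pz_algebra_sort}
}.

Section IndProCompletion.
Variable R : comPzRingType.
Implicit Types (P : prime_ideal R) (M : pz_algebra R).

Lemma compl_image_subproof P M :
  is_mult_closed (pz_algebra_map M @` (~` P)).
Proof.
have [_ P1 PM] := prime_idealP P; split; first by exists 1; rewrite ?rmorph1.
move=> _ _ [x Px <-] [y Py <-]; exists (x * y); rewrite ?rmorphM //.
by move=> /PM[].
Qed.
Definition compl_image P M : mult_set M := MultSet (compl_image_subproof P M).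

Definition localize_at P M : pz_algebra R :=
  PzAlgebra (@loc_embed M (compl_image P M) \o pz_algebra_map M).

Definition ext_pow P M (l : nat) : ideal M :=
  ideal_gen (pz_algebra_map M @` ideal_pow P l).

Lemma ext_pow_decr P M l : ext_pow P M l.+1 `<=` ext_pow P M l.
Proof.
apply: sub_smallest2r; first exact: ideal_gen_is_ideal.
apply: image_subset.
apply: smallest_sub; first exact: idealP.
by move=> _ [x [y [_ Iy ->]]]; have [_ _ IM] := idealP (ideal_pow P l); apply: IM.
Qed.
Definition adic_filtration P M : filtration M := Filtration (@ext_pow_decr P M).

Definition complete_along P M : pz_algebra R :=
  PzAlgebra (@completion_embed M (adic_filtration P M) \o pz_algebra_map M).

Definition base_algebra : pz_algebra R := PzAlgebra (@idfun R).

Definition prime_chain (n : nat) (p : 'I_n.+1 -> prime_ideal R) : Prop :=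
  forall i j : 'I_n.+1, j = i.+1 :> nat -> p i `<` p j.

Definition ind_pro_completion (n : nat) (p : 'I_n.+1 -> prime_ideal R) :
    pz_algebra R :=
  foldr (fun P M => complete_along P (localize_at P M)) base_algebra
        [seq p i | i <- enum 'I_n.+1].

End IndProCompletion.

Section Dimension.
Variable A : comPzRingType.

(* Every subset of [\bar int] has a least upper bound; it is -oo for the empty
   set, so that the zero ring has dimension -oo. *)
Definition sup_length (L : set nat) : \bar int :=
  supremum -oo%E [set m%:Z%:E%E | m in L].

Definition krull_dim : \bar int :=
  sup_length [set m | exists p : 'I_m.+1 -> prime_ideal A, prime_chain p].

Definition height (Q : prime_ideal A) : \bar int :=
  sup_length [set m | exists p : 'I_m.+1 -> prime_ideal A,
    prime_chain p /\ p ord_max = Q :> set A].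

Definition rel_height (P Q : prime_ideal A) : \bar int :=
  sup_length [set m | exists p : 'I_m.+1 -> prime_ideal A,
    [/\ prime_chain p, p ord0 = P :> set A & p ord_max = Q :> set A]].

End Dimension.

Section EssentiallyFiniteType.
Variable k : fieldType.

Definition finite_type (B : comAlgType k) : Prop :=
  exists xs : seq B,
    smallest (fun C : set B => GRing.subalg_closed [in C]) [set` xs] = setT.

Definition ess_finite_type (R : comAlgType k) : Prop :=
  exists (B : comAlgType k) (T : mult_set B)
         (f : {rmorphism localization T -> R}),
    [/\ finite_type B, bijective f &
        forall c : k, f (loc_embed T c%:A) = c%:A].

End EssentiallyFiniteType.

(* Main.v *)
(* Every chain of primes in a stage of the completion can be moved over a fixed
   prime of the base. Upper bound: p_(i+1) is minimal over p_i and h elements,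
   where h is at most the height of p_(i+1)/p_i, so by Krull's principal ideal
   theorem a chain starting over p_i loses at most h steps when it is moved over
   p_(i+1); and a chain lying over p_i can be extended at the top, since p_(i+1)
   lies in the Jacobson radical of the stage. Lower bound: elements outside a
   prime P of the base are nonzerodivisors modulo the extension of P
   (Artin-Rees), which gives going-down along chains of the base; catenarity of
   algebras of finite type then lets the chain pass through p_(i+1), and it
   remains to make a chain of length m+1 generic, i.e. lying over its bottom, at
   the cost of one step. For this, given primes Q0 < Q1 < Q2 and an element a of
   the base in Q1 but not in Q0, one takes z in Q2 outside the minimal primes of
   a modulo Q0 and a lacunary series g = a^m0 + a^m1 + ... such that no nonzero
   element of the base is a multiple of z - g modulo Q0: the base is a countable
   union of finite-dimensional spaces, on which decreasing sequences of ideals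
   stabilize, so the exponents can be chosen one at a time. *)
From HB Require Import structures.
Require Import Defs.
From mathcomp Require Import all_boot all_order all_algebra.
From mathcomp Require Import boolp classical_sets constructive_ereal ring.

Set Implicit Arguments.
Unset Strict Implicit.
Unset Printing Implicit Defensive.

Import Order.TTheory GRing.Theory Num.Theory.

Local Open Scope classical_set_scope.
Local Open Scope ring_scope.

(** * Ideals and primes in Noetherian rings *)

(** A stage is accessible only modulo the prime along which it was completed last: there completion
    changes nothing and localization merely discards primes. So a chain lying over p_i in the stage
    of p_i amounts to a chain lying over p_i in the stage of p_(i+1), from which it was built. In
    that stage, however, it is the primes over p_(i+1) that are accessible, and so chains have to be
    exchanged between the two fibres. The exchange is off by one in both directions, through the
    extension at the top in the upper bound and through the link lost to genericity in the lower
    bound; n exchanges give the term -n of the formula. The obstacle in the lower bound is that a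
    single prime has to avoid infinitely many elements of the base, over a field that may be
    uncountable, so that they cannot be treated one at a time; hence the finite-dimensional pieces.
    Denominators may give R itself uncountable dimension. The pieces are therefore taken in the
    algebra of finite type of which R is a localization, whose elements represent those of R up to
    units. *)

Section IdealBasics.
Variable A : comPzRingType.
Implicit Types (I J P Q : set A) (s : seq A).

Lemma ideal0 I : is_ideal I -> I 0. Proof. by case. Qed.
Lemma idealD I x y : is_ideal I -> I x -> I y -> I (x + y).
Proof. by case=> _ + _; apply. Qed.
Lemma idealMl I a x : is_ideal I -> I x -> I (a * x).
Proof. by case=> _ _; apply. Qed.
Lemma idealMr I a x : is_ideal I -> I x -> I (x * a).
Proof. by rewrite mulrC; apply: idealMl. Qed.
Lemma idealN I x : is_ideal I -> I x -> I (- x).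
Proof. by move=> iI Ix; rewrite -mulN1r; apply: idealMl. Qed.
Lemma idealB I x y : is_ideal I -> I x -> I y -> I (x - y).
Proof. by move=> iI Ix Iy; apply: idealD => //; apply: idealN. Qed.
Lemma idealDr I x y : is_ideal I -> I y -> I (x + y) -> I x.
Proof. by move=> iI Iy Ixy; rewrite -[x](addrK y); apply: idealB. Qed.
Lemma ideal_sum I (T : Type) (r : seq T) (p : pred T) F : is_ideal I ->
  (forall i, p i -> I (F i)) -> I (\sum_(i <- r | p i) F i).
Proof.
move=> iI IF; elim/big_ind : _ => //; first exact: ideal0.
by move=> x y; apply: idealD.
Qed.

Lemma prime_is_ideal P : is_prime_ideal P -> is_ideal P. Proof. by case. Qed.
Lemma prime_neq1 P : is_prime_ideal P -> ~ P 1. Proof. by case. Qed.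
Lemma primeM P x y : is_prime_ideal P -> P (x * y) -> P x \/ P y.
Proof. by case=> _ _; apply. Qed.
Lemma primeMn P x y : is_prime_ideal P -> ~ P x -> ~ P y -> ~ P (x * y).
Proof. by move=> pP Px Py /(primeM pP)[]. Qed.
Lemma primeX P x n : is_prime_ideal P -> P (x ^+ n) -> P x.
Proof.
move=> pP; elim: n => [|n IH]; first by rewrite expr0 => /(prime_neq1 pP).
by rewrite exprS => /(primeM pP)[].
Qed.

Lemma setT_ideal : is_ideal [set: A]. Proof. by []. Qed.
Lemma set0_ideal : is_ideal [set 0 : A].
Proof. by split=> [|x y -> ->|a x ->] //=; rewrite ?addr0 ?mulr0. Qed.

Definition add_ideal I J : set A := [set z | exists x y, [/\ I x, J y & z = x + y]].
Definition principal (f : A) : set A := [set z | exists d, z = f * d].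

Lemma add_ideal_ideal I J : is_ideal I -> is_ideal J -> is_ideal (add_ideal I J).
Proof.
move=> iI iJ; split.
- by exists 0, 0; rewrite addr0; split=> //; apply: ideal0.
- move=> _ _ [x [y [Ix Jy ->]]] [u [v [Iu Jv ->]]].
  by exists (x + u), (y + v); split; [exact: idealD|exact: idealD|ring].
- move=> a _ [x [y [Ix Jy ->]]]; exists (a * x), (a * y).
  by rewrite mulrDr; split=> //; apply: idealMl.
Qed.

Lemma principal_ideal f : is_ideal (principal f).
Proof.
split=> [|_ _ [x ->] [y ->]|a _ [x ->]].
- by exists 0; rewrite mulr0.
- by exists (x + y); rewrite mulrDr.
- by exists (a * x); ring.
Qed.
Lemma principal_gen f : principal f f. Proof. by exists 1; rewrite mulr1. Qed.

Lemma add_ideall I J : is_ideal J -> I `<=` add_ideal I J.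
Proof. by move=> iJ x Ix; exists x, 0; rewrite addr0; split=> //; apply: ideal0. Qed.
Lemma add_idealr I J : is_ideal I -> J `<=` add_ideal I J.
Proof. by move=> iI x Jx; exists 0, x; rewrite add0r; split=> //; apply: ideal0. Qed.
Lemma add_ideal_sub I J K : is_ideal K -> I `<=` K -> J `<=` K -> add_ideal I J `<=` K.
Proof. by move=> iK IK JK _ [x [y [Ix Jy ->]]]; apply: idealD; auto. Qed.
Lemma principal_sub f K : is_ideal K -> K f -> principal f `<=` K.
Proof. by move=> iK Kf _ [d ->]; apply: idealMr. Qed.

Definition lin s (c : nat -> A) := \sum_(i < size s) c i * s`_i.
Definition span s : set A := [set x | exists c, x = lin s c].

Lemma span_ideal s : is_ideal (span s).
Proof.
split.
- by exists (fun=> 0); rewrite /lin big1 // => i _; rewrite mul0r.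
- move=> _ _ [c ->] [d ->]; exists (fun i => c i + d i).
  by rewrite /lin -big_split /=; apply: eq_bigr => i _; rewrite mulrDl.
- move=> a _ [c ->]; exists (fun i => a * c i).
  by rewrite /lin mulr_sumr; apply: eq_bigr => i _; rewrite mulrA.
Qed.

Lemma span_gen s x : x \in s -> span s x.
Proof.
move=> xs; exists (fun i => (i == index x s)%:R).
have lt : (index x s < size s)%N by rewrite index_mem.
rewrite /lin (bigD1 (Ordinal lt)) //= eqxx mul1r nth_index // big1 ?addr0 //.
move=> i ni; case: eqP => [e|_]; last by rewrite mul0r.
by case/eqP: ni; apply: val_inj.
Qed.

Lemma span_sub s I : is_ideal I -> (forall x, x \in s -> I x) -> span s `<=` I.
Proof.
by move=> iI sI _ [c ->]; apply: ideal_sum => // i _; apply: idealMl => //; apply/sI/mem_nth.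
Qed.

Definition fgen_ideal I := exists s, (forall x, x \in s -> I x) /\ I `<=` span s.

End IdealBasics.

Definition noetherian (A : comPzRingType) := forall I : set A, is_ideal I -> fgen_ideal I.

Lemma preim_ideal (A B : comPzRingType) (f : {rmorphism A -> B}) (I : set B) :
  is_ideal I -> is_ideal (f @^-1` I).
Proof.
move=> iI; split=> /= [|x y|a x].
- by rewrite rmorph0; apply: ideal0.
- by rewrite rmorphD; apply: idealD.
- by rewrite rmorphM; apply: idealMl.
Qed.

Lemma preim_prime (A B : comPzRingType) (f : {rmorphism A -> B}) (P : set B) :
  is_prime_ideal P -> is_prime_ideal (f @^-1` P).
Proof.
move=> pP; split; first exact/preim_ideal/prime_is_ideal.
- by rewrite /= rmorph1; apply: prime_neq1.
- by move=> x y; rewrite /= rmorphM; apply: primeM.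
Qed.

Section Noetherian.
Variable A : comPzRingType.
Hypothesis nA : noetherian A.
Implicit Types (I J P Q : set A).

Lemma ideal_acc (I : nat -> set A) : (forall n, is_ideal (I n)) ->
  (forall n, I n `<=` I n.+1) -> exists n, forall m, I m `<=` I n.
Proof.
move=> iI inc.
have mono m n : (m <= n)%N -> I m `<=` I n.
  elim: n => [|n IH]; first by rewrite leqn0 => /eqP ->.
  by rewrite leq_eqVlt => /predU1P[->//|/IH sub x /sub /inc].
pose U : set A := [set x | exists n, I n x].
have iU : is_ideal U.
  split=> [|x y [m Ix] [n Iy]|a x [m Ix]]; first by exists 0%N; apply: ideal0.
    exists (maxn m n); apply: idealD => //; first exact: (mono _ _ (leq_maxl _ _)).
    exact: (mono _ _ (leq_maxr _ _)).
  by exists m; apply: idealMl.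
have [s [sU Us]] := nA iU.
have [n sn] : exists n, forall x, x \in s -> I n x.
  elim: s sU {Us} => [|x s IH] sU; first by exists 0%N.
  have [n Hn] := IH (fun y ys => sU y (mem_behead (s := x :: s) ys)).
  have [m Hm] := sU x (mem_head _ _).
  exists (maxn m n) => y; rewrite inE => /predU1P[->|/Hn].
    exact: (mono _ _ (leq_maxl _ _)).
  exact: (mono _ _ (leq_maxr _ _)).
by exists n => m x Ix; apply: (span_sub (iI n) sn); apply: Us; exists m.
Qed.

Lemma ideal_max (F : set (set A)) : (exists I, F I) -> F `<=` @is_ideal A ->
  exists I, F I /\ forall J, F J -> I `<=` J -> J `<=` I.
Proof.
move=> [I0 FI0] Fi; apply: contrapT => nomax.
have next (I : {I | F I}) : exists J : {I | F I}, sval I `<=` sval J /\ ~ sval J `<=` sval I.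
  apply: contrapT => no; apply: nomax; exists (sval I); split; first exact: (svalP I).
  move=> J FJ IJ; apply: contrapT => JI; apply: no.
  by exists (exist _ J FJ).
have [nx nxP] := choice next.
pose s n := iter n nx (exist _ I0 FI0).
have [n Hn] := @ideal_acc (fun n => sval (s n)) (fun n => Fi _ (svalP (s n))) (fun n => (nxP (s n)).1).
exact: (nxP (s n)).2 (Hn n.+1).
Qed.

Lemma prime_exists I (S : set A) : is_ideal I -> is_mult_closed S ->
  (forall x, I x -> ~ S x) ->
  exists P, [/\ is_prime_ideal P, I `<=` P & forall x, P x -> ~ S x].
Proof.
move=> iI [S1 SM] dis.
pose F : set (set A) := fun J => [/\ is_ideal J, I `<=` J & forall x, J x -> ~ S x].
have [P [[iP IP dP] mP]] := @ideal_max F (ex_intro _ I (And3 iI (fun x => id) dis)) (fun J h => let: And3 a _ _ := h in a).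
have grow x : ~ P x -> exists d, exists2 p, P p & S (p + x * d).
  move=> Px; apply: contrapT => no; apply: Px.
  apply: (mP (add_ideal P (principal x))); last 1 first.
  - exact/add_idealr/principal_gen.
  - split; first exact/add_ideal_ideal/principal_ideal.
      by move=> y /IP; apply/add_ideall/principal_ideal.
    move=> _ [p [_ [Pp [d ->] ->]]] Sx; apply: no; exists d; by exists p.
  - exact/add_ideall/principal_ideal.
exists P; split=> //; split=> // [P1|x y Pxy]; first exact: (dP 1).
apply: contrapT => /not_orP[/grow[d [p Pp Sp]] /grow[e [q Pq Sq]]].
apply: (dP _ _ (SM _ _ Sp Sq)).
have -> : (p + x * d) * (q + y * e) = p * (q + y * e) + (x * d) * q + (d * e) * (x * y).
  by ring.
by apply: idealD (idealMl _ iP Pxy) => //; apply: idealD (idealMl _ iP Pq) => //; apply: idealMr.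
Qed.

Lemma prime_over I : is_ideal I -> ~ I 1 -> exists P, is_prime_ideal P /\ I `<=` P.
Proof.
move=> iI I1.
have [||P [pP IP _]] := @prime_exists I [set 1] iI; last by exists P.
- by split=> // x y -> ->; rewrite mulr1.
- by move=> x Ix x1; apply: I1; rewrite -x1.
Qed.

Lemma finite_min_primes I : is_ideal I -> exists n (P : nat -> set A),
  (forall i, (i < n)%N -> is_prime_ideal (P i) /\ I `<=` P i) /\
  (forall Q, is_prime_ideal Q -> I `<=` Q -> exists2 i, (i < n)%N & P i `<=` Q).
Proof.
move=> iI; apply: contrapT => bad.
pose good (I : set A) := exists n (P : nat -> set A),
  (forall i, (i < n)%N -> is_prime_ideal (P i) /\ I `<=` P i) /\
  (forall Q, is_prime_ideal Q -> I `<=` Q -> exists2 i, (i < n)%N & P i `<=` Q).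
have [J [[iJ bJ] mJ]] := @ideal_max (fun J => is_ideal J /\ ~ good J)
  (ex_intro _ I (conj iI bad)) (fun J h => h.1).
have big K : is_ideal K -> J `<=` K -> ~ K `<=` J -> good K.
  by move=> iK JK KJ; apply: contrapT => gK; apply: KJ; apply: mJ.
have J1 : ~ J 1.
  move=> J1; apply: bJ; exists 0%N, (fun=> setT); split=> // Q pQ /(_ _ J1).
  by move/(prime_neq1 pQ).
have nP : ~ is_prime_ideal J.
  by move=> pJ; apply: bJ; exists 1%N, (fun=> J); split=> [i _|Q _ JQ]; [split|exists 0%N].
have [x [y [Jxy Jx Jy]]] : exists x y, [/\ J (x * y), ~ J x & ~ J y].
  apply: contrapT => no; apply: nP; split=> // x y Jxy.
  by apply: contrapT => /not_orP[Jx Jy]; apply: no; exists x, y.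
have add z : ~ J z -> good (add_ideal J (principal z)).
  move=> Jz; apply: big.
  - exact/add_ideal_ideal/principal_ideal.
  - exact/add_ideall/principal_ideal.
  - by move=> sub; apply/Jz/sub/add_idealr => //; apply: principal_gen.
have [m [P [P1 P2]]] := add x Jx; have [n [P' [P1' P2']]] := add y Jy.
apply: bJ; exists (m + n)%N, (fun i => if (i < m)%N then P i else P' (i - m)%N).
have subJ z : J `<=` add_ideal J (principal z) by exact/add_ideall/principal_ideal.
split=> [i|Q pQ JQ].
  case: (ltnP i m) => [im _|mi imn].
    by have [? JP] := P1 i im; split=> // t /subJ /JP.
  have [|? JP] := P1' (i - m)%N; first by rewrite ltn_subLR.
  by split=> // t /subJ /JP.
have iQ := prime_is_ideal pQ.
case: (primeM pQ (JQ _ Jxy)) => Qz.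
  have [|i im PQ] := P2 Q pQ; first by apply: add_ideal_sub => //; apply: principal_sub.
  by exists i; rewrite ?im // ltn_addr.
have [|i im PQ] := P2' Q pQ; first by apply: add_ideal_sub => //; apply: principal_sub.
by exists (m + i)%N; rewrite ?ltn_add2l // ltnNge leq_addr /= addKn.
Qed.

End Noetherian.

Lemma inter_not_sub_prime (A : comPzRingType) (I Q : set A) n (P : nat -> set A) :
  is_prime_ideal Q -> is_ideal I -> (forall i, (i < n)%N -> is_ideal (P i)) ->
  ~ I `<=` Q -> (forall i, (i < n)%N -> ~ P i `<=` Q) ->
  exists y, [/\ I y, ~ Q y & forall i, (i < n)%N -> P i y].
Proof.
move=> pQ iI; elim: n => [|n IH] iP /existsNP[w /not_implyP[Iw Qw]] PQ.
  by exists w.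
have [|||y [Iy Qy yP]] := IH; [by move=> i /ltnW/iP|by move/(_ _ Iw)|by move=> i /ltnW/PQ|].
have /existsNP[v /not_implyP[Pv Qv]] := PQ n (leqnn _).
exists (y * v); split; [exact: idealMr|exact: primeMn|move=> i].
rewrite ltnS leq_eqVlt => /predU1P[->|iln]; first by apply: idealMl => //; apply: iP.
by apply: idealMr; [exact/iP/ltnW|exact: yP].
Qed.

Lemma prime_avoidance (A : comPzRingType) (I : set A) n (P : nat -> set A) :
  is_ideal I -> (forall i, (i < n)%N -> is_prime_ideal (P i)) ->
  (forall i, (i < n)%N -> ~ I `<=` P i) ->
  exists2 x, I x & forall i, (i < n)%N -> ~ P i x.
Proof.
move=> iI; elim: n P => [|n IH] P pP IP; first by exists 0 => //; apply: ideal0.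
have pn := pP n (leqnn _).
(* If [P j] lies in [P n], avoiding [P n] is enough: it takes the place of [P j] in the shorter
   list. *)
have [[j jn Pjn]|no] := pselect (exists2 j, (j < n)%N & P j `<=` P n).
  have [||x Ix xP] := IH (fun i => if i == j then P n else P i).
  - by move=> i /ltnW/pP; case: ifP.
  - by move=> i /ltnW/IP; case: ifP => // _ _; apply: IP.
  have Pnx : ~ P n x by have := xP j jn; rewrite eqxx.
  exists x => // i; rewrite ltnS leq_eqVlt => /predU1P[->//|/xP].
  by case: eqP => // -> _ /Pjn.
have [||x Ix xP] := IH P; [by move=> i /ltnW/pP|by move=> i /ltnW/IP|].
have [Pnx|Pnx] := pselect (P n x); last first.
  by exists x => // i; rewrite ltnS leq_eqVlt => /predU1P[->|/xP].
have [|||y [Iy Pny yP]] := @inter_not_sub_prime A I (P n) n P pn iI.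
- by move=> i /ltnW/pP/prime_is_ideal.
- exact: IP.
- by move=> i iln Pin; apply: no; exists i.
exists (x + y) => [|i]; first exact: idealD.
rewrite ltnS leq_eqVlt => /predU1P[->|iln].
  by rewrite addrC => /(idealDr (prime_is_ideal pn) Pnx).
move/(idealDr (prime_is_ideal (pP _ (ltnW iln))) (yP _ iln)).
exact: xP.
Qed.

(** * Hilbert basis theorem, Artin-Rees lemma, Krull intersection *)

Section Hilbert.
Variable A : comNzRingType.
Hypothesis nA : noetherian A.

Lemma noetherian_poly : noetherian {poly A}.
Proof.
move=> I iI.
(* A bound on the size, rather than an exact degree, makes [L d] an ideal; multiplication by ['X]
   makes [L] increase. *)
pose L d : set A := [set a | exists p : {poly A}, [/\ I p, (size p <= d.+1)%N & p`_d = a]].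
have iL d : is_ideal (L d).
  split.
  - by exists 0; rewrite size_poly0 coef0; split=> //; apply: ideal0.
  - move=> _ _ [p [Ip sp <-]] [q [Iq sq <-]]; exists (p + q); split; first exact: idealD.
      by rewrite (leq_trans (size_polyD _ _)) // geq_max sp.
    by rewrite coefD.
  - move=> a _ [p [Ip sp <-]]; exists (a%:P * p); split; first exact: idealMl.
      by rewrite mul_polyC (leq_trans (size_scale_leq _ _)).
    by rewrite coefCM.
have Linc d : L d `<=` L d.+1.
  move=> _ [p [Ip sp <-]]; exists (p * 'X); split; first exact: idealMr.
    by rewrite (leq_trans (size_polyMleq _ _)) // size_polyX addnC.
  by rewrite coefMX.
have [D LD] := ideal_acc nA iL Linc.
have /choice[G GP] d : exists G : seq {poly A},
    (forall p, p \in G -> I p /\ (size p <= d.+1)%N) /\ L d `<=` span [seq (p : {poly A})`_d | p <- G].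
  have [s [sL Ls]] := nA (iL d).
  have [G [GI Gs]] : exists G : seq {poly A},
      (forall p, p \in G -> I p /\ (size p <= d.+1)%N) /\ [seq (p : {poly A})`_d | p <- G] = s.
    elim: s sL {Ls} => [|x s IH] sL; first by exists [::].
    have [|G [GP <-]] := IH; first by move=> y ys; apply: sL; rewrite inE ys orbT.
    have [p [Ip sp <-]] := sL x (mem_head _ _).
    by exists (p :: G); split=> // q; rewrite inE => /predU1P[->|/GP].
  by exists G; rewrite Gs.
pose gens := flatten [seq G d | d <- iota 0 D.+1].
have gensP d p : (d <= D)%N -> p \in G d -> p \in gens.
  by move=> dD pG; apply/flattenP; exists (G d) => //; apply: map_f; rewrite mem_iota.
exists gens; split=> [p /flattenP[_ /mapP[d _ ->]] /(GP d).1[]//|].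
have iJ := span_ideal gens.
suff red n f : I f -> (size f <= n)%N -> span gens f by move=> f If; exact: (red (size f)).
elim: n f => [|n IH] f If; first by rewrite leqn0 size_poly_eq0 => /eqP->; apply: ideal0.
(* Above the degree [D] where [L] stabilizes, generators of degree [D] times a power of ['X] cancel
   the leading term. *)
move=> sf; pose e := minn n D.
have Lf : L e f`_n.
  rewrite /e; case: (leqP n D) => nD; first by exists f.
  by apply: (LD n); exists f.
have : [set a | exists h : {poly A}, [/\ I h, span gens h, (size h <= e.+1)%N & h`_e = a]] f`_n.
  apply: span_sub ((GP e).2 _ Lf).
    split.
    - by exists 0; rewrite size_poly0 coef0; split=> //; apply: ideal0.
    - move=> _ _ [p [Ip Jp sp <-]] [q [Iq Jq sq <-]]; exists (p + q).
      split; [exact: idealD|exact: idealD| |by rewrite coefD].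
      by rewrite (leq_trans (size_polyD _ _)) // geq_max sp.
    - move=> a _ [p [Ip Jp sp <-]]; exists (a%:P * p).
      split; [exact: idealMl|exact: idealMl| |by rewrite coefCM].
      by rewrite mul_polyC (leq_trans (size_scale_leq _ _)).
  move=> _ /mapP[p pG ->]; have [Ip sp] := (GP e).1 p pG.
  by exists p; split=> //; apply: span_gen; apply: gensP pG; rewrite geq_minr.
move=> [h [Ih Jh sh hE]].
pose h' := h * 'X^(n - e).
have eE : (e + (n - e))%N = n by rewrite subnKC // geq_minl.
suff Jfh : span gens (f - h') by rewrite -[f](subrK h'); apply: idealD => //; apply: idealMr.
apply: IH; first by apply: idealB => //; apply: idealMr.
apply/leq_sizeP => j nj; rewrite coefB coefMXn.
have -> : (j < n - e)%N = false by apply/negbTE; rewrite -leqNgt (leq_trans (leq_subr _ _)).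
have [<-|nj'] := eqVneq n j.
  by rewrite -[X in (X - _)%N]eE addnK hE subrr.
have ltnj : (n < j)%N by rewrite ltn_neqAle nj'.
rewrite (nth_default _ (leq_trans sf ltnj)) nth_default ?subr0 //.
by apply: leq_trans sh _; rewrite ltn_subRL addnC eE.
Qed.

End Hilbert.

Lemma noetherian_surj (A B : comPzRingType) (f : {rmorphism A -> B}) :
  (forall b, exists a, f a = b) -> noetherian A -> noetherian B.
Proof.
move=> surj nA I iI; have [s [sI Is]] := nA _ (preim_ideal f iI).
exists [seq f x | x <- s]; split=> [_ /mapP[x xs ->]|x Ix]; first exact: sI.
have [a fa] := surj x; have := Is a; rewrite /= fa => /(_ Ix) [c aE].
exists (fun i => f (c i)); rewrite -fa aE /lin rmorph_sum size_map.
by apply: eq_bigr => i _; rewrite rmorphM (nth_map 0).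
Qed.

Section Powers.
Variables (A : comPzRingType) (g : seq A).

(** The ideal power $(g)^l$ as nested linear combinations along [g], the form in which successive
    approximation delivers its elements. *)
Fixpoint pw l : set A :=
  if l is l'.+1 then [set x | exists c, (forall i, pw l' (c i)) /\ x = lin g c] else setT.

Lemma pw_ideal l : is_ideal (pw l).
Proof.
elim: l => [|l IH]; first exact: setT_ideal A.
split.
- exists (fun=> 0); split=> [_|]; first exact: ideal0.
  by rewrite /lin big1 // => i _; rewrite mul0r.
- move=> _ _ [c [lc ->]] [d [ld ->]]; exists (fun i => c i + d i).
  split=> [i|]; first exact: idealD IH (lc i) (ld i).
  by rewrite /lin -big_split /=; apply: eq_bigr => i _; rewrite mulrDl.
- move=> a _ [c [lc ->]]; exists (fun i => a * c i); split=> [i|]; first exact: idealMl IH (lc i).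
  by rewrite /lin mulr_sumr; apply: eq_bigr => i _; rewrite mulrA.
Qed.

Lemma pwS_sub l : pw l.+1 `<=` pw l.
Proof.
move=> _ [c [lc ->]]; apply: ideal_sum; first exact: pw_ideal.
by move=> i _; apply: idealMr; [exact: pw_ideal|exact: lc].
Qed.

Lemma pw_sub m n : (m <= n)%N -> pw n `<=` pw m.
Proof.
elim: n => [|n IH]; first by rewrite leqn0 => /eqP->.
by rewrite leq_eqVlt => /predU1P[->//|/IH sub x /pwS_sub /sub].
Qed.

Lemma pwD m n x y : pw m x -> pw n y -> pw (m + n) (x * y).
Proof.
elim: m x => [|m IH] x; first by move=> _ ny; apply: idealMl => //; apply: pw_ideal.
move=> [c [lc ->]] ny; exists (fun i => c i * y); split=> [i|]; first exact: IH (lc i) ny.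
by rewrite /lin mulr_suml; apply: eq_bigr => i _; ring.
Qed.

Lemma pw_gen x : x \in g -> pw 1 x.
Proof. by move=> /span_gen[c ->]; exists c. Qed.

Lemma pw1E : pw 1 = span g.
Proof. by apply/seteqP; split=> x [c]; [move=> [_ ->]|move=> ->]; exists c. Qed.

Lemma pwX x n : pw 1 x -> pw n (x ^+ n).
Proof.
move=> x1; elim: n => [//|n IH]; rewrite exprS -[n.+1]/(1 + n)%N; exact: pwD.
Qed.

End Powers.

Section Rees.
Variables (X : comNzRingType) (g : seq X).
Hypothesis nX : noetherian X.

Definition in_rees (F : {poly X}) := forall i, pw g i F`_i.

(** The Rees algebra is reached as the image of an iterated polynomial ring, with one variable for
    each generator [y], sent to [y *: 'X]. Hilbert's theorem makes the source Noetherian, and graded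
    ideals are studied through their preimages there. *)
Lemma rees_image (g' : seq X) : (forall x, x \in g' -> x \in g) ->
  exists (S : comNzRingType) (f : {rmorphism S -> {poly X}}),
    [/\ noetherian S, forall s, in_rees (f s), forall x, exists s, f s = x%:P &
        forall x, x \in g' -> exists s, f s = x *: 'X].
Proof.
elim: g' => [|y g' IH] sub.
  exists X, polyC; split=> // [s i|x]; last by exists x.
  by rewrite coefC; case: eqP => [->|_]; [exact: I|apply: ideal0; exact: pw_ideal].
have [|S [f [nS fR fC fX]]] := IH; first by move=> x xg; apply: sub; rewrite inE xg orbT.
pose F : {rmorphism {poly S} -> {poly X}} := horner_morph (fun s => mulrC (y *: 'X) (f s)).
have FC s : F s%:P = f s by exact: horner_morphC.
have FX : F 'X = y *: 'X by exact: horner_morphX.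
exists {poly S}, F; split.
- exact: noetherian_poly.
- elim/poly_ind => [|p s IHp] i.
    by rewrite rmorph0 coef0; apply: ideal0; exact: pw_ideal.
  rewrite rmorphD rmorphM FC FX coefD; apply: idealD; [exact: pw_ideal| |exact: fR].
  rewrite -scalerAr coefZ coefMX; case: i => [|i]; first exact: I.
  exact: (@pwD _ g 1 i _ _ (pw_gen (sub _ (mem_head _ _))) (IHp i)).
- by move=> x; have [s <-] := fC x; exists s%:P.
- move=> x; rewrite inE => /predU1P[->|/fX[s <-]]; last by exists s%:P.
  by exists 'X.
Qed.

(* The graded ideal [\oplus H l] of the Rees algebra is finitely generated. The
   conclusion is phrased through additive sets [T], so that no bookkeeping of
   coefficients is needed. *)
Lemma rees_gens_nz (H : nat -> set X) : (forall l, is_ideal (H l)) ->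
  (forall l, H l `<=` pw g l) ->
  (forall m l x y, pw g m x -> H l y -> H (m + l)%N (x * y)) ->
  exists gs : seq (nat * X), (forall p, p \in gs -> H p.1 p.2) /\
    forall l w, H l w -> forall T : set X, T 0 -> (forall x y, T x -> T y -> T (x + y)) ->
      (forall p, p \in gs -> (p.1 <= l)%N -> forall b, pw g (l - p.1) b -> T (b * p.2)) -> T w.
Proof.
move=> iH Hpw HM.
have [S [f [nS fR fC fX]]] := @rees_image g (fun x h => h).
have mono l w : pw g l w -> exists s, f s = w *: 'X^l.
  elim: l w => [|l IH] w; first by have [s sE] := fC w; exists s; rewrite sE expr0 alg_polyC.
  move=> [c [lc ->]]; rewrite /lin.
  have /choice[u uP] : forall i : 'I_(size g), exists s, f s = (c i * g`_i) *: 'X^(l.+1).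
    move=> i; have [s sE] := IH _ (lc i); have [t tE] := fX _ (mem_nth 0 (ltn_ord i)).
    by exists (s * t); rewrite rmorphM sE tE -scalerAl -scalerAr scalerA exprSr.
  exists (\sum_i u i); rewrite rmorph_sum scaler_suml; exact: eq_bigr.
pose J : set S := [set s | forall i, H i (f s)`_i].
have iJ : is_ideal J.
  split=> [i|s t Js Jt i|s t Jt i].
  - by rewrite rmorph0 coef0; apply: ideal0.
  - by rewrite rmorphD coefD; apply: idealD.
  - rewrite rmorphM coefMr; apply: ideal_sum => // j _.
    rewrite -{1}(subnK (ltn_ord j : j <= i)%N); apply: HM; [exact: fR|exact: Jt].
have [s [sJ Js]] := nS J iJ.
(* The homogeneous components of the images of the generators of [J], tagged with their degrees. *)
pose gs := flatten [seq [seq (j, (f x)`_j) | j <- iota 0 (size (f x))] | x <- s].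
exists gs; split=> [p /flattenP[_ /mapP[x xs ->] /mapP[j _ ->]]|l w Hw T T0 TD Tgs].
  exact: sJ.
have [t tE] := mono _ _ (Hpw _ _ Hw).
have /Js[c tc] : J t.
  move=> i; rewrite tE coefZ coefXn; case: eqP => [->|_]; first by rewrite mulr1.
  by rewrite mulr0; apply: ideal0.
have -> : w = (f t)`_l by rewrite tE coefZ coefXn eqxx mulr1.
rewrite tc /lin rmorph_sum coef_sum; elim/big_ind : _ => // i _.
rewrite rmorphM coefMr; elim/big_ind : _ => // j _.
have [big|small] := leqP (size (f s`_i)) j; first by rewrite [X in _ * X]nth_default // mulr0.
apply: (Tgs (nat_of_ord j, (f s`_i)`_j)) => /=; [|exact: ltn_ord j|exact: fR].
apply/flattenP; exists [seq (j, (f s`_i)`_j) | j <- iota 0 (size (f s`_i))].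
  by apply: (map_f (fun x => [seq (j, (f x)`_j) | j <- iota 0 (size (f x))])); apply: mem_nth.
by apply: (map_f (fun j => (j, (f s`_i)`_j))); rewrite mem_iota.
Qed.

End Rees.

Lemma rees_gens (X : comPzRingType) (g : seq X) (H : nat -> set X) : noetherian X ->
  (forall l, is_ideal (H l)) -> (forall l, H l `<=` pw g l) ->
  (forall m l x y, pw g m x -> H l y -> H (m + l)%N (x * y)) ->
  exists gs : seq (nat * X), (forall p, p \in gs -> H p.1 p.2) /\
    forall l w, H l w -> forall T : set X, T 0 -> (forall x y, T x -> T y -> T (x + y)) ->
      (forall p, p \in gs -> (p.1 <= l)%N -> forall b, pw g (l - p.1) b -> T (b * p.2)) -> T w.
Proof.
move=> nX iH Hpw HM; have [t1|nt] := eqVneq (1 : X) 0.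
  exists [::]; split=> // l w _ T T0 _ _.
  by rewrite -[w]mulr1 t1 mulr0.
pose X' : comNzRingType := HB.pack (X : Type) (GRing.ComPzRing.class X) (GRing.PzSemiRing_isNonZero.Build X nt).
exact: (@rees_gens_nz X' g nX H).
Qed.

(** The intersections of the powers of [(g)] with [(f) + I] form a graded ideal over the Rees
    algebra. The constant [c] is the largest degree of its generators, so in degree [l] their
    coefficients have degree at least [l - c]. *)
Lemma artin_rees (X : comPzRingType) (g : seq X) (f : X) (I : set X) :
  noetherian X -> is_ideal I -> exists c, forall l w, pw g l w ->
    add_ideal (principal f) I w ->
    exists y e, [/\ pw g (l - c) y, I e & w = f * y + e].
Proof.
move=> nX iI.
pose K := add_ideal (principal f) I.
have iK : is_ideal K by apply: add_ideal_ideal => //; apply: principal_ideal.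
have [|||gs [gsH gsP]] := @rees_gens X g (fun l => pw g l `&` K) nX.
- move=> l; have iP := pw_ideal g l; split; first by split; apply: ideal0.
    by move=> x y [? ?] [? ?]; split; apply: idealD.
  by move=> a x [? ?]; split; apply: idealMl.
- by move=> l x [].
- by move=> m l x y xm [yl Ky]; split; [exact: pwD|exact: idealMl].
exists (\max_(p <- gs) p.1) => l w lw Kw.
apply: (gsP l w (conj lw Kw) [set w | exists y e, [/\ pw g (l - \max_(p <- gs) p.1) y, I e & w = f * y + e]]).
- by exists 0, 0; rewrite mulr0 addr0; split=> //; apply: ideal0 => //; apply: pw_ideal.
- move=> _ _ [y [e [ly Ie ->]]] [y' [e' [ly' Ie' ->]]]; exists (y + y'), (e + e').
  by split; [apply: idealD => //; exact: pw_ideal|exact: idealD|ring].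
move=> p pgs pl b lb; have [_ [_ [e [[x ->] Ie pE]]]] := gsH p pgs.
rewrite pE; exists (b * x), (b * e); split; [|exact: idealMl|ring].
apply: idealMr; first exact: pw_ideal.
by apply: pw_sub lb; rewrite leq_sub2l //; apply: (@leq_bigmax_seq _ gs xpredT (fun p => p.1)).
Qed.

(** Artin-Rees with [f := x]: an element of $(g)^{c+1}$ congruent to [x] modulo [I] is also
    congruent to [x * y] with [y] in [(g)]. *)
Lemma krull_intersection (X : comPzRingType) (g : seq X) (I : set X) x :
  noetherian X -> is_ideal I ->
  (forall l, exists2 w, pw g l w & I (x - w)) -> exists2 y, pw g 1 y & I (x * (1 - y)).
Proof.
move=> nX iI xl; have [c cP] := artin_rees g x nX iI.
have [w lw Ixw] := xl c.+1.
have [|y [e [ly Ie wE]]] := cP _ _ lw.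
  exists x, (- (x - w)); split; [exact: principal_gen|exact: idealN|ring].
rewrite subSnn in ly; exists y => //.
have -> : x * (1 - y) = (x - w) + e by rewrite wE; ring.
exact: idealD.
Qed.

(** * Chains of primes, quotients and localizations *)

Section Chains.
Variable A : comPzRingType.
Implicit Types (P Q : set A).

(** Links are added at the top, the end from which [chain_through] works its way down. The endpoints
    are plain sets, so that contractions and extensions can be rewritten without bundled primality
    proofs. *)
Inductive chain : nat -> set A -> set A -> Prop :=
| chain_nil P : is_prime_ideal P -> chain 0 P P
| chain_rcons m P Q Q' : chain m P Q -> is_prime_ideal Q' -> Q `<` Q' -> chain m.+1 P Q'.

Lemma chain_primer m P Q : chain m P Q -> is_prime_ideal Q.
Proof. by case. Qed.

Lemma chain_primel m P Q : chain m P Q -> is_prime_ideal P.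
Proof. by elim. Qed.

Lemma chain_sub m P Q : chain m P Q -> P `<=` Q.
Proof.
elim=> [{}P _ //|{}m {}P {}Q Q' _ PQ _ [QQ' _] x Px].
exact/QQ'/PQ.
Qed.

Lemma chain_cat m n P Q Q' : chain m P Q -> chain n Q Q' -> chain (m + n) P Q'.
Proof.
move=> c1 c2; elim: c2 c1 => [{}Q _|{}n {}Q Q1 Q2 _ IH pQ2 lt] c1; first by rewrite addn0.
by rewrite addnS; apply: chain_rcons lt => //; apply: IH.
Qed.

Lemma chain1 P Q : is_prime_ideal P -> is_prime_ideal Q -> P `<` Q -> chain 1 P Q.
Proof. by move=> pP pQ lt; apply: chain_rcons lt => //; apply: chain_nil. Qed.

Lemma chain_cons m P Q Q' : is_prime_ideal P -> P `<` Q -> chain m Q Q' -> chain m.+1 P Q'.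
Proof. by move=> pP lt c; rewrite -add1n; apply: (chain_cat (chain1 pP (chain_primel c) lt) c). Qed.

Lemma chain_proper m P Q : chain m.+1 P Q -> ~ Q `<=` P.
Proof.
move E: m.+1 => n c; case: c E => // k P1 Q1 Q2 c _ [_ nsub] _ sub.
by apply: nsub => x /sub /(chain_sub c).
Qed.

Lemma chain_le0 m P Q : chain m P Q -> Q `<=` P -> m = 0%N.
Proof. by case: m => // m /chain_proper. Qed.

Lemma chain_eq m P Q : is_prime_ideal P -> P `<=` Q -> Q `<=` P -> m = 0%N -> chain m P Q.
Proof.
move=> pP PQ QP ->; have -> : Q = P by apply/seteqP.
exact: chain_nil.
Qed.

End Chains.

Lemma chain_map (A B : comPzRingType) (F : set A -> set B) m P Q : chain m P Q ->
  (forall Q', is_prime_ideal Q' -> P `<=` Q' -> Q' `<=` Q -> is_prime_ideal (F Q')) ->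
  (forall Q1 Q2, is_prime_ideal Q1 -> is_prime_ideal Q2 -> P `<=` Q1 -> Q2 `<=` Q ->
     Q1 `<` Q2 -> F Q1 `<` F Q2) ->
  chain m (F P) (F Q).
Proof.
elim=> [{}P pP pF _|{}m {}P {}Q Q' c IH pQ' lt pF mF]; first exact/chain_nil/pF.
have PQ := chain_sub c; have QQ' := lt.1.
apply: chain_rcons (IH _ _) _ _.
- by move=> T pT PT TQ; apply: pF => // x /TQ /QQ'.
- by move=> Q1 Q2 p1 p2 P1 Q2Q l; apply: mF => // x /Q2Q /QQ'.
- by apply: pF => // x /PQ /QQ'.
- by apply: mF => //; apply: chain_primer c.
Qed.

(* Covers quotients, localizations and their compositions. *)
Definition fracmap (A B : comPzRingType) (e : A -> B) :=
  forall d, exists a s u, e s * u = 1 /\ d * e s = e a.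

Section FracMap.
Variables (A B : comPzRingType) (e : {rmorphism A -> B}).
Hypothesis fe : fracmap e.

Definition frac_ext (P : set A) : set B :=
  [set d | exists a s u, [/\ P a, e s * u = 1 & d * e s = e a]].

Lemma fracmap_noetherian : noetherian A -> noetherian B.
Proof.
move=> nA I iI; have [s [sI Is]] := nA _ (preim_ideal e iI).
exists (map e s); split=> [_ /mapP[x xs ->]|d Id]; first exact: sI.
have [a [t [u [tu dt]]]] := fe d.
have [|c ac] := Is a; first by rewrite /= -dt; apply: idealMr.
exists (fun i => u * e (c i)).
have -> : d = u * e a by rewrite -dt -{1}[d]mulr1 -tu; ring.
rewrite ac /lin rmorph_sum size_map mulr_sumr.
by apply: eq_bigr => i _; rewrite rmorphM (nth_map 0) // mulrA.
Qed.

Lemma fracmap_sub (I J : set B) : is_ideal I -> is_ideal J ->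
  e @^-1` I `<=` e @^-1` J -> I `<=` J.
Proof.
move=> iI iJ IJ d Id; have [a [s [u [su ds]]]] := fe d.
have -> : d = u * e a by rewrite -ds -{1}[d]mulr1 -su; ring.
by apply: idealMl => //; apply: IJ; rewrite /= -ds; apply: idealMr.
Qed.

Lemma fracmap_lt (I J : set B) : is_ideal I -> is_ideal J -> I `<` J ->
  e @^-1` I `<` e @^-1` J.
Proof.
move=> iI iJ [IJ JI]; split=> [x /IJ //|sub]; apply: JI; exact: fracmap_sub.
Qed.

Lemma chain_preim m P Q : chain m P Q -> chain m (e @^-1` P) (e @^-1` Q).
Proof.
move=> c; apply: (chain_map (F := fun Q => e @^-1` Q) c) => [Q' pQ' _ _|Q1 Q2 p1 p2 _ _].
  exact: preim_prime.
by apply: fracmap_lt; apply: prime_is_ideal.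
Qed.

(** For a prime [P], this characterizes the contractions of primes of [B]. *)
Definition frac_ok (P : set A) :=
  (forall s u, e s * u = 1 -> ~ P s) /\ (forall x, e x = 0 -> P x).

Lemma frac_extK P : is_prime_ideal P -> frac_ok P -> e @^-1` frac_ext P = P.
Proof.
move=> pP [nu ker]; have iP := prime_is_ideal pP.
apply/seteqP; split=> x.
  move=> [a [s [u [Pa su xs]]]].
  have : P (x * s - a) by apply: ker; rewrite rmorphB rmorphM xs subrr.
  move=> /(fun h => idealD iP h Pa); rewrite subrK => /(primeM pP)[//|].
  by move/nu: su.
by move=> Px; exists x, 1, 1; rewrite rmorph1 !mulr1; split.
Qed.

Lemma frac_ext_prime P : is_prime_ideal P -> frac_ok P -> is_prime_ideal (frac_ext P).
Proof.
move=> pP okP; have iP := prime_is_ideal pP; have K := frac_extK pP okP.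
have inE' a : frac_ext P (e a) <-> P a by rewrite -{2}K.
split.
- split.
  + by exists 0, 1, 1; rewrite rmorph0 rmorph1 mul0r mulr1; split=> //; apply: ideal0.
  + move=> x y [a [s [u [Pa su xs]]]] [b [t [v [Pb tv yt]]]].
    exists (a * t + b * s), (s * t), (u * v); split.
    * by apply: idealD => //; apply: idealMr.
    * by rewrite rmorphM -[1]mulr1 -{1}su -tv; ring.
    * by rewrite rmorphD !rmorphM -xs -yt; ring.
  + move=> d x [a [s [u [Pa su xs]]]]; have [b [t [v [tv dt]]]] := fe d.
    exists (b * a), (t * s), (v * u); split; first exact: idealMl.
      by rewrite rmorphM -[1]mulr1 -{1}su -tv; ring.
    by rewrite !rmorphM -xs -dt; ring.
- by rewrite -(rmorph1 e) inE'; apply: prime_neq1.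
- move=> x y [a [s [u [Pa su xys]]]].
  have [b [t [v [tv xt]]]] := fe x; have [c [r [w [rw yr]]]] := fe y.
  have : frac_ext P (e (b * c)).
    exists (a * t * r), s, u; split=> //; first by do 2 apply: idealMr => //.
    by rewrite !rmorphM -xys -xt -yr; ring.
  rewrite inE' => /(primeM pP)[Pb|Pc]; [left; exists b, t, v|right; exists c, r, w]; by split.
Qed.

Lemma frac_ext_lt P Q : is_prime_ideal P -> frac_ok P -> is_prime_ideal Q -> frac_ok Q ->
  P `<` Q -> frac_ext P `<` frac_ext Q.
Proof.
move=> pP okP pQ okQ [PQ QP]; split=> [d [a [s [u [/PQ Qa su ds]]]]|sub].
  by exists a, s, u.
apply: QP; rewrite -(frac_extK pP okP) -(frac_extK pQ okQ) => x; exact: sub.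
Qed.

Lemma chain_ext m P Q : chain m P Q -> (forall s u, e s * u = 1 -> ~ Q s) ->
  (forall x, e x = 0 -> P x) -> chain m (frac_ext P) (frac_ext Q).
Proof.
move=> c nu ker; apply: (chain_map c) => [Q' pQ' PQ' Q'Q|Q1 Q2 p1 p2 PQ1 Q2Q lt].
  apply: frac_ext_prime => //; split=> [s u /nu + /Q'Q //|x /ker /PQ' //].
apply: frac_ext_lt => //.
  by split=> [s u /nu h /lt.1 /Q2Q //|x /ker /PQ1 //].
by split=> [s u /nu h /Q2Q //|x /ker /PQ1 /lt.1 //].
Qed.

End FracMap.

Lemma fracmap_comp (A B C : comPzRingType) (e : {rmorphism A -> B}) (f : {rmorphism B -> C}) :
  fracmap e -> fracmap f -> fracmap (f \o e).
Proof.
move=> fe ff d; have [b [t [v [tv dt]]]] := ff d.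
have [a [s [u [su bs]]]] := fe b; have [c [r [w [rw tr]]]] := fe t.
have ws : f (e s) * f u = 1 by rewrite -rmorphM su rmorph1.
have wr : f (e r) * f w = 1 by rewrite -rmorphM rw rmorph1.
exists (a * r), (c * s), (v * f u * f w); split=> /=.
  by rewrite rmorphM rmorphM -tr rmorphM -[1]mulr1 -{1}ws -[f (e s) * f u]mulr1 -{1}wr -tv; ring.
by rewrite !rmorphM /= -tr -bs !rmorphM -dt; ring.
Qed.

Section Quotient.
Variables (A : comPzRingType) (I : ideal A).
Definition quot_pi (x : A) : quot_ring I := \pi_(quot_ring I)%qT x.

Lemma quot_pi_zmod : zmod_morphism quot_pi.
Proof. by move=> x y; rewrite /quot_pi pi_quot_opp pi_quot_add. Qed.
Lemma quot_pi_monoid : monoid_morphism quot_pi.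
Proof. by split=> // x y; rewrite /quot_pi -pi_quot_mul. Qed.
HB.instance Definition _ := GRing.isZmodMorphism.Build A (quot_ring I) quot_pi quot_pi_zmod.
HB.instance Definition _ := GRing.isMonoidMorphism.Build A (quot_ring I) quot_pi quot_pi_monoid.

Lemma quot_pi_surj y : exists x, quot_pi x = y.
Proof. by exists (repr y); rewrite /quot_pi reprK. Qed.

Lemma quot_pi_frac : fracmap quot_pi.
Proof.
move=> d; have [a <-] := quot_pi_surj d.
by exists a, 1, 1; rewrite rmorph1 !mulr1.
Qed.

Lemma quot_pi_eq0 x : quot_pi x = 0 <-> (I : set A) x.
Proof. by rewrite -(rmorph0 quot_pi) quot_ringP subr0. Qed.

End Quotient.

Section LocalizationFacts.
Variables (A : comPzRingType) (S : mult_set A).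

Lemma loc_embed_unit s : (S : set A) s -> exists u, loc_embed S s * u = 1.
Proof.
move=> Ss; have sS : s \in (S : set A) by apply/mem_set.
exists (loc_frac 1 (exist _ s sS)); rewrite -[LHS]/(loc_mul _ _) loc_mulE.
by apply: loc_frac_eq => /=; ring.
Qed.

Lemma loc_embed_fracP d : exists a s, (S : set A) s /\ d * loc_embed S s = loc_embed S a.
Proof.
have [a [s ->]] := loc_fracE d; exists a, (sval s); split; first exact/set_mem/valP.
by rewrite -[LHS]/(loc_mul _ _) loc_mulE; apply: loc_frac_eq => /=; ring.
Qed.

Lemma loc_embed_frac : fracmap (loc_embed S).
Proof.
move=> d; have [a [s [Ss dE]]] := loc_embed_fracP d.
by have [u su] := loc_embed_unit Ss; exists a, s, u.
Qed.

Lemma loc_embed_eq0 x : loc_embed S x = 0 <-> exists s, (S : set A) s /\ s * x = 0.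
Proof.
rewrite -(rmorph0 (loc_embed S)) loc_fracP /=; split=> -[s [Ss sx]]; exists s; split=> //.
  by move: sx; rewrite !mulr1 mulr0.
by rewrite !mulr1 mulr0.
Qed.

Lemma loc_embed_unitP x u : loc_embed S x * u = 1 -> exists y, (S : set A) (x * y).
Proof.
have [a [s [Ss dE]]] := loc_embed_fracP u => xu.
have [_ SM] := mult_setP S.
have /eqP : loc_embed S (x * a - s) = 0.
  by rewrite rmorphB rmorphM /= -dE mulrA xu mul1r subrr.
move/eqP/loc_embed_eq0 => [t [St]]; rewrite mulrBr => /eqP; rewrite subr_eq0 => /eqP tE.
exists (a * t); have -> : x * (a * t) = t * (x * a) by ring.
by rewrite tE; apply: SM.
Qed.

End LocalizationFacts.

(** [D] is the local domain $(A/P)_Q$, presented by its calculus of fractions so that the two-step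
    construction stays inside this proof. *)
Lemma local_domain_at (A : comPzRingType) (P Q : set A) : noetherian A ->
  is_prime_ideal P -> is_prime_ideal Q -> P `<=` Q ->
  exists (D : comPzRingType) (e : {rmorphism A -> D}),
    [/\ noetherian D, forall x, e x = 0 <-> P x,
        forall d, exists a s, ~ Q s /\ d * e s = e a,
        forall s, ~ Q s <-> exists u, e s * u = 1 &
        forall x y : D, x * y = 0 -> x = 0 \/ y = 0].
Proof.
move=> nA pP pQ PQ; pose IP := Ideal (prime_is_ideal pP).
have mS : is_mult_closed (@quot_pi A IP @` (~` Q)).
  split; first by exists 1; rewrite ?rmorph1 //; apply: prime_neq1.
  by move=> _ _ [x Qx <-] [y Qy <-]; exists (x * y); rewrite ?rmorphM //; apply: primeMn.
pose S := MultSet mS; pose e : {rmorphism A -> localization S} := loc_embed S \o @quot_pi A IP.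
have fe : fracmap e := fracmap_comp (@quot_pi_frac A IP) (@loc_embed_frac _ S).
have e0 x : e x = 0 <-> P x.
  split=> [/loc_embed_eq0[_ [[s Qs <-]]]|Px].
    by rewrite -rmorphM => /quot_pi_eq0 /(primeM pP)[/PQ|].
  by rewrite /e /= (proj2 (quot_pi_eq0 _ _)) ?rmorph0.
have frac d : exists a s, ~ Q s /\ d * e s = e a.
  have [b [_ [[s Qs <-] dE]]] := @loc_embed_fracP _ S d.
  have [a aE] := quot_pi_surj b; exists a, s; split=> //.
  by rewrite /e /= aE.
have eu s : ~ Q s <-> exists u, e s * u = 1.
  split=> [Qs|[u /loc_embed_unitP[y [t Qt]]]].
    by apply: loc_embed_unit; exists s.
  have [y' <-] := quot_pi_surj y; rewrite -rmorphM => /quot_ringP /= ts.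
  move=> Qs; apply: Qt; have iQ := prime_is_ideal pQ.
  by rewrite -[t](subrK (s * y')); apply: idealD => //; [exact: (PQ _ ts)|exact: idealMr].
exists (localization S), e; split=> //; first exact: fracmap_noetherian nA.
move=> x y xy; have [a [s [Qs xs]]] := frac x; have [b [t [Qt yt]]] := frac y.
have [u su] := (eu s).1 Qs; have [v tv] := (eu t).1 Qt.
have : e (a * b) = 0 by rewrite rmorphM -xs -yt -[RHS](mul0r (e s * e t)) -xy; ring.
move/e0 => /(primeM pP)[] /e0 z; [left|right].
  by rewrite -[x]mulr1 -su mulrA xs z mul0r.
by rewrite -[y]mulr1 -tv mulrA yt z mul0r.
Qed.

(** * Krull's principal ideal theorem *)

Lemma chain_rconsP (A : comPzRingType) m (P Q : set A) : chain m.+1 P Q ->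
  exists Q1, [/\ chain m P Q1, is_prime_ideal Q & Q1 `<` Q].
Proof.
move E: m.+1 => k c; case: c E => // k' P1 Q1 Q2 c pQ2 lt [mk].
by rewrite -mk in c; exists Q1.
Qed.

Section LocalKrull.
Variables (D : comPzRingType) (N : set D) (f : D).
Hypothesis nD : noetherian D.
Hypothesis pN : is_prime_ideal N.
Hypothesis unitN : forall x, ~ N x -> exists u, x * u = 1.
Hypothesis Nf : N f.
Hypothesis minN : forall Q, is_prime_ideal Q -> Q f -> N `<=` Q.

Definition dcc_above (I : set D) := forall J : nat -> set D,
  (forall n, is_ideal (J n)) -> (forall n, I `<=` J n) -> (forall n, J n.+1 `<=` J n) ->
  exists n0, forall n, J n0 `<=` J n.

Lemma decr_sub (J : nat -> set D) m n : (forall n, J n.+1 `<=` J n) -> (m <= n)%N -> J n `<=` J m.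
Proof.
move=> dJ; elim: n => [|n IH]; first by rewrite leqn0 => /eqP->.
by rewrite leq_eqVlt => /predU1P[->//|/IH sub x /dJ /sub].
Qed.

Lemma decr_stab (J : nat -> set D) n0 : (forall n, J n.+1 `<=` J n) ->
  (forall n, (n0 <= n)%N -> J n0 `<=` J n) -> forall n, J n0 `<=` J n.
Proof.
by move=> dJ st n; case: (leqP n0 n) => [/st//|/ltnW nn]; apply: decr_sub.
Qed.

(* This replaces the fact that the local ring modulo f is Artinian: for an ideal
   I maximal among the counterexamples, an associated prime of I is N, so some x
   outside I satisfies N x <= I and the property passes from I + (x) to I. *)
Lemma dcc_above_minimal (I0 : set D) : is_ideal I0 -> I0 f -> dcc_above I0.
Proof.
move=> iI0 I0f; apply: contrapT => bad.
have [I [[iI If ndI] mI]] := ideal_max nD (F := fun I => [/\ is_ideal I, I f & ~ dcc_above I])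
  (ex_intro _ I0 (And3 iI0 I0f bad)) (fun I h => let: And3 a _ _ := h in a).
have I1 : ~ I 1.
  move=> I1; apply: ndI => J iJ IJ _; exists 0%N => n x _.
  by rewrite -[x]mulr1; apply: idealMl => //; apply: IJ.
pose col x := [set d | I (x * d)].
have [K [[x Ix KE] mK]] := ideal_max nD (F := fun K => exists2 x, ~ I x & K = col x)
  (ex_intro _ (col 1) (ex_intro2 _ _ 1 I1 erefl))
  (fun K h => let: ex_intro2 x _ e := h in
     eq_ind_r (@is_ideal D) (And3 (eq_ind_r I (ideal0 iI) (mulr0 x))
       (fun a b Ia Ib => eq_ind_r I (idealD iI Ia Ib) (mulrDr x a b))
       (fun a b Ib => eq_ind_r I (idealMl a iI Ib) (mulrCA x a b))) e).
have iK : is_ideal K.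
  rewrite KE /col; split=> /= [|a b|a b]; first by rewrite mulr0; apply: ideal0.
    by rewrite mulrDr; apply: idealD.
  by rewrite mulrCA; apply: idealMl.
have pK : is_prime_ideal K.
  split=> // [|a b]; first by rewrite KE /col /= mulr1.
  rewrite {1}KE /col /= => Kab; apply: contrapT => /not_orP[Ka Kb]; apply: Ka.
  have Kb' : ~ I (x * b) by move: Kb; rewrite KE.
  apply: (mK (col (x * b))); first by exists (x * b).
    by rewrite KE /col => d /= xd; rewrite mulrAC; apply: idealMr.
  by rewrite /col /= mulrAC -mulrA.
have NK : N `<=` K by apply: minN => //; rewrite KE /col /=; apply: idealMl.
have NI d : N d -> I (x * d) by move/NK; rewrite KE.
have dccJ : dcc_above (add_ideal I (principal x)).
  apply: contrapT => nd; apply: Ix; apply: (mI (add_ideal I (principal x))).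
  - split=> //; first by apply: add_ideal_ideal => //; apply: principal_ideal.
    by apply: add_ideall If; apply: principal_ideal.
  - by apply: add_ideall; apply: principal_ideal.
  - by apply: add_idealr => //; apply: principal_gen.
apply: ndI => J iJ IJ dJ.
have [allx|/existsNP[n2 Jx]] := pselect (forall n, J n x).
  by apply: dccJ => // n; apply: add_ideal_sub => //; apply: principal_sub.
have [n|n|n|n1 n1P] := dccJ (fun n => add_ideal (J n) (principal x)).
- by apply: add_ideal_ideal => //; apply: principal_ideal.
- move=> _ [a [b [Ia xb ->]]]; exists a, b; split=> //; exact: IJ.
- move=> _ [a [b [Ia xb ->]]]; exists a, b; split=> //; exact: dJ.
(* From [n1] on the ideals [J n + (x)] are constant, and from [n2] on [x] is missing from [J n].
   Hence in [y = y' + x * d] the factor [d] cannot be a unit; it lies in [N], and [x * d] lies in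
   [I]. *)
exists (maxn n1 n2); apply: decr_stab => // n nn y Jy.
have Jx' : ~ J (maxn n1 n2) x by move/(decr_sub dJ (leq_maxr n1 n2)).
have [|y' [_ [Jy' [d ->] yE]]] := n1P n y.
  by apply: add_ideall; [exact: principal_ideal|exact: decr_sub (leq_maxl _ _) _ Jy].
have Jxd : J (maxn n1 n2) (x * d).
  have -> : x * d = y - y' by rewrite yE; ring.
  by apply: idealB => //; apply: decr_sub nn _ Jy'.
rewrite yE; apply: idealD => //; apply: IJ; apply: NI; apply: contrapT => /unitN[u du].
by apply: Jx'; rewrite -[x]mulr1 -du mulrA; apply: idealMr.
Qed.

Hypothesis dom : forall x y : D, x * y = 0 -> x = 0 \/ y = 0.

(** Krull's argument with the symbolic powers [sp n] of [P]. Modulo [f] they stabilize; since [f] is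
    outside [P], an element of [sp n0] is [f] times another one modulo [sp n]. Iteration and Krull's
    intersection theorem place [sp n0] inside every later [sp n]. *)
Lemma local_pit (P : set D) : is_prime_ideal P -> P `<=` N -> ~ N `<=` P -> forall x, P x -> x = 0.
Proof.
move=> pP PN NP y0 Py0; have iP := prime_is_ideal pP.
have Pf : ~ P f by move=> Pf; apply: NP; apply: minN.
have [g [gP Pg]] := nD iP.
have spanP : span g `<=` P by exact: span_sub.
pose sp n : set D := [set x | exists2 s, ~ P s & pw g n (s * x)].
have isp n : is_ideal (sp n).
  have ip := pw_ideal g n; split.
  - by exists 1; [exact: prime_neq1|rewrite mulr0; apply: ideal0].
  - move=> x y [s Ps sx] [t Pt ty]; exists (s * t); first exact: primeMn.
    have -> : s * t * (x + y) = t * (s * x) + s * (t * y) by ring.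
    by apply: idealD => //; apply: idealMl.
  - by move=> a x [s Ps sx]; exists s => //; rewrite mulrCA; apply: idealMl.
have dsp n : sp n.+1 `<=` sp n by move=> x [s Ps /pwS_sub sx]; exists s.
have ifd := principal_ideal f.
have [n|n|n|n0 st] := dcc_above_minimal ifd (principal_gen f) (J := fun n => add_ideal (sp n) (principal f)).
- exact: add_ideal_ideal.
- exact: add_idealr.
- by move=> _ [a [b [Ia xb ->]]]; exists a, b; split=> //; exact: dsp.
have key n x : (n0 <= n)%N -> sp n0 x -> sp n x.
  move=> nn; move=> spx.
  have step z : sp n0 z -> exists2 d, sp n0 d & sp n (z - f * d).
    move=> spz; have [|z' [_ [z'n [d ->] zE]]] := st n z; first exact: add_ideall spz.
    exists d; last by have -> : z - f * d = z' by rewrite zE; ring.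
    have : sp n0 (f * d).
      have -> : f * d = z - z' by rewrite zE; ring.
      by apply: idealB => //; apply: decr_sub nn _ z'n.
    by move=> [s Ps sfd]; exists (s * f); [exact: primeMn|rewrite -mulrA].
  have iter l : exists2 d, sp n0 d & sp n (x - f ^+ l * d).
    elim: l => [|l [d spd xd]]; first by exists x; rewrite // expr0 mul1r subrr; apply: ideal0.
    have [d' spd' dd'] := step d spd; exists d' => //.
    have -> : x - f ^+ l.+1 * d' = (x - f ^+ l * d) + f ^+ l * (d - f * d') by rewrite exprS; ring.
    by apply: idealD => //; apply: idealMl.
  have [l|y y1 xy] := @krull_intersection D [:: f] (sp n) x nD (isp n).
    have [d _ xd] := iter l; exists (f ^+ l * d) => //.
    by apply: idealMr; [exact: pw_ideal|apply/pwX/pw_gen; rewrite mem_head].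
  have Ny : N y.
    move: y1; rewrite pw1E; apply: span_sub; first exact: prime_is_ideal.
    by move=> z; rewrite inE => /eqP->.
  have [u yu] : exists u, (1 - y) * u = 1.
    apply: unitN => N1y; apply: (prime_neq1 pN); rewrite -(subrK y 1).
    by apply: idealD => //; apply: prime_is_ideal.
  by rewrite -[x]mulr1 -yu mulrA; apply: idealMr.
pose x := y0 ^+ n0.
have spx : sp n0 x.
  exists 1; first exact: prime_neq1.
  by rewrite mul1r; apply: pwX; rewrite pw1E; apply: Pg.
(* Artin-Rees for [(x)] turns [s * x] in a high power of [(g)] into [s * x = x * y] with [y] in [P];
   as [s] is outside [P], the domain forces [x = 0]. *)
have [c cP] := artin_rees g x nD (set0_ideal D).
have [s Ps sx] := key (maxn n0 c.+1) x (leq_maxl _ _) spx.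
have [||y [e [ly -> sxE]]] := cP c.+1 (s * x).
- by apply: pw_sub sx; apply: leq_maxr.
- by exists (s * x), 0; rewrite addr0; split=> //; exists s; ring.
rewrite subSnn pw1E in ly.
have : x * (s - y) = 0 by rewrite mulrBr mulrC sxE addr0 subrr.
case/dom => [x0|sy0]; last first.
  by case: Ps; rewrite (_ : s = y) ?(subr0_eq sy0) //; apply: spanP.
have exp0 n : y0 ^+ n = 0 -> y0 = 0.
  elim: n => [|n IH]; last by rewrite exprS => /dom[|/IH].
  by rewrite expr0 => z; case: (prime_neq1 pP); rewrite z; apply: ideal0.
exact: exp0 x0.
Qed.

End LocalKrull.

Section Krull.
Variable A : comPzRingType.
Hypothesis nA : noetherian A.
Implicit Types (P Q : set A).

Lemma krull_pit P Q f : is_prime_ideal P -> is_prime_ideal Q -> P `<=` Q -> Q f ->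
  (forall Q', is_prime_ideal Q' -> P `<=` Q' -> Q' f -> Q' `<=` Q -> Q `<=` Q') ->
  forall P', is_prime_ideal P' -> P `<=` P' -> P' `<` Q -> P' `<=` P.
Proof.
move=> pP pQ PQ Qf minQ P' pP' PP' [P'Q QP'].
have [D [e [nD e0 eF eU dom]]] := local_domain_at nA pP pQ PQ.
have fe : fracmap e.
  by move=> d; have [a [s [/eU[u su] ds]]] := eF d; exists a, s, u.
have okQ T : P `<=` T -> T `<=` Q -> frac_ok e T.
  move=> PT TQ; split=> [s u su /TQ|x /e0 /PT //].
  by apply: ((eU s).2 _); exists u.
have okQ' := okQ Q PQ (fun x h => h); have okP' := okQ P' PP' P'Q.
have pN := frac_ext_prime fe pQ okQ'.
have NK := frac_extK pQ okQ'; have P'K := frac_extK pP' okP'.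
have iQ := prime_is_ideal pQ.
have unitN x : ~ frac_ext e Q x -> exists u, x * u = 1.
  move=> Nx; have [a [s [Qs xs]]] := eF x; have [u su] := (eU s).1 Qs.
  have Qa : ~ Q a by move=> Qa; apply: Nx; exists a, s, u.
  have [v av] := (eU a).1 Qa; exists (e s * v); by rewrite mulrA xs.
have sub := @local_pit D (frac_ext e Q) (e f) nD pN unitN.
move=> x P'x; apply/e0; apply: (sub _ _ dom (frac_ext e P')).
- by rewrite -NK in Qf.
- move=> T pT Tf; apply: (fracmap_sub fe); [exact: prime_is_ideal|exact: prime_is_ideal|].
  rewrite NK; apply: minQ => //; first exact: preim_prime.
    by move=> z Pz; rewrite /= ((e0 z).2 Pz); apply: ideal0; apply: prime_is_ideal.
  move=> z Tz; apply: contrapT => /eU[u zu]; apply: (prime_neq1 pT).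
  by rewrite -zu; apply: idealMr => //; apply: prime_is_ideal.
- exact: frac_ext_prime.
- move=> d [a [s [u [/P'Q Qa su ds]]]]; by exists a, s, u.
- move=> sub'; apply: QP'; rewrite -NK -P'K => z; exact: sub'.
- by rewrite -P'K in P'x.
Qed.

Lemma minimal_prime_below P Q f : is_prime_ideal P -> is_prime_ideal Q -> P `<=` Q -> Q f ->
  exists Q', [/\ is_prime_ideal Q', P `<=` Q', Q' f, Q' `<=` Q &
    forall T, is_prime_ideal T -> P `<=` T -> T f -> T `<=` Q' -> Q' `<=` T].
Proof.
move=> pP pQ PQ Qf.
pose I := add_ideal P (principal f).
have iI : is_ideal I by apply: add_ideal_ideal; [exact: prime_is_ideal|exact: principal_ideal].
have [n [R [R1 R2]]] := finite_min_primes nA iI.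
have PI : P `<=` I by apply: add_ideall; exact: principal_ideal.
have If : I f by apply: add_idealr; [exact: prime_is_ideal|exact: principal_gen].
have IT T : is_prime_ideal T -> P `<=` T -> T f -> I `<=` T.
  by move=> pT PT Tf; apply: add_ideal_sub => //; [exact: prime_is_ideal|
     apply: principal_sub => //; exact: prime_is_ideal].
have [i iln RQ] := R2 Q pQ (IT Q pQ PQ Qf).
(* Descent inside the finite list [R]: [m] bounds the number of members contained in [R i], and a
   prime strictly below [R i] leads to a member whose count excludes [R i]. *)
have : forall m i, (i < n)%N -> R i `<=` Q -> (#|[pred j : 'I_n | `[< R j `<=` R i >]]| <= m)%N ->
  exists Q', [/\ is_prime_ideal Q', P `<=` Q', Q' f, Q' `<=` Q &
    forall T, is_prime_ideal T -> P `<=` T -> T f -> T `<=` Q' -> Q' `<=` T].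
  elim=> [|m IH] {RQ iln}i iln RQ.
    rewrite leqn0 => /eqP/card0_eq/(_ (Ordinal iln)); rewrite inE /= => /asboolP[] //.
  move=> sz; have [pR IR] := R1 i iln.
  have [[T [pT PT Tf TR RT]]|no] := pselect (exists T, [/\ is_prime_ideal T, P `<=` T, T f,
    T `<=` R i & ~ R i `<=` T]).
    have [j jn RjT] := R2 T pT (IT T pT PT Tf).
    apply: (IH j jn) => [x /RjT /TR /RQ //|].
    rewrite -ltnS; apply: leq_trans sz; apply: proper_card.
    apply/properP; split.
      by apply/fintype.subsetP => l; rewrite !inE /= => Rl x /Rl /RjT /TR.
    exists (Ordinal iln); first by rewrite inE.
    by rewrite inE; apply/negP => /asboolP RR; apply: RT => x /RR /RjT.
  exists (R i); split=> //; [by move=> x /PI /IR|exact: IR|].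
  move=> T pT PT Tf TR; apply: contrapT => RT; apply: no.
  by exists T.
by move/(_ _ i iln RQ (leqnn _)).
Qed.

(** The element is pushed down the chain. If the last prime but one, [Q1], misses [f], it is
    replaced by a prime [Q'] minimal over [f] and the prime [Q0] before. By the principal ideal
    theorem [Q'] is not [Q], since [Q1] lies strictly between [Q0] and [Q]. Only the bottom link is
    lost. *)
Lemma chain_through m P Q f : chain m.+1 P Q -> Q f ->
  exists P', [/\ P `<=` P', P' f & chain m P' Q].
Proof.
elim: m Q => [|m IH] Q /chain_rconsP[Q1 [c pQ lt]] Qf.
  exists Q; split=> //; last exact: chain_nil.
  by move=> x /(chain_sub c) /lt.1.
have [Q1f|Q1f] := pselect (Q1 f).
  have [P' [PP' P'f c']] := IH _ c Q1f.
  by exists P'; split=> //; apply: chain_rcons lt.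
have [Q0 [c0 pQ1 lt0]] := chain_rconsP c.
have pQ0 := chain_primer c0.
have [|Q' [pQ' Q0Q' Q'f Q'Q mQ']] := @minimal_prime_below Q0 Q f pQ0 pQ _ Qf.
  by move=> x /lt0.1 /lt.1.
have lt' : Q0 `<` Q'.
  by split=> // sub; apply: Q1f; apply/lt0.1/sub.
have [QQ'|QQ'] := pselect (Q `<=` Q').
  case: lt0 => Q01 []; apply: (krull_pit pQ0 pQ _ Qf _ pQ1 Q01 lt) => [x /Q01 /lt.1 //|].
  by move=> T pT QT Tf TQ x /QQ'; apply: mQ' => // y /TQ /QQ'.
have [P' [PP' P'f c']] := IH _ (chain_rcons c0 pQ' lt') Q'f.
by exists P'; split=> //; apply: (chain_rcons c' pQ (conj Q'Q QQ')).
Qed.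

Lemma chain_through_seq m P Q (s : seq A) : chain m P Q -> (forall x, x \in s -> Q x) ->
  exists P' m', [/\ P `<=` P', forall x, x \in s -> P' x, chain m' P' Q & (m <= m' + size s)%N].
Proof.
elim: s m P => [|f s IH] m P c sQ; first by exists P, m; rewrite addn0; split.
have [|P1 [m1 [PP1 sP1 c1 le1]]] := IH m P c.
  by move=> x xs; apply: sQ; rewrite inE xs orbT.
have Qf := sQ f (mem_head _ _).
case: m1 c1 le1 => [|m1] c1 le1.
  exists Q, 0%N; split=> //; [exact: chain_sub c|exact/chain_nil/chain_primer/c|].
  by rewrite (leq_trans le1) // !add0n.
have [P' [P1P' P'f c']] := chain_through c1 Qf.
exists P', m1; split=> //; [by move=> x /PP1 /P1P'| |by rewrite addnS].
by move=> x; rewrite inE => /predU1P[->//|/sP1 /P1P'].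
Qed.

(** The parameters grow as long as each prime inside [Q] over [P] and [s] is the top of a chain from
    [P] with at least [size s] links; growth is measured by the ideal [P + (s)]. While [Q] is not
    minimal over it, prime avoidance supplies another parameter. *)
Lemma parameters P Q : is_prime_ideal P -> is_prime_ideal Q -> P `<=` Q ->
  exists (s : seq A) m, [/\ forall x, x \in s -> Q x, chain m P Q, (size s <= m)%N &
    forall T, is_prime_ideal T -> P `<=` T -> (forall x, x \in s -> T x) -> T `<=` Q -> Q `<=` T].
Proof.
move=> pP pQ PQ; have iP := prime_is_ideal pP; have iQ := prime_is_ideal pQ.
pose good (s : seq A) := (forall x, x \in s -> Q x) /\
  forall T, is_prime_ideal T -> P `<=` T -> (forall x, x \in s -> T x) -> T `<=` Q ->
    exists2 m, (size s <= m)%N & chain m P T.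
have good0 : good [::].
  split=> // T pT PT _ TQ; have [TP|TP] := pselect (T `<=` P).
    by exists 0%N => //; apply: chain_eq.
  by exists 1%N => //; apply: chain1.
have iJ s : is_ideal (add_ideal P (span s)) by apply: add_ideal_ideal => //; apply: span_ideal.
have [J [[s gs ->] mJ]] := ideal_max nA (F := fun J => exists2 s, good s & J = add_ideal P (span s))
  (ex_intro _ _ (ex_intro2 _ _ [::] good0 erefl))
  (fun J h => let: ex_intro2 s _ e := h in eq_ind_r (@is_ideal A) (iJ s) e).
have [sQ sT] := gs.
have JT T : is_prime_ideal T -> P `<=` T -> (forall x, x \in s -> T x) -> add_ideal P (span s) `<=` T.
  move=> /prime_is_ideal iT PT sT'; apply: add_ideal_sub => //; exact: span_sub.
have sJ x : x \in s -> add_ideal P (span s) x.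
  by move=> xs; apply: add_idealr => //; apply: span_gen.
have PJ : P `<=` add_ideal P (span s) by apply: add_ideall; apply: span_ideal.
have [[T0 [pT0 PT0 sT0 T0Q QT0]]|no] := pselect (exists T, [/\ is_prime_ideal T, P `<=` T,
    (forall x, x \in s -> T x), T `<=` Q & ~ Q `<=` T]); last first.
  have [m sm c] := sT Q pQ PQ sQ (fun x h => h).
  exists s, m; split=> // T pT PT sT' TQ; apply: contrapT => QT; apply: no.
  by exists T.
exfalso; have [n [R [R1 R2]]] := finite_min_primes nA (iJ s).
(* Members of the list containing [Q] cannot be avoided inside [Q]. The prime [T0], over [s] and
   strictly inside [Q], stands in for them. *)
pose R' i := if `[< Q `<=` R i >] then T0 else R i.
have R'1 i : (i < n)%N -> [/\ is_prime_ideal (R' i), add_ideal P (span s) `<=` R' i & ~ Q `<=` R' i].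
  move=> /R1[pR JR]; rewrite /R'; case: asboolP => QR; first by split=> //; apply: JT.
  by split.
have R'2 T : is_prime_ideal T -> P `<=` T -> (forall x, x \in s -> T x) -> T `<=` Q ->
    exists2 i, (i < n)%N & R' i `<=` T.
  move=> pT PT sT' TQ; have [i iln RT] := R2 T pT (JT T pT PT sT').
  exists i => //; rewrite /R'; case: asboolP => [QR x /T0Q /QR /RT //|//].
have [|i /R'1[] //|f Qf fR] := @prime_avoidance A Q n R' iQ; first by move=> i /R'1[].
have [i iln R'Q] := R'2 Q pQ PQ sQ (fun x h => h).
have [pR JR _] := R'1 i iln.
apply: (fR i iln); apply: JR; apply: (mJ (add_ideal P (span (f :: s)))); last 1 first.
- by apply: add_idealr => //; apply: span_gen; rewrite mem_head.
- exists (f :: s) => //; split=> [x|T pT PT sT' TQ].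
    by rewrite inE => /predU1P[->|/sQ].
  have sTs x : x \in s -> T x by move=> xs; apply: sT'; rewrite inE xs orbT.
  have [j jn RT] := R'2 T pT PT sTs TQ.
  have [pRj JRj _] := R'1 j jn.
  have [|||m sm c] := sT (R' j) pRj.
  + by move=> x /PJ /JRj.
  + by move=> x /sJ /JRj.
  + by move=> x /RT /TQ.
  exists m.+1 => //; apply: chain_rcons c pT _; split=> // sub.
  by apply: (fR j jn); apply/sub/sT'; rewrite mem_head.
- apply: add_ideal_sub => //.
    by apply: add_ideall; apply: span_ideal.
  apply: span_sub => // x xs; apply: add_idealr => //; apply: span_gen.
  by rewrite inE xs orbT.
Qed.

End Krull.

(** * Adic completions *)

Definition ext_ideal (A B : comPzRingType) (e : A -> B) (I : set A) : set B := ideal_gen (e @` I).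

Section ExtIdeal.
Variables (A B : comPzRingType) (e : {rmorphism A -> B}).
Implicit Types I : set A.

Lemma ext_ideal_ideal I : is_ideal (ext_ideal e I).
Proof. exact: idealP (ideal_gen _). Qed.

Lemma ext_ideal_gen I x : I x -> ext_ideal e I (e x).
Proof. by move=> Ix J [_ sJ]; apply: sJ; exists x. Qed.

Lemma ext_ideal_sub I (J : set B) : is_ideal J -> I `<=` e @^-1` J -> ext_ideal e I `<=` J.
Proof. by move=> iJ IJ x; apply; split=> // _ [y Iy <-]; apply: IJ. Qed.

Lemma ext_ideal_span I : noetherian A -> is_ideal I ->
  exists s, (forall x, x \in s -> I x) /\ ext_ideal e I = span [seq e x | x <- s].
Proof.
move=> nA iI; have [s [sI Is]] := nA I iI; exists s; split=> //; apply/seteqP; split.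
  apply: ext_ideal_sub; first exact: span_ideal.
  apply: (subset_trans Is); apply: span_sub; first exact/preim_ideal/span_ideal.
  by move=> x xs; apply: span_gen; apply: map_f.
apply: span_sub; first exact: ext_ideal_ideal.
by move=> _ /mapP[x xs ->]; apply: ext_ideal_gen; apply: sI.
Qed.

End ExtIdeal.

(** [K l] is the kernel of the projection from [C] to $X/(g)^l$; arguing with kernels keeps
    representatives of residue classes out of the analysis. *)
Record adic_completion (X C : comPzRingType) (i : {rmorphism X -> C}) (g : seq X)
    (K : nat -> set C) : Prop := AdicCompletion {
  ac_noeth : noetherian X;
  ac_ideal : forall l, is_ideal (K l);
  ac_K0 : forall x, K 0 x;
  ac_decr : forall l, K l.+1 `<=` K l;
  ac_approx : forall l x, exists a, K l (x - i a);
  ac_pre : forall l a, K l (i a) <-> pw g l a;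
  ac_sep : forall x, (forall l, K l x) -> x = 0;
  ac_complete : forall a : nat -> X, (forall l, pw g l (a l)) ->
    exists y, forall m, K m (y - i (\sum_(l < m) a l))
}.

Section AbstractCompletion.
Variables (X C : comPzRingType) (g : seq X) (i : {rmorphism X -> C}) (K : nat -> set C).
Hypothesis ac : adic_completion i g K.

Let nX := ac_noeth ac.
Let iK := ac_ideal ac.
Let K0 := ac_K0 ac.
Let dK := ac_decr ac.
Let Kapprox := ac_approx ac.
Let Kpre := ac_pre ac.
Let Ksep := ac_sep ac.
Let Kcomplete := ac_complete ac.

Lemma Ksub m n : (m <= n)%N -> K n `<=` K m.
Proof. exact: (decr_sub dK). Qed.

Lemma Kapprox_pw l m x : K l x -> (l <= m)%N -> exists2 a, pw g l a & K m (x - i a).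
Proof.
move=> Kx lm; have [a ax] := Kapprox m x; exists a => //; apply/Kpre.
have -> : i a = x - (x - i a) by ring.
by apply: idealB => //; apply: Ksub lm _ ax.
Qed.

Lemma KM l m x y : K l x -> K m y -> K (l + m) (x * y).
Proof.
move=> Kx Ky; have [a la ax] := Kapprox_pw Kx (leq_addr m l).
have [b mb yb] := Kapprox_pw Ky (leq_addl l m).
have -> : x * y = i a * i b + (x * (y - i b) + i b * (x - i a)) by ring.
apply: idealD => //; last by apply: idealD => //; apply: idealMl.
by rewrite -rmorphM; apply/Kpre/pwD.
Qed.

Lemma KX x n : K 1 x -> K n (x ^+ n).
Proof. by move=> Kx; elim: n => [//|n IH]; rewrite exprS -add1n; apply: KM. Qed.

(** The shift [c] admits terms that tend to 0 with a constant delay. Since [ac_complete] sums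
    sequences of [X] only, the partial sums are first approximated by elements of [X]. *)
Lemma series_limit c (t : nat -> C) : (forall n, K (n - c) (t n)) ->
  exists y, forall m, K m (y - \sum_(n < m + c) t n).
Proof.
move=> Kt; pose S m := \sum_(n < m + c) t n.
have /choice[a aP] m : exists a, K m (S m - i a) by exact: Kapprox.
have dS m : S m.+1 = S m + t (m + c)%N by rewrite /S addSn big_ord_recr.
have [l|y yP] := Kcomplete (a := fun m => a m.+1 - a m).
  apply/Kpre; rewrite rmorphB.
  have -> : i (a l.+1) - i (a l) = (S l - i (a l)) - (S l.+1 - i (a l.+1)) + t (l + c)%N.
    by rewrite dS; ring.
  by apply: idealD; [|apply: idealB => //; exact: dK|rewrite -{1}(addnK c l)].
exists (y + i (a 0%N)) => m; rewrite -/(S m).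
have tel : \sum_(l < m) (a l.+1 - a l) = a m - a 0%N.
  by rewrite -(big_mkord xpredT (fun l => a l.+1 - a l)) telescope_sumr.
have -> : y + i (a 0%N) - S m = (y - i (\sum_(l < m) (a l.+1 - a l))) - (S m - i (a m)).
  by rewrite tel rmorphB; ring.
exact: idealB.
Qed.

(** [J] is an invariant of the remainders: the whole ring when powers of [(g)] are studied, an ideal
    when generators are sought. The delay [c] is the same at every order, so the corrections along
    each member of [us] add up. *)
Lemma successive_approx (us : seq C) c l0 (J : set C) :
  (forall l u, (l0 <= l)%N -> J u -> K l u -> exists b : nat -> X,
     [/\ forall j, pw g (l - c) (b j), J (u - lin us (i \o b)) & K l.+1 (u - lin us (i \o b))]) ->
  forall u, J u -> K l0 u -> exists2 y, (forall j, K (l0 - c) (y j)) & u = lin us y.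
Proof.
move=> step u Ju Ku.
have /choice[nx nxP] (p : nat * C) : exists b : nat -> X, J p.2 -> K (l0 + p.1) p.2 ->
     [/\ forall j, pw g (l0 + p.1 - c) (b j), J (p.2 - lin us (i \o b)) &
     K (l0 + p.1).+1 (p.2 - lin us (i \o b))].
  have [[Jv Kv]|no] := pselect (J p.2 /\ K (l0 + p.1) p.2).
    by have [b bP] := step _ _ (leq_addr _ _) Jv Kv; exists b.
  by exists (fun=> 0) => Jv Kv; case: no.
pose U := fix U n := if n is n'.+1 then U n' - lin us (i \o nx (n', U n')) else u.
pose b n := nx (n, U n).
have UP n : J (U n) /\ K (l0 + n) (U n).
  elim: n => [|n [JU KU]]; first by rewrite addn0.
  by have [_ ? ?] := nxP (n, U n) JU KU; rewrite addnS.
have bP n j : K (l0 + n - c) (i (b n j)).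
  by have [JU KU] := UP n; apply/Kpre; have [h _ _] := nxP (n, U n) JU KU; apply: h.
have sumU m : u = U m + lin us (fun j => \sum_(n < m) i (b n j)).
  elim: m => [|m IH].
    by rewrite /lin big1 ?addr0 // => j _; rewrite big_ord0 mul0r.
  rewrite {1}IH /= -/(b m) -addrA; congr (_ + _).
  rewrite /lin -sumrN -big_split /=; apply: eq_bigr => j _.
  by rewrite big_ord_recr /=; ring.
have /choice[y yP] j : exists y, forall m, K m (y - \sum_(n < m + c) i (b n j)).
  by apply: (@series_limit c (fun n => i (b n j))) => n; refine (Ksub _ (bP n j)); rewrite leq_sub2r // leq_addl.
exists y => [j|].
  rewrite -[y j](subrK (\sum_(n < l0 + c) i (b n j))); apply: idealD => //.
    by refine (Ksub _ (yP j l0)); apply: leq_subr.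
  by apply: ideal_sum => // n _; refine (Ksub _ (bP n j)); rewrite leq_sub2r // leq_addr.
apply/eqP; rewrite -subr_eq0; apply/eqP/Ksep => m.
have -> : u - lin us y = U (m + c)%N - lin us (fun j => y j - \sum_(n < m + c) i (b n j)).
  rewrite {1}(sumU (m + c)%N) -addrA; congr (_ + _).
  by rewrite /lin -!sumrN -big_split /=; apply: eq_bigr => j _; ring.
apply: idealB => //.
  by refine (Ksub _ (UP (m + c)%N).2); rewrite addnCA leq_addr.
by apply: ideal_sum => // j _; apply: idealMr.
Qed.

(** Finiteness of [g] makes the kernels algebraic: infinitely many corrections along a generator add
    up to one coefficient, which by the delay 1 lies in the kernel one order lower. *)
Lemma completion_K1_ext l x : K l x -> pw [seq i y | y <- g] l x.
Proof.
elim: l x => [//|l IH] x Kx.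
have [m u lm _ Ku|y Ky ->] := @successive_approx [seq i y | y <- g] 1 l.+1 setT _ x I Kx.
  have [a am ua] := Kapprox_pw Ku (leqnSn m).
  case: m lm am Ku ua => [//|m] _ [b [bm aE]] Ku ua; exists b.
  suff -> : lin [seq i y | y <- g] (i \o b) = i a by split=> // j; rewrite subn1; exact: bm.
  rewrite aE /lin rmorph_sum size_map; apply: eq_bigr => j _.
  by rewrite rmorphM (nth_map 0).
by exists y; split=> // j; apply: IH; have := Ky j; rewrite subn1.
Qed.

(** [H l] consists of the initial forms of degree [l] of elements of [J]. Lifts of finitely many
    generators of this graded ideal generate [J] by successive approximation, with their largest
    degree as the delay. *)
Lemma completion_noetherian : noetherian C.
Proof.
move=> J iJ.
pose H l : set X := [set a | pw g l a /\ exists2 u, J u & K l.+1 (u - i a)].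
have [l|l a []//|m l x y mx [ly [u Ju uy]]|gs [gsH gsP]] := @rees_gens X g H nX.
- have iP := pw_ideal g l; split.
  + by split; [exact: ideal0|exists 0; rewrite ?rmorph0 ?subrr; exact: ideal0].
  + move=> a b [la [u Ju ua]] [lb [v Jv vb]]; split; first exact: idealD.
    exists (u + v); first exact: idealD.
    by rewrite rmorphD opprD addrACA; apply: idealD.
  + move=> a b [lb [v Jv vb]]; split; first exact: idealMl.
    exists (i a * v); first exact: idealMl.
    by rewrite rmorphM -mulrBr; apply: idealMl.
- split; first exact: pwD.
  exists (i x * u); first exact: idealMl.
  by rewrite rmorphM -mulrBr -addnS; apply: KM => //; apply/Kpre.
have /choice[up upP] (p : nat * X) : exists u, p \in gs -> J u /\ K p.1.+1 (u - i p.2).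
  case: (boolP (p \in gs)) => [/gsH[_ [u Ju up]]|_]; first by exists u.
  by exists 0.
pose us := map up gs; pose c := \max_(p <- gs) p.1.
exists us; split=> [_ /mapP[p pgs ->]|u Ju]; first by have [] := upP p pgs.
have [l v _ Jv Kv|y _ ->] := @successive_approx us c 0 J _ u Ju (K0 u); last by exists y.
have [a la va] := Kapprox_pw Kv (leqnSn l).
have Ha : H l a by split=> //; exists v.
have : exists b : nat -> X, (forall j, pw g (l - c) (b j)) /\ K l.+1 (i a - lin us (i \o b)).
  apply: (gsP l a Ha [set a | exists b : nat -> X, (forall j, pw g (l - c) (b j)) /\
     K l.+1 (i a - lin us (i \o b))]).
  - exists (fun=> 0); split=> [j|]; first exact: (ideal0 (pw_ideal g (l - c))).
    rewrite rmorph0 /lin big1 ?subrr; [exact: ideal0|by move=> j _; rewrite /= rmorph0 mul0r].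
  - move=> x y [b [lb xb]] [b' [lb' yb']]; exists (fun j => b j + b' j); split=> [j|].
      by apply: idealD => //; exact: pw_ideal.
    have -> : i (x + y) - lin us (i \o (fun j => b j + b' j)) =
        (i x - lin us (i \o b)) + (i y - lin us (i \o b')).
      rewrite rmorphD addrACA -opprD; congr (_ - _); rewrite /lin -big_split /=.
      by apply: eq_bigr => j _; rewrite rmorphD mulrDl.
    exact: idealD.
  - move=> p pgs pl b lb.
    exists (fun j => if j == index p gs then b else 0); split=> [j|].
      case: eqP => _; last exact: (ideal0 (pw_ideal g (l - c))).
      by apply: pw_sub lb; rewrite leq_sub2l //; apply: (@leq_bigmax_seq _ gs xpredT (fun p => p.1)).
    have lt : (index p gs < size us)%N by rewrite size_map index_mem.
    rewrite /lin (bigD1 (Ordinal lt)) //= eqxx big1 => [|j nj]; last first.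
      case: eqP => [e|_]; last by rewrite rmorph0 mul0r.
      by case/eqP: nj; apply: val_inj.
    have -> : us`_(index p gs) = up p by rewrite (nth_map p) ?index_mem // nth_index.
    rewrite addr0 rmorphM -mulrBr.
    have [_ Kp] := upP p pgs.
    (* The lift [up p] is known one order beyond the degree of [p.2]; the coefficient contributes
       the remaining [l - p.1]. *)
    have -> : l.+1 = ((l - p.1) + p.1.+1)%N by rewrite addnS subnK.
    apply: KM; first exact/Kpre.
    by rewrite -opprB; apply: idealN.
move=> [b [lb Kb]]; exists b.
have JL : J (lin us (i \o b)).
  apply: ideal_sum => // j _; apply: idealMl => //.
  by have /mapP[p /upP[Jp _] ->] := mem_nth 0 (ltn_ord j).
split=> //; first exact: idealB.
have -> : v - lin us (i \o b) = (v - i a) + (i a - lin us (i \o b)) by ring.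
exact: idealD.
Qed.

Lemma completion_jacobson x : K 1 x -> exists u, (1 - x) * u = 1.
Proof.
move=> Kx; have [n|y yP] := @series_limit 0 (fun n => x ^+ n).
  by rewrite subn0; apply: KX.
exists y; apply/eqP; rewrite -subr_eq0; apply/eqP/Ksep => m.
have yPm := yP m; rewrite addn0 in yPm.
have -> : (1 - x) * y - 1 = (1 - x) * (y - \sum_(n < m) x ^+ n) - x ^+ m.
  rewrite mulrBr; have -> : (1 - x) * \sum_(n < m) x ^+ n = 1 - x ^+ m.
    by rewrite -(opprB x 1) mulNr -subrX1 opprB.
  ring.
by apply: idealB => //; [exact: idealMl|exact: KX].
Qed.

(** Exact divisibility of the tails holds because the tail with [a ^+ m j] factored out is itself a
    convergent series, of sum [d]. *)
Lemma completion_gap_series a (m : nat -> nat) : K 1 a -> (forall j, (m j < m j.+1)%N) ->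
  exists y, forall j, exists d, y - \sum_(n < j) a ^+ m n = a ^+ m j * d.
Proof.
move=> Ka mS.
have mD j n : (m j + n <= m (j + n))%N.
  elim: n => [|n IH]; first by rewrite !addn0.
  by rewrite !addnS (leq_ltn_trans IH).
have lim j : exists y, forall k, K k (y - \sum_(n < k) a ^+ (m (j + n) - m j)%N).
  have [n|y yP] := @series_limit 0 (fun n => a ^+ (m (j + n) - m j)%N).
    by rewrite subn0; refine (Ksub _ (KX _ Ka)); rewrite leq_subRL ?mD // (leq_trans _ (mD j n)) ?leq_addr.
  by exists y => k; have := yP k; rewrite addn0.
have [y yP] := lim 0%N; exists (a ^+ m 0%N * y) => j; have [d dP] := lim j; exists d.
apply/eqP; rewrite -subr_eq0; apply/eqP/Ksep => k.
have E j' l : a ^+ m j' * \sum_(n < l) a ^+ (m (j' + n) - m j')%N = \sum_(n < l) a ^+ m (j' + n)%N.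
  rewrite mulr_sumr; apply: eq_bigr => n _; rewrite -exprD subnKC //.
  by rewrite (leq_trans _ (mD j' n)) ?leq_addr.
have -> : a ^+ m 0%N * y - \sum_(n < j) a ^+ m n - a ^+ m j * d =
   a ^+ m 0%N * (y - \sum_(n < (j + k)%N) a ^+ (m (0 + n) - m 0)%N) -
   a ^+ m j * (d - \sum_(n < k) a ^+ (m (j + n) - m j)%N).
  have split : \sum_(n < (j + k)%N) a ^+ m (0 + n)%N =
      \sum_(n < j) a ^+ m n + \sum_(n < k) a ^+ m (j + n)%N by rewrite big_split_ord.
  by rewrite !mulrBr !E split; ring.
apply: idealB => //; apply: idealMl => //; refine (Ksub _ (yP _)); exact: leq_addl.
Qed.

(** By Artin-Rees, [i f * x] near the extension of [I] forces [x] to be near it. The extension is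
    closed, by Krull's intersection theorem and since elements [1 - y] with [y] in [K 1] are
    units. *)
Lemma completion_nonzerodivisor (I : set X) f : is_ideal I -> (forall x, I (f * x) -> I x) ->
  forall x, ext_ideal i I (i f * x) -> ext_ideal i I x.
Proof.
move=> iI fI x fx; have iE := ext_ideal_ideal i I.
have [c cP] := artin_rees g f nX iI.
have [s [sI sE]] := ext_ideal_span i nX iI.
have close l : exists2 w, pw [seq i y | y <- g] l w & ext_ideal i I (x - w).
  have [a xa] := Kapprox (l + c) x.
  have : [set z | exists2 e, I e & K (l + c) (z - i e)] (i f * x).
    move: fx; apply: ext_ideal_sub => [|e Ie]; last by exists e => //; rewrite subrr; apply: ideal0.
    split.
    - by exists 0; rewrite ?rmorph0 ?subrr; apply: ideal0.
    - move=> y z [e Ie ye] [e' Ie' ze]; exists (e + e'); first exact: idealD.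
      by rewrite rmorphD opprD addrACA; apply: idealD.
    - move=> y z [e Ie ze]; have [b yb] := Kapprox (l + c) y.
      exists (b * e); first exact: idealMl.
      have -> : y * z - i (b * e) = y * (z - i e) + i e * (y - i b) by rewrite rmorphM; ring.
      by apply: idealD => //; apply: idealMl.
  move=> [e Ie fxe].
  have pf : pw g (l + c) (f * a - e).
    apply/Kpre; have -> : i (f * a - e) = (i f * x - i e) - i f * (x - i a).
      by rewrite rmorphB rmorphM; ring.
    by apply: idealB => //; apply: idealMl.
  have [|y [e' [ly Ie' fE]]] := cP _ _ pf.
    by exists (f * a), (- e); split=> //; [exists a|exact: idealN].
  rewrite addnK in ly.
  have Iay : I (a - y).
    apply: fI; have -> : f * (a - y) = e + e' by rewrite mulrBr -[f * a](subrK e) fE; ring.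
    exact: idealD.
  exists (x - i (a - y)); last by rewrite opprB addrC subrK; exact: ext_ideal_gen.
  apply: completion_K1_ext; rewrite rmorphB.
  have -> : x - (i a - i y) = (x - i a) + i y by ring.
  by apply: idealD => //; [refine (Ksub _ xa); exact: leq_addr|exact/Kpre].
have [y y1 xy] := krull_intersection completion_noetherian iE close.
have Ky : K 1 y.
  move: y1; rewrite pw1E; apply: (span_sub (iK 1)) => _ /mapP[z zg ->].
  by apply/Kpre; apply: pw_gen.
have [u yu] := completion_jacobson Ky.
by rewrite -[x]mulr1 -yu mulrA; exact: (idealMr _ iE xy).
Qed.

End AbstractCompletion.

(** * Primes avoiding a subalgebra *)

Section ScalarSpans.
Variables (k : fieldType) (D : comPzRingType) (kappa : {rmorphism k -> D}).

Definition kspan (v : nat -> D) n : set D :=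
  [set x | exists c : nat -> k, x = \sum_(i < n) kappa (c i) * v i].

Lemma kspanB v n x y c : kspan v n x -> kspan v n y -> kspan v n (x - kappa c * y).
Proof.
move=> [a ->] [b ->]; exists (fun i => a i - c * b i).
rewrite mulr_sumr -sumrB; apply: eq_bigr => i _; rewrite rmorphB rmorphM; ring.
Qed.

Lemma kspanM v n a x : kspan v n x -> kspan (fun i => a * v i) n (a * x).
Proof.
move=> [c ->]; exists c; rewrite mulr_sumr; apply: eq_bigr => i _; ring.
Qed.

(** Induction on [n]: either every [W m] contains a combination with last coefficient 1, which
    eliminates the last coefficient, or beyond some index last coefficients vanish. The index [m0]
    is uniform in [x]. *)
Lemma kspan_stab v n (W : nat -> set D) : (forall m, is_ideal (W m)) ->
  (forall m, W m.+1 `<=` W m) -> exists m0, forall m x, kspan v n x -> W m0 x -> W m x.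
Proof.
move=> iW dW; elim: n => [|n [m2 IH]].
  by exists 0%N => m x [c ->] _; rewrite big_ord0; apply: ideal0.
have splitx x : kspan v n.+1 x -> exists w c, kspan v n w /\ x = w + kappa c * v n.
  move=> [c ->]; rewrite big_ord_recr /=; exists (\sum_(i < n) kappa (c i) * v i), (c n).
  by split=> //; exists c.
have [allm|/existsNP[m1 no]] := pselect (forall m, exists2 w, kspan v n w & W m (w + v n)).
  exists m2 => m x /splitx[w [c [sw ->]]] Wx.
  have [w' sw' Wy] := allm (maxn m m2).
  have -> : w + kappa c * v n = (w - kappa c * w') + kappa c * (w' + v n) by ring.
  have Wy' := decr_sub dW (leq_maxl m m2) Wy; have Wy2 := decr_sub dW (leq_maxr m m2) Wy.
  apply: idealD => //; last exact: idealMl.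
  apply: IH; first exact: kspanB.
  have -> : w - kappa c * w' = (w + kappa c * v n) - kappa c * (w' + v n) by ring.
  by apply: idealB => //; apply: idealMl.
exists (maxn m1 m2) => m x /splitx[w [c [sw ->]]] Wx.
have [c0|c0] := eqVneq c 0.
  move: Wx; rewrite c0 rmorph0 mul0r addr0 => Wx.
  by apply: IH => //; apply: decr_sub (leq_maxr m1 m2) _ Wx.
case: no; exists (kappa c^-1 * w).
  have -> : kappa c^-1 * w = 0 - kappa (- c^-1) * w by rewrite rmorphN; ring.
  by apply: kspanB => //; exists (fun=> 0); rewrite big1 // => i _; rewrite rmorph0 mul0r.
apply: (decr_sub dW (leq_maxl m1 m2)).
have -> : kappa c^-1 * w + v n = kappa c^-1 * (w + kappa c * v n).
  by rewrite mulrDr mulrA -rmorphM mulVf // rmorph1 mul1r.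
exact: idealMl.
Qed.

End ScalarSpans.

Section GapElement.
Variables (k : fieldType) (D : comPzRingType) (kappa : {rmorphism k -> D}) (a : D).
Hypothesis nD : noetherian D.
Hypothesis dom : forall x y : D, x * y = 0 -> x = 0 \/ y = 0.
Hypothesis jac : forall d, exists u, (1 - a * d) * u = 1.

(** [I] is closed in the [a]-adic topology by Krull's intersection theorem and [jac]; on a
    finite-dimensional space the ideals $I + (a^m)$ stabilize, so one exponent detects
    membership. *)
Lemma kspan_close v n (I : set D) : is_ideal I -> exists M, forall x, kspan kappa v n x ->
  add_ideal I (principal (a ^+ M)) x -> I x.
Proof.
move=> iI.
have [m|m|M MP] := @kspan_stab k D kappa v n (fun M => add_ideal I (principal (a ^+ M))).
- by apply: add_ideal_ideal => //; apply: principal_ideal.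
- move=> _ [x [_ [Ix [d ->] ->]]]; exists x, (a ^+ m * (a * d)); split=> //; first by exists (a * d).
  by rewrite exprSr mulrA.
exists M => x sx Mx.
have [l|y y1 xy] := @krull_intersection D [:: a] I x nD iI.
  have [y [_ [Iy [d ->] ->]]] := MP l x sx Mx; exists (a ^+ l * d); last by rewrite addrK.
  by apply: idealMr; [exact: pw_ideal|apply/pwX/pw_gen; rewrite mem_head].
have [d yE] : principal a y.
  move: y1; rewrite pw1E; apply: span_sub; first exact: principal_ideal.
  by move=> z; rewrite inE => /eqP->; apply: principal_gen.
have [u yu] := jac d; rewrite -yE in yu.
by rewrite -[x]mulr1 -yu mulrA; apply: idealMr.
Qed.

(* If x = (w - a^m) d lies in the span and m is large, then Krull's intersection
   theorem on the span gives a^c x = w (w - a^m) d' with c independent of m;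
   iterating, some a^e x lies in w^l for a large l, which forces x = 0. *)
Lemma kspan_avoid_gap v n w : w <> 0 -> (forall c, ~ principal w (a ^+ c)) ->
  exists m0, forall m x, (m0 <= m)%N -> kspan kappa v n x -> principal (w - a ^+ m) x -> x = 0.
Proof.
move=> w0 wa.
have wX0 i x : w ^+ i * x = 0 -> x = 0.
  elim: i x => [|i IH] x; first by rewrite expr0 mul1r.
  by rewrite exprSr -mulrA => /IH /dom[].
(* The ideals of those [d] with [a ^+ m * d] in [(w)] increase with [m]; [c] is where they
   stabilize. *)
have [c cP] : exists c, forall m d, principal w (a ^+ m * d) -> principal w (a ^+ c * d).
  apply: (ideal_acc nD (I := fun m => [set d | principal w (a ^+ m * d)])).
    have iw := principal_ideal w; move=> m; split=> /= [|x y|b x].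
    - by rewrite mulr0; apply: ideal0.
    - by rewrite mulrDr; apply: idealD.
    - by rewrite mulrCA; apply: idealMl.
  by move=> m d /= md; rewrite exprS -mulrA; apply: idealMl => //; apply: principal_ideal.
pose W l : set D := [set x | exists e, principal (w ^+ l) (a ^+ e * x)].
have [l|l|l0 l0P] := @kspan_stab k D kappa v n W.
- have iw := principal_ideal (w ^+ l); split.
  + by exists 0%N; rewrite mulr0; apply: ideal0.
  + move=> x y [e ex] [f fy]; exists (e + f)%N; rewrite exprD.
    have -> : a ^+ e * a ^+ f * (x + y) = a ^+ f * (a ^+ e * x) + a ^+ e * (a ^+ f * y) by ring.
    by apply: idealD => //; apply: idealMl.
  + by move=> b x [e ex]; exists e; rewrite mulrCA; apply: idealMl.
- by move=> x [e [d ex]]; exists e; exists (w * d); rewrite ex exprSr mulrA.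
(* Stabilization puts multiples of [x] by powers of [a] into arbitrarily high powers of [(w)].
   Artin-Rees for [(x)] then gives [a ^+ e * x = x * y] with [y] in [(w)], and [wa] excludes
   [a ^+ e = y]. *)
have W0 x : kspan kappa v n x -> W l0 x -> x = 0.
  move=> sx W0x; have [c1 c1P] := artin_rees [:: w] x nD (set0_ideal D).
  have [e [d ed]] := l0P c1.+1 x sx W0x.
  have [||y [_ [y1 -> xy]]] := c1P c1.+1 (a ^+ e * x).
  - by rewrite ed; apply: idealMr; [exact: pw_ideal|apply/pwX/pw_gen; rewrite mem_head].
  - by exists (a ^+ e * x), 0; rewrite addr0; split=> //; exists (a ^+ e); ring.
  have /dom[//|ey] : x * (a ^+ e - y) = 0 by rewrite mulrBr [x * _]mulrC xy addr0 subrr.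
  case: (wa e); rewrite (subr0_eq ey).
  move: y1; rewrite subSnn pw1E; apply: span_sub; first exact: principal_ideal.
  by move=> z; rewrite inE => /eqP->; apply: principal_gen.
have C i : exists m0, forall m x, (m0 <= m)%N -> kspan kappa v n x -> principal (w - a ^+ m) x ->
    exists d, a ^+ (c * i)%N * x = w ^+ i * ((w - a ^+ m) * d).
  elim: i => [|i [m0 IH]].
    by exists 0%N => m x _ _ [d ->]; exists d; rewrite muln0 !expr0 !mul1r.
  (* [a ^+ (c * i) * x] ranges over a fixed finite-dimensional space and lies in [(w ^+ i.+1)] up to
     a multiple of [a ^+ M], hence lies in it. Cancelling [w ^+ i] puts [a ^+ m * d], and so
     [a ^+ c * d], into [(w)]. *)
  have [M MP] := @kspan_close (fun j => a ^+ (c * i)%N * v j) n (principal (w ^+ i.+1)) (principal_ideal _).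
  exists (maxn m0 M) => m x; rewrite geq_max => /andP[m0m Mm] sx wx.
  have [d dE] := IH m x m0m sx wx.
  have [|d' d'E] := MP _ (kspanM (a ^+ (c * i)%N) sx).
    exists (w ^+ i.+1 * d), (- (a ^+ M * (a ^+ (m - M) * (w ^+ i * d)))).
    split; [by exists d|by exists (- (a ^+ (m - M) * (w ^+ i * d))); ring|].
    by rewrite dE -{1}(subnKC Mm) exprD exprS; ring.
  have md : principal w (a ^+ m * d).
    exists (d - d'); apply/eqP; rewrite -subr_eq0; apply/eqP/(wX0 i).
    have -> : w ^+ i * (a ^+ m * d - w * (d - d')) = w ^+ i.+1 * d' - w ^+ i * ((w - a ^+ m) * d).
      by rewrite exprS; ring.
    by rewrite -d'E dE subrr.
  have [d2 d2E] := cP _ _ md; exists d2.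
  rewrite mulnS exprD -mulrA dE.
  have -> : a ^+ c * (w ^+ i * ((w - a ^+ m) * d)) = w ^+ i * (w - a ^+ m) * (a ^+ c * d) by ring.
  by rewrite d2E exprS; ring.
have [m0 m0P] := C l0; exists m0 => m x m0m sx wx; apply: W0 => //.
by have [d dE] := m0P m x m0m sx wx; exists (c * l0)%N; exists ((w - a ^+ m) * d).
Qed.

(** Stage [j] chooses an exponent that settles the span of the first [j] vectors, and then a bound
    beyond which further terms of the series cannot disturb what is settled. *)
Lemma gap_element (b : nat -> D) z : ~ principal a z ->
  (forall g c, principal a g -> ~ principal (z - g) (a ^+ c)) ->
  (forall m : nat -> nat, (forall j, (m j < m j.+1)%N) ->
     exists y, forall j, exists d, y - \sum_(n < j) a ^+ m n = a ^+ m j * d) ->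
  exists2 g, principal a g & forall n x, kspan kappa b n x -> principal (z - g) x -> x = 0.
Proof.
move=> za zg conv.
(* The input is the stage, the partial sum and a lower bound for the next exponent. The output is
   that exponent [q.1] and the next bound [q.2]; the conclusion tolerates any multiple of
   [a ^+ q.2]. *)
have /choice[F FP] (p : nat * D * nat) : exists q : nat * nat, principal a p.1.2 ->
    [/\ (p.2 <= q.1)%N, (q.1 < q.2)%N & forall x, kspan kappa b p.1.1 x ->
      add_ideal (principal (z - (p.1.2 + a ^+ q.1))) (principal (a ^+ q.2)) x -> x = 0].
  case: p => [[j g] M] /=; have [ag|nag] := pselect (principal a g); last by exists (0, 0)%N.
  have zg0 : z - g <> 0 by move=> /subr0_eq e; apply: za; rewrite e.
  have [m0 m0P] := @kspan_avoid_gap b j (z - g) zg0 (fun c => zg g c ag).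
  pose m := maxn m0 M.
  have [M' M'P] := kspan_close b j (principal_ideal (z - (g + a ^+ m))).
  exists (m, maxn M' m.+1) => _ /=; split; [exact: leq_maxr|exact: leq_maxr|].
  move=> x sx [_ [_ [[d ->] [e ->] xE]]].
  apply: (m0P m x (leq_maxl _ _) sx); rewrite -addrA -opprD; apply: M'P => //.
  rewrite xE; exists ((z - (g + a ^+ m)) * d), (a ^+ maxn M' m.+1 * e); split=> //; first by exists d.
  by exists (a ^+ (maxn M' m.+1 - M') * e); rewrite mulrA -exprD subnKC // leq_maxl.
(* The initial bound 1 keeps the exponents positive and the partial sums in [(a)]. *)
pose s := fix s j : D * nat := if j is j'.+1
  then ((s j').1 + a ^+ (F (j', (s j').1, (s j').2)).1, (F (j', (s j').1, (s j').2)).2) else (0, 1%N).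
pose m j := (F (j, (s j).1, (s j).2)).1.
have [sa sM] : (forall j, principal a (s j).1) /\ (forall j, (0 < (s j).2)%N).
  have sP j : principal a (s j).1 /\ (0 < (s j).2)%N.
    elim: j => [|j [IHa IHM]] /=; first by split=> //; exists 0; rewrite mulr0.
    have [le lt _] := FP (j, (s j).1, (s j).2) IHa; split; last exact: leq_ltn_trans lt.
    apply: idealD => //; first exact: principal_ideal.
    rewrite -(prednK (leq_trans IHM le)) exprS; exact: ex_intro.
  by split=> j; have [] := sP j.
have mP j := FP (j, (s j).1, (s j).2) (sa j).
have mS j : (m j < m j.+1)%N.
  by have [_ lt _] := mP j; have [le _ _] := mP j.+1; apply: leq_trans lt le.
have sE j : (s j).1 = \sum_(n < j) a ^+ m n.
  by elim: j => [|j IH]; rewrite ?big_ord0 // big_ord_recr /= -IH.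
have [g gP] := conv m mS; exists g.
  have [d] := gP 0%N; rewrite big_ord0 subr0 => ->.
  have [le _ _] := mP 0%N; have m0 : (0 < m 0%N)%N by exact: le.
  by rewrite -(prednK m0) exprS -mulrA; exact: ex_intro.
move=> n x sx [e xE]; have [_ _ avoid] := mP n; apply: (avoid x sx) => /=.
have [d dE] := gP n.+1; have [le _ _] := mP n.+1.
exists ((z - (s n.+1).1) * e), (- (a ^+ m n.+1 * d * e)); split; first by exists e.
- exists (- (a ^+ (m n.+1 - (s n.+1).2) * d * e)).
  by rewrite mulrN mulrA mulrA -exprD subnKC.
- by rewrite xE -dE -sE; ring.
Qed.

End GapElement.

(** The work takes place in the local domain $(A/Q_0)_{Q_2}$. Because of [Q1] its maximal ideal is
    not minimal over [a], which leaves room for [z]. The wanted prime contains [z - g] and avoids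
    the images of [B] outside [Q0]; one of these is the image of [a], so it is strictly smaller than
    [Q2]. *)
Lemma prime_avoiding_subalgebra (k : fieldType) (A : comPzRingType) (kappa : {rmorphism k -> A})
    (b : nat -> A) (B : set A) (Q0 Q1 Q2 : set A) a :
  noetherian A -> (forall x, B x -> exists n, kspan kappa b n x) ->
  is_mult_closed B -> is_prime_ideal Q0 -> is_prime_ideal Q1 -> is_prime_ideal Q2 ->
  Q0 `<` Q1 -> Q1 `<` Q2 -> B a -> Q1 a -> ~ Q0 a ->
  (forall m : nat -> nat, (forall j, (m j < m j.+1)%N) ->
     exists y, forall j, exists d, y - \sum_(n < j) a ^+ m n = a ^+ m j * d) ->
  exists Q, [/\ is_prime_ideal Q, Q0 `<` Q, Q `<` Q2 & forall x, B x -> Q x -> Q0 x].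
Proof.
move=> nA Bk [B1 BM] pQ0 pQ1 pQ2 lt01 lt12 Ba Q1a Q0a conv.
have Q02 : Q0 `<=` Q2 by move=> x /lt01.1 /lt12.1.
have [D [e [nD e0 eF eU dom]]] := local_domain_at nA pQ0 pQ2 Q02.
have fe : fracmap e.
  by move=> d; have [x [s [/eU[u su] ds]]] := eF d; exists x, s, u.
have ok T : Q0 `<=` T -> T `<=` Q2 -> frac_ok e T.
  move=> PT TQ; split=> [s u su /TQ|x /e0 /PT //].
  by apply: ((eU s).2 _); exists u.
have ok2 := ok Q2 Q02 (fun x h => h); have ok1 := ok Q1 lt01.1 lt12.1.
pose N := frac_ext e Q2; pose P' := frac_ext e Q1.
have pN : is_prime_ideal N := frac_ext_prime fe pQ2 ok2.
have pP' : is_prime_ideal P' := frac_ext_prime fe pQ1 ok1.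
have NK : e @^-1` N = Q2 := frac_extK pQ2 ok2.
have P'K : e @^-1` P' = Q1 := frac_extK pQ1 ok1.
have iN := prime_is_ideal pN.
have P'N : P' `<=` N by move=> d [x [s [u [/lt12.1 Qx su ds]]]]; exists x, s, u.
have NP' : ~ N `<=` P' by move=> sub; apply: lt12.2; rewrite -NK -P'K => x; exact: sub.
have unitN x : ~ N x -> exists u, x * u = 1.
  move=> Nx; have [y [s [Qs xs]]] := eF x; have [u su] := (eU s).1 Qs.
  have Qy : ~ Q2 y by move=> Qy; apply: Nx; exists y, s, u.
  have [v yv] := (eU y).1 Qy; exists (e s * v); by rewrite mulrA xs.
have subN Q : is_prime_ideal Q -> Q `<=` N.
  move=> pQ x Qx; apply: contrapT => /unitN[u xu]; apply: (prime_neq1 pQ).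
  by rewrite -xu; apply: idealMr => //; apply: prime_is_ideal.
have P'a : P' (e a) by rewrite -P'K in Q1a.
have Na := P'N _ P'a.
have ea0 : e a <> 0 by move/e0.
have p0 : is_prime_ideal [set 0 : D].
  split; [exact: set0_ideal| |exact: dom].
  by move=> /= D1; apply: (prime_neq1 pQ0); apply/e0; rewrite rmorph1 D1.
have jac d : exists u, (1 - e a * d) * u = 1.
  apply: unitN => N1; apply: (prime_neq1 pN); rewrite -(subrK (e a * d) 1).
  by apply: idealD => //; apply: idealMr.
have [n [R [R1 R2]]] := finite_min_primes nD (principal_ideal (e a)).
pose R' i := if `[< N `<=` R i >] then P' else R i.
have aQ Q : is_prime_ideal Q -> Q (e a) -> principal (e a) `<=` Q.
  by move=> /prime_is_ideal iQ Qa; apply: principal_sub.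
have R'1 i : (i < n)%N -> [/\ is_prime_ideal (R' i), R' i (e a) & ~ N `<=` R' i].
  move=> /R1[pR aR]; rewrite /R'; case: asboolP => NR; first by split.
  by split=> //; apply/aR/principal_gen.
have R'2 Q : is_prime_ideal Q -> Q (e a) -> exists2 i, (i < n)%N & R' i `<=` Q.
  move=> pQ Qa; have [i iln RQ] := R2 Q pQ (aQ Q pQ Qa); exists i => //.
  by rewrite /R'; case: asboolP => // NR x /P'N /NR /RQ.
have [i /R'1[] //|i /R'1[] //|z Nz zR] := @prime_avoidance D N n R' iN.
have za : ~ principal (e a) z.
  move=> az; have [i iln _] := R'2 N pN Na; apply: (zR i iln).
  by have [pR Ra _] := R'1 i iln; apply: (aQ _ pR Ra).
have Nzg g : principal (e a) g -> N (z - g).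
  by move=> ag; apply: idealB => //; apply: (aQ N pN Na).
(* Otherwise a prime [Q] minimal over [z - g] contains [e a], hence some [R' i]. If [Q] lies inside
   [R' i], then so does [z], against its choice; if not, the nonzero prime [R' i] strictly inside
   [Q] contradicts the principal ideal theorem. *)
have zg g c : principal (e a) g -> ~ principal (z - g) (e a ^+ c).
  move=> ag zga.
  have sub0N : [set 0] `<=` N by move=> x ->; apply: ideal0.
  have [Q [pQ _ Qz QN mQ]] := minimal_prime_below nD p0 pN sub0N (Nzg g ag).
  have iQ := prime_is_ideal pQ.
  have Qa : Q (e a) by apply: (@primeX _ _ _ c) => //; apply: principal_sub Qz _ zga.
  have [i iln RQ] := R'2 Q pQ Qa; have [pR Ra _] := R'1 i iln.
  have [QR|QR] := pselect (Q `<=` R' i).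
    apply: (zR i iln); rewrite -[z](subrK g); apply: idealD; [exact: prime_is_ideal|exact: QR|].
    exact: (aQ _ pR Ra).
  have sub0 : [set 0] `<=` R' i by move=> x ->; apply: ideal0; apply: prime_is_ideal.
  have sub0Q : [set 0] `<=` Q by move=> x ->; apply: ideal0.
  by have /(_ _ Ra) := krull_pit nD p0 pQ sub0Q Qz mQ pR sub0 (conj RQ QR).
have [m mS|g ag gP] := @gap_element k D (e \o kappa) (e a) nD dom jac (e \o b) z za zg.
  have [y yP] := conv m mS; exists (e y) => j; have [d dE] := yP j; exists (e d).
  rewrite -rmorphXn -rmorphM -dE rmorphB rmorph_sum; congr (_ - _).
  by apply: eq_bigr => l _; rewrite rmorphXn.
pose S := e @` [set x | B x /\ ~ Q0 x].
have mS : is_mult_closed S.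
  split; first by exists 1; rewrite ?rmorph1 //; split=> //; apply: prime_neq1.
  move=> _ _ [x [Bx Qx] <-] [y [By Qy] <-]; exists (x * y); rewrite ?rmorphM //.
  by split; [exact: BM|exact: primeMn].
have zg0 : z - g <> 0 by move=> /subr0_eq zE; apply: za; rewrite zE.
have [|Q [pQ Qz QS]] := prime_exists nD (principal_ideal (z - g)) mS.
  move=> w zw [x [Bx Qx] xE]; apply: Qx; apply/e0.
  have [l [c cE]] := Bk x Bx; apply: (gP l); last by rewrite xE.
  by exists c; rewrite cE rmorph_sum; apply: eq_bigr => j _; rewrite rmorphM.
have iQ := prime_is_ideal pQ.
exists (e @^-1` Q); split; first exact: preim_prime.
- split=> [x /e0 ex|sub]; first by rewrite /= ex; apply: ideal0.
  apply: zg0; apply: (fracmap_sub fe iQ (set0_ideal D)); last exact/Qz/principal_gen.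
  by move=> x /sub /e0.
- split=> [x Qx|sub]; first by rewrite -NK; apply: subN Qx.
  by apply: (QS (e a)); [exact: (sub a (lt12.1 _ Q1a))|exists a].
- by move=> x Bx Qx; apply: contrapT => Q0x; apply: (QS (e x)) => //; exists x.
Qed.

(** * Integral extensions *)

Lemma nz_quotient (B : comNzRingType) (P : set B) : is_ideal P -> ~ P 1 ->
  exists (E : comNzRingType) (p : {rmorphism B -> E}),
    (forall e, exists b, p b = e) /\ (forall b, p b = 0 <-> P b).
Proof.
move=> iP P1; pose I := Ideal iP.
have nz : (1 : quot_ring I) != 0.
  by apply/eqP => /(@quot_pi_eq0 _ I 1).
pose E : comNzRingType := HB.pack (quot_ring I : Type) (GRing.ComPzRing.class (quot_ring I))
  (GRing.PzSemiRing_isNonZero.Build (quot_ring I) nz).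
exists E, (@quot_pi B I); split; first exact: quot_pi_surj.
by move=> b; apply: quot_pi_eq0.
Qed.

Lemma integral_trans (A B E : comNzRingType) (f : {rmorphism A -> B}) (h : {rmorphism B -> E}) x :
  integralRange f -> integralOver h x -> integralOver (h \o f) x.
Proof.
move=> intf [p mp px]; apply: (integral_root_monic (p := map_poly h p)) => //.
  exact: monic_map.
apply/integral_poly => i; rewrite coef_map; exact: integral_rmorph.
Qed.

Lemma poly_morph_X0 (T E : nzRingType) (w : {rmorphism {poly T} -> E}) :
  w 'X = 0 -> forall q, w q = w (q.[0])%:P.
Proof.
move=> wX; elim/poly_ind => [|q c _]; first by rewrite horner0.
by rewrite hornerMXaddC mulr0 add0r rmorphD rmorphM /= wX mulr0 add0r.
Qed.

Lemma integral_poly_X0 (T E : comNzRingType) (w : {rmorphism {poly T} -> E}) :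
  w 'X = 0 -> integralRange w -> integralRange (w \o polyC).
Proof.
move=> wX intw x; have [p mp px] := intw x.
exists (map_poly (horner_eval 0) p); first exact: monic_map.
suff -> : map_poly (w \o polyC) (map_poly (horner_eval 0) p) = map_poly w p by [].
by apply/polyP => i; rewrite !coef_map /= /horner_eval (poly_morph_X0 wX p`_i).
Qed.

Section IntegralDomains.
Variables (T : idomainType) (E : comNzRingType).
Hypothesis dom : forall x y : E, x * y = 0 -> x = 0 \/ y = 0.

(** The multiple is, up to sign, the constant term of an equation of [x], after the equation has
    been divided by powers of the variable, which is possible in a domain. *)
Lemma integral_multiple (f : {rmorphism T -> E}) x : injective f -> integralOver f x -> x <> 0 ->
  exists2 t, t != 0 & exists e, f t = x * e.
Proof.
move=> injf [p mp /eqP px] x0; have := monic_neq0 mp; move: px {mp}.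
move: {2}(size p) (leqnn (size p)) => n; elim: n p => [|n IH] p.
  by rewrite leqn0 size_poly_eq0 => /eqP-> _; rewrite eqxx.
elim/poly_ind: p => [|p c _]; first by rewrite eqxx.
rewrite size_MXaddC; have [-> |c0 sp] := eqVneq c 0; last first.
  rewrite rmorphD rmorphM /= map_polyX map_polyC !hornerE => /eqP.
  rewrite addr_eq0 => /eqP pE _; exists (- c); rewrite ?oppr_eq0 //.
  by exists (map_poly f p).[x]; rewrite rmorphN -pE mulrC.
have [->|p0] := eqVneq p 0; first by rewrite mul0r addr0 eqxx.
rewrite /= ?polyC0 addr0 rmorphM /= map_polyX hornerMX => sp /dom[px _|//].
exact: IH sp px p0.
Qed.

Lemma integral_field_dim0 (f : {rmorphism {poly T} -> E}) : injective f -> integralRange f ->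
  ~ exists w, f 'X * w = 1.
Proof.
move=> injf intf [w Xw]; have [p mp /eqP pw] := intf w.
pose n := (size p).-1.
have sp : size p = n.+1 by rewrite /n prednK // lt0n size_poly_eq0 monic_neq0.
(* The equation of [w] multiplied by ['X^n], with ['X * w] replaced by 1; its constant term is that
   of the leading coefficient of [p], namely 1. *)
pose q := \sum_(i < n.+1) p`_i * 'X^(n - i).
have : f q = 0.
  transitivity (f 'X ^+ n * (map_poly f p).[w]); last by rewrite pw mulr0.
  rewrite horner_coef size_map_poly_id0 ?sp; last by rewrite (monicP mp) rmorph1 oner_neq0.
  rewrite rmorph_sum mulr_sumr; apply: eq_bigr => i _.
  rewrite rmorphM rmorphXn coef_map /=.
  have le : (i <= n)%N by rewrite -ltnS.
  have -> : f 'X ^+ n = f 'X ^+ (n - i) * f 'X ^+ i by rewrite -exprD subnK.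
  have -> : f 'X ^+ (n - i) * f 'X ^+ i * (f p`_i * w ^+ i) = f p`_i * f 'X ^+ (n - i) * (f 'X * w) ^+ i.
    by rewrite exprMn; ring.
  by rewrite Xw expr1n mulr1.
rewrite -(rmorph0 f) => /injf /(congr1 (fun q : {poly T} => q`_0)) /eqP.
rewrite coef0 coef_sum big_ord_recr /= subnn expr0 mulr1 big1 => [|i _]; last first.
  by rewrite coefMXn subn_gt0 ltn_ord.
have -> : p`_n = 1 by rewrite -(monicP mp) /lead_coef sp.
by rewrite add0r coef1 oner_eq0.
Qed.

End IntegralDomains.

Lemma dvd_coprime_X (T : idomainType) i (a b w : {poly T}) : w`_0 != 0 ->
  'X^i * b = w * a -> exists f, a = 'X^i * f.
Proof.
move=> w0; elim: i a b => [|i IH] a b; first by exists a; rewrite expr0 mul1r.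
move=> E; have : root a 0.
  have /(congr1 (fun q : {poly T} => q.[0])) := E; rewrite !hornerM hornerXn expr0n mul0r => /esym/eqP.
  by rewrite mulf_eq0 horner_coef0 (negbTE w0) /root => /orP[].
move=> /factor_theorem[a' aE]; rewrite subr0 in aE.
have [f fE] : exists f, a' = 'X^i * f.
  apply: (IH a' b); apply: (mulfI (negbT (polyX_eq0 T))).
  by rewrite mulrA -exprS E aE; ring.
by exists f; rewrite aE fE exprS; ring.
Qed.

Section SerreTrick.
Variables (T : idomainType) (E : comNzRingType) (f : {rmorphism {poly T} -> E}).
Hypothesis dom : forall x y : E, x * y = 0 -> x = 0 \/ y = 0.
Hypothesis injf : injective f.

Lemma monic_power_reduce (p : {poly {poly T}}) x : p \is monic -> root (map_poly f p) x ->
  forall i, exists q : {poly {poly T}}, (size q <= (size p).-1)%N /\ x ^+ i = (map_poly f q).[x].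
Proof.
move=> mp /eqP px i; exists ('X^i %% p); split.
  by rewrite -ltnS prednK ?lt0n ?size_poly_eq0 ?monic_neq0 // ltn_modp monic_neq0.
have /(congr1 (fun q => (map_poly f q).[x])) := Pdiv.IdomainMonic.divp_eq mp 'X^i.
rewrite map_polyXn hornerXn => ->.
by rewrite rmorphD rmorphM /= hornerD hornerM px mulr0 add0r.
Qed.

(* In the fraction field s/X = r/v with X and v coprime: a denominator common to
   all powers of s and r then also serves for all powers of s/X. *)
Lemma common_denominator s r (v : {poly T}) : v`_0 != 0 -> f v * s = f 'X * r ->
  integralOver f s -> integralOver f r ->
  exists2 G : E, G <> 0 & forall i, exists e, G * s ^+ i = f 'X ^+ i * e.
Proof.
move=> v0 vs [ps mps rs] [pr mpr rr].
pose ev : {rmorphism {poly {poly T}} -> E} := horner_morph (fun x => mulrC s (f x)).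
have evE q : ev q = (map_poly f q).[s] by [].
have evC c : ev c%:P = f c by exact: horner_morphC.
have evX : ev 'X = s by exact: horner_morphX.
(* The least size of a relation of [s] is called [e.+1], so that the powers of [s] with exponent
   below [e] are independent; [F0] is their span. *)
pose rel n := `[< exists2 p : {poly {poly T}}, size p = n & p != 0 /\ ev p = 0 >].
have exrel : exists n, rel n.
  by exists (size ps); apply/asboolP; exists ps => //; split; [exact: monic_neq0|exact/eqP].
have [n /asboolP[p sp [p0 evp]] minn] := ex_minnP exrel.
have [e ne] : exists e, n = e.+1.
  by exists n.-1; rewrite prednK // -sp lt0n size_poly_eq0.
rewrite {n}ne in sp minn.
have free (q : {poly {poly T}}) : (size q <= e)%N -> ev q = 0 -> q = 0.
  move=> sq evq; apply/eqP; apply: contraTT sq => q0; rewrite -ltnNge.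
  by apply: minn; apply/asboolP; exists q.
pose F0 x := exists2 q : {poly {poly T}}, (size q <= e)%N & x = ev q.
have F0D x y : F0 x -> F0 y -> F0 (x + y).
  move=> [q sq ->] [q' sq' ->]; exists (q + q'); last by rewrite rmorphD.
  by rewrite (leq_trans (size_polyD _ _)) // geq_max sq.
have F0M c x : F0 x -> F0 (f c * x).
  move=> [q sq ->]; exists (c%:P * q); last by rewrite rmorphM evC.
  by rewrite mul_polyC (leq_trans (size_scale_leq _ _)).
have F00 : F0 0 by exists 0; rewrite ?size_poly0 ?rmorph0.
have F0sum m (F : nat -> E) : (forall j, (j < m)%N -> F0 (F j)) -> F0 (\sum_(j < m) F j).
  by move=> FF; elim/big_ind : _ => // j _; apply: FF.
pose g0 := lead_coef p.
have g00 : g0 != 0 by rewrite lead_coef_eq0.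
have F01 : F0 1.
  exists 1; last by rewrite rmorph1.
  rewrite size_poly1 lt0n; apply/eqP => e0; move: sp; rewrite e0 => /eqP/size_poly1P[c c0 pE].
  by move: evp; rewrite pE evC -(rmorph0 f) => /injf /eqP; rewrite (negbTE c0).
have F0s x : F0 x -> F0 (f g0 * s * x).
  move=> [q sq ->]; exists (g0%:P * 'X * q - (q`_(e.-1))%:P * p); last first.
    by rewrite rmorphB !rmorphM evp mulr0 subr0 evC evX.
  apply/leq_sizeP => j ej; rewrite coefB -mulrA !coefCM coefXM.
  case: j ej => [|j] ej /=.
    move: ej sq; rewrite leqn0 => /eqP ->; rewrite leqn0 size_poly_eq0 => /eqP ->.
    by rewrite coef0 mul0r mulr0 subr0.
  have := ej; rewrite leq_eqVlt => /predU1P[eE|ej'].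
    by rewrite eE /= /g0 lead_coefE sp eE /= mulrC subrr.
  by rewrite [q`_j]nth_default ?(leq_trans sq) // [p`_j.+1]nth_default ?sp // !mulr0 subrr.
have F0pow i : F0 (f g0 ^+ i * s ^+ i).
  elim: i => [|i IH]; first by rewrite !expr0 mulr1.
  have -> : f g0 ^+ i.+1 * s ^+ i.+1 = f g0 * s * (f g0 ^+ i * s ^+ i) by rewrite !exprS; ring.
  exact: F0s.
pose ms := (size ps).-1; pose mr := (size pr).-1.
have F0G i : F0 (f (g0 ^+ ms) * s ^+ i).
  have [q [sq ->]] := monic_power_reduce mps rs i.
  rewrite horner_coef mulr_sumr.
  apply: (F0sum _ (fun j => f (g0 ^+ ms) * ((map_poly f q)`_j * s ^+ j))) => j jq.
  have jm : (j <= ms)%N by rewrite ltnW // (leq_trans jq) // (leq_trans (size_poly _ _)).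
  rewrite coef_map /= -{1}(subnK jm) exprD rmorphM !rmorphXn.
  have -> : f g0 ^+ (ms - j) * f g0 ^+ j * (f q`_j * s ^+ j) =
     f (g0 ^+ (ms - j) * q`_j) * (f g0 ^+ j * s ^+ j) by rewrite rmorphM rmorphXn; ring.
  exact: F0M.
(* Powers of [s] reduce to exponents below [ms], so [g0 ^+ ms] brings all of them into [F0]. The
   factor ['X^mr] turns powers of [r] into powers of ['X * r], that is of [v * s]. *)
pose G := g0 ^+ ms * 'X^mr.
have F0Gs i : F0 (f G * s ^+ i).
  have -> : f G * s ^+ i = f 'X^mr * (f (g0 ^+ ms) * s ^+ i) by rewrite /G rmorphM; ring.
  exact: F0M.
have F0Gr i : F0 (f G * r ^+ i).
  have [q [sq ->]] := monic_power_reduce mpr rr i.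
  rewrite horner_coef mulr_sumr.
  apply: (F0sum _ (fun j => f G * ((map_poly f q)`_j * r ^+ j))) => j jq.
  have jm : (j <= mr)%N by rewrite ltnW // (leq_trans jq) // (leq_trans (size_poly _ _)).
  rewrite coef_map /= /G -{1}(subnK jm) exprD !rmorphM /=.
  have -> : f (g0 ^+ ms) * (f 'X^(mr - j) * f 'X^j) * (f q`_j * r ^+ j) =
     f ('X^(mr - j) * q`_j) * (f (g0 ^+ ms) * (f 'X * r) ^+ j) by rewrite !rmorphM !rmorphXn exprMn; ring.
  rewrite -vs exprMn.
  have -> : f ('X^(mr - j) * q`_j) * (f (g0 ^+ ms) * (f v ^+ j * s ^+ j)) =
     f ('X^(mr - j) * q`_j * v ^+ j) * (f (g0 ^+ ms) * s ^+ j) by rewrite !rmorphM !rmorphXn; ring.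
  exact: F0M.
exists (f G).
  rewrite -(rmorph0 f) => /injf /eqP; rewrite /G mulf_eq0 !expf_eq0 (negbTE g00) polyX_eq0.
  by rewrite !andbF.
move=> i; have [a sa aE] := F0Gs i; have [b sb bE] := F0Gr i.
(* By independence the two sides agree coefficient by coefficient; as [v] is prime to ['X], every
   coefficient of [a] is divisible by ['X^i]. *)
have ab : 'X^i *: b = v ^+ i *: a.
  apply/eqP; rewrite -subr_eq0; apply/eqP/free.
    rewrite (leq_trans (size_polyD _ _)) // geq_max size_polyN.
    by rewrite !(leq_trans (size_scale_leq _ _)).
  rewrite rmorphB -!mul_polyC !rmorphM /= !evC -aE -bE !rmorphXn.
  have -> : f 'X ^+ i * (f G * r ^+ i) = f G * (f 'X * r) ^+ i by rewrite exprMn; ring.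
  by rewrite -vs exprMn; ring.
have vi0 : (v ^+ i)`_0 != 0 by rewrite -horner_coef0 horner_exp expf_neq0 // horner_coef0.
have /choice[c cP] j : exists c, a`_j = 'X^i * c.
  apply: (dvd_coprime_X (b := b`_j) vi0).
  by have /(congr1 (fun q : {poly {poly T}} => q`_j)) := ab; rewrite !coefZ.
rewrite aE evE horner_coef; exists (\sum_(j < size (map_poly f a)) f (c j) * s ^+ j).
rewrite mulr_sumr; apply: eq_bigr => j _.
by rewrite coef_map /= cP rmorphM rmorphXn; ring.
Qed.

Hypothesis nE : noetherian E.

(* By [common_denominator] s/X is integral, hence a power of s lies in (X), which
   contradicts s \notin P. No normality of the polynomial ring is needed. *)
Lemma going_down_X (P : set E) (u : {poly T}) : integralRange f -> is_prime_ideal P -> P (f 'X) ->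
  (forall Q, is_prime_ideal Q -> Q (f 'X) -> Q `<=` P -> P `<=` Q) -> P (f u) -> u`_0 = 0.
Proof.
move=> intf pP PX minP Pu; apply/eqP/negPn/negP => u0; have iP := prime_is_ideal pP.
pose S := [set x : E | exists n s, ~ P s /\ x = f u ^+ n * s].
have mS : is_mult_closed S.
  split; first by exists 0%N, 1; split; [exact: prime_neq1|rewrite expr0 mulr1].
  move=> _ _ [n [s [Ps ->]]] [m [t [Pt ->]]]; exists (n + m)%N, (s * t).
  by split; [exact: primeMn|rewrite exprD; ring].
have [n [s [Ps [r usE]]]] : exists n s, ~ P s /\ principal (f 'X) (f u ^+ n * s).
  apply: contrapT => no.
  have [|Q [pQ XQ QS]] := prime_exists nE (principal_ideal (f 'X)) mS.
    by move=> x Xx [n [s [Ps xE]]]; apply: no; exists n, s; rewrite -xE.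
  have QP : Q `<=` P.
    move=> x Qx; apply: contrapT => Px; apply: (QS x) => //.
    by exists 0%N, x; rewrite expr0 mul1r.
  have PQ := minP Q pQ (XQ _ (principal_gen _)) QP.
  apply: (QS _ (PQ _ Pu)); exists 1%N, 1; rewrite expr1 mulr1; split=> //; exact: prime_neq1.
have v0 : (u ^+ n)`_0 != 0 by rewrite -horner_coef0 horner_exp expf_neq0 // horner_coef0.
have [G G0 GP] : exists2 G : E, G <> 0 & forall i, exists e, G * s ^+ i = f 'X ^+ i * e.
  by apply: (@common_denominator s r (u ^+ n)) => //; rewrite rmorphXn.
have {GP} /choice[e eP] := GP.
(* Here [e i] stands for $G s^i / X^i$. Expressing [e m] through earlier ones, multiplying by $X^m$
   and cancelling [G] gives $s^m = \sum_{i<m} c_i X^{m-i} s^i$. *)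
pose I n := span [seq e i | i <- iota 0 n].
have Ie i m : (i < m)%N -> I m (e i).
  by move=> im; apply: span_gen; apply: map_f; rewrite mem_iota.
have [|m|m mP] := @ideal_acc E nE I.
- by move=> m; apply: span_ideal.
- apply: span_sub; first exact: span_ideal.
  by move=> x /mapP[i]; rewrite mem_iota add0n => /andP[_ im] ->; apply: Ie; apply: leqW.
have : principal (f 'X) (s ^+ m).
  have [c eE] : I m (e m) by apply: (mP m.+1); apply: Ie.
  pose d := \sum_(i < m) c i * (f 'X ^+ (m - i.+1) * s ^+ i).
  exists d; suff : G * (s ^+ m - f 'X * d) = 0 by move/dom => [//|/subr0_eq].
  rewrite mulrBr eP eE /lin size_map size_iota mulr_sumr /d !mulr_sumr -sumrB big1 // => i _.
  rewrite (nth_map 0%N) ?size_iota // nth_iota // add0n.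
  have -> : f 'X ^+ m = f 'X * f 'X ^+ (m - i.+1) * f 'X ^+ i.
    by rewrite -exprS -exprD; congr (_ ^+ _); rewrite addSnnS subnK.
  have -> : G * (f 'X * (c i * (f 'X ^+ (m - i.+1) * s ^+ i))) =
    f 'X * (c i * (f 'X ^+ (m - i.+1) * (G * s ^+ i))) by ring.
  by rewrite eP; ring.
by move=> [d sE]; apply: Ps; apply: (@primeX _ _ _ m) => //; rewrite sE; apply: idealMr.
Qed.

End SerreTrick.

(** * Noether normalization and catenarity *)

Lemma chain0_eq (A : comPzRingType) (P Q : set A) : chain 0 P Q -> P = Q.
Proof. by move E: 0%N => n c; case: c E. Qed.

Lemma chain_lconsP (A : comPzRingType) m (P Q : set A) : chain m.+1 P Q ->
  exists P', P `<` P' /\ chain m P' Q.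
Proof.
elim: m Q => [|m IH] Q /chain_rconsP[Q1 [c pQ lt]].
  by exists Q; rewrite (chain0_eq c); split=> //; apply: chain_nil.
have [P' [PP' c']] := IH _ c; exists P'; split=> //; exact: chain_rcons lt.
Qed.

Fixpoint tower (k : fieldType) (d : nat) : idomainType :=
  if d is d'.+1 then {poly (tower k d')} else k.

Section Nagata.
Variable A : idomainType.

(* The automorphism Y -> Y + Z^N followed by the exchange of Y and Z. *)
Lemma nagata_twist (h : {poly {poly A}}) : lead_coef (lead_coef h) \is a GRing.unit ->
  exists (g g' : {rmorphism {poly {poly A}} -> {poly {poly A}}}),
    [/\ cancel g g', cancel g' g & lead_coef (g h) \is a GRing.unit].
Proof.
(* [N] exceeds the size of every coefficient, so that in [gE] the term with the largest [j]
   dominates all the others. *)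
move=> uh; pose sz j := size h`_j; pose N := ((\max_(j < size h) sz j).+1)%N.
have h0 : h != 0 by apply: contraTneq uh => ->; rewrite !lead_coef0 unitr0.
pose s : {poly {poly A}} := 'X + ('X^N)%:P; pose s' : {poly {poly A}} := 'X - ('X^N)%:P.
pose g : {rmorphism {poly {poly A}} -> {poly {poly A}}} := @swapXY A \o comp_poly s.
pose g' : {rmorphism {poly {poly A}} -> {poly {poly A}}} := comp_poly s' \o @swapXY A.
exists g, g'; split=> [x|x|].
- rewrite /g /g' /= swapXYK -comp_polyA /s comp_polyD comp_polyX comp_polyC /s'.
  by rewrite subrK comp_polyXr.
- rewrite /g /g' /= -comp_polyA /s' comp_polyB comp_polyX comp_polyC /s addrK comp_polyXr.
  by rewrite swapXYK.
pose M : {poly {poly A}} := 'X^N + 'X%:P.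
have MN : M \is monic /\ size M = N.+1.
  have sX : (size (('X : {poly A})%:P : {poly {poly A}}) < size ('X^N : {poly {poly A}}))%N.
    by rewrite size_polyXn (leq_ltn_trans (size_polyC_leq1 _)).
  split; last by rewrite size_polyDl // size_polyXn.
  by rewrite monicE lead_coefDl // lead_coefXn.
have gE : g h = \sum_(j < size h) map_poly polyC h`_j * M ^+ j.
  rewrite /g /= comp_polyE rmorph_sum; apply: eq_bigr => j _ /=.
  rewrite -mul_polyC rmorphM rmorphXn /= swapXY_polyC; congr (_ * _ ^+ _).
  by rewrite /s rmorphD /= swapXY_X swapXY_polyC map_polyXn addrC.
have sM (a : {poly A}) j : a != 0 -> size (map_poly polyC a * M ^+ j) = (size a + N * j)%N.
  move=> a0; have Mj0 : M ^+ j != 0 by rewrite monic_neq0 // monic_exp // MN.1.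
  have MX : size (M ^+ j) = (N * j).+1.
    by rewrite -(prednK (_ : 0 < size (M ^+ j))%N) ?size_exp ?MN.2 // lt0n size_poly_eq0.
  by rewrite size_mul ?map_poly_eq0_id0 ?polyC_eq0 ?lead_coef_eq0 // MX size_map_polyC addnS.
set t := (size h).-1.
have st : size h = t.+1 by rewrite /t prednK // lt0n size_poly_eq0.
have ht0 : h`_t != 0 by rewrite -lead_coefE lead_coef_eq0.
have low : (size (\sum_(j < t) map_poly polyC h`_j * M ^+ j)%R <
    size (map_poly polyC h`_t * M ^+ t)%R)%N.
  rewrite sM //; apply: (@leq_ltn_trans (N * t)); last first.
    by rewrite -[X in (X < _)%N]add0n ltn_add2r lt0n size_poly_eq0.
  apply: leq_trans (size_sum _ _ _) _; apply/bigmax_leqP => j _.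
  have [->|hj] := eqVneq h`_j 0; first by rewrite rmorph0 mul0r size_poly0.
  rewrite sM //.
  have sj : (sz j < N)%N.
    have jh : (j < size h)%N by rewrite st ltnS ltnW.
    by rewrite ltnS (leq_bigmax (F := fun i : 'I_(size h) => sz i) (Ordinal jh)).
  have jt : (N + N * j <= N * t)%N by rewrite -mulnS leq_mul2l ltn_ord orbT.
  by apply: leq_trans jt; rewrite leq_add2r ltnW.
rewrite gE st big_ord_recr /= lead_coefDr // lead_coefM.
have /monicP-> : M ^+ t \is monic by apply: monic_exp; exact: MN.1.
rewrite mulr1 lead_coef_map_inj //; last exact: polyC_inj.
by rewrite -lead_coefE; apply: rmorph_unit.
Qed.

End Nagata.

(** Induction on the number of variables: an automorphism acting on the coefficients first gives the
    leading coefficient an invertible leading coefficient of its own, as [nagata_twist] requires. *)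
Lemma nagata (k : fieldType) m (h : tower k m.+1) : h != 0 ->
  exists (g g' : {rmorphism {poly tower k m} -> {poly tower k m}}),
    [/\ cancel g g', cancel g' g & lead_coef (g h : {poly tower k m}) \is a GRing.unit].
Proof.
elim: m h => [|m IH] h h0.
  by exists idfun, idfun; split=> //; rewrite unitfE lead_coef_eq0.
have a0 : lead_coef (h : {poly tower k m.+1}) != 0 by rewrite lead_coef_eq0.
have [b [b' [bK b'K ub]]] := IH _ a0.
pose mb : {rmorphism {poly tower k m.+1} -> {poly tower k m.+1}} := map_poly b.
pose mb' : {rmorphism {poly tower k m.+1} -> {poly tower k m.+1}} := map_poly b'.
have mK : cancel mb mb'.
  by move=> x; rewrite /mb /mb' /= -map_poly_comp map_poly_id // => y _ /=; apply: bK.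
have mK' : cancel mb' mb.
  by move=> x; rewrite /mb /mb' /= -map_poly_comp map_poly_id // => y _ /=; apply: b'K.
have uh : lead_coef (lead_coef (mb h) : {poly tower k m}) \is a GRing.unit.
  by rewrite /mb /= lead_coef_map_inj //; [exact: can_inj bK|exact: rmorph0].
have [g [g' [gK g'K ug]]] := nagata_twist uh.
exists (g \o mb), (mb' \o g'); split=> //.
  by move=> x /=; rewrite gK mK.
by move=> x /=; rewrite mK' g'K.
Qed.

(** After the automorphism, the variable is a root of [H(Y) - H], which is monic up to a unit; so
    substituting [H] for the variable is integral. Since [h] is not a unit, [H] has positive
    degree. *)
Lemma nagata_normalization (k : fieldType) m (h : tower k m.+1) : h != 0 ->
  h \isn't a GRing.unit -> exists f : {rmorphism {poly tower k m} -> {poly tower k m}},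
    [/\ injective f, integralRange f & f 'X = h].
Proof.
move=> h0 uh; have [g [g' [gK g'K ug]]] := nagata h0.
set H : {poly tower k m} := g h in ug.
have sH : (1 < size H)%N.
  rewrite ltnNge; apply: contra uh => /size1_polyC HE.
  have uH : H \is a GRing.unit.
    by rewrite HE; apply: rmorph_unit; have := ug; rewrite {1}HE lead_coefC.
  by rewrite -(gK h); apply: rmorph_unit.
pose c : {rmorphism {poly tower k m} -> {poly tower k m}} := comp_poly H.
have cC a : c a%:P = a%:P by rewrite /c /= comp_polyC.
have intX : integralOver c 'X.
  pose u := (lead_coef H)^-1.
  pose p : {poly {poly tower k m}} := u%:P%:P * (map_poly polyC H - 'X%:P).
  have sX : (size (('X : {poly tower k m})%:P : {poly {poly tower k m}}) < size (map_poly polyC H))%N.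
    by rewrite size_map_polyC (leq_ltn_trans (size_polyC_leq1 _)).
  exists p.
    rewrite monicE /p lead_coefM lead_coefC lead_coefDl ?size_polyN //.
    rewrite lead_coef_map_inj //; last exact: polyC_inj.
    by rewrite -polyCM mulVr.
  rewrite /root /p rmorphM rmorphB /= !map_polyC /= -map_poly_comp hornerM hornerD hornerN !hornerC.
  rewrite (eq_map_poly (g := polyC)) => [|a] /=; last by rewrite comp_polyC.
  have -> : (map_poly polyC H).['X] = H by rewrite -[RHS]comp_polyXr.
  by rewrite comp_polyX subrr mulr0.
have intc : integralRange c.
  move=> q; rewrite -[q]comp_polyXr /comp_poly; apply: integral_horner => //.
  by apply/integral_poly => i; rewrite coef_map /= -cC; apply: integral_id.
exists (g' \o c); split.
- move=> x y /= /(can_inj g'K) /eqP; rewrite -subr_eq0 -comp_polyB comp_poly_eq0 // subr_eq0.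
  by move/eqP.
- by move=> x; rewrite -(gK x); apply: integral_rmorph.
- by rewrite /c /= comp_polyX gK.
Qed.

Lemma noetherian_tower (k : fieldType) d : noetherian (tower k d).
Proof.
elim: d => [|d IH]; last exact: noetherian_poly.
move=> I iI; have [[x [Ix x0]]|no] := pselect (exists x : k, I x /\ x != 0).
  exists [:: x]; split=> [y|y _]; first by rewrite inE => /eqP->.
  by exists (fun=> y / x); rewrite /lin big_ord1 /= divfK.
exists [::]; split=> // y Iy; exists (fun=> 0); rewrite /lin big_ord0.
by apply/eqP/negPn/negP => y0; apply: no; exists y.
Qed.

Section Normalization.
Variables (k : fieldType) (B : comNzRingType).
Hypothesis nB : noetherian B.

(* The rank d of a Noether normalization of B/P. It drops by exactly one when P
   is replaced by a prime immediately above it, whence catenarity. *)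
Definition norm_rank (P : set B) d := exists (E : comNzRingType) (p : {rmorphism B -> E})
  (f : {rmorphism tower k d -> E}),
  [/\ forall e, exists b, p b = e, forall b, p b = 0 <-> P b, injective f & integralRange f].

Lemma quotient_domain (P : set B) (E : comNzRingType) (p : {rmorphism B -> E}) :
  is_prime_ideal P -> (forall e, exists b, p b = e) -> (forall b, p b = 0 <-> P b) ->
  forall x y : E, x * y = 0 -> x = 0 \/ y = 0.
Proof.
move=> pP sp kp x y; have [a <-] := sp x; have [b <-] := sp y.
by rewrite -rmorphM => /kp /(primeM pP)[] /kp; [left|right].
Qed.

Lemma surj_fracmap (E : comNzRingType) (p : {rmorphism B -> E}) :
  (forall e, exists b, p b = e) -> fracmap p.
Proof.
by move=> sp d; have [b <-] := sp d; exists b, 1, 1; rewrite rmorph1 !mulr1.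
Qed.

(** A nonzero element of the kernel is turned into a variable by [nagata_normalization], and this
    variable is then dropped. *)
Lemma norm_rank_domain (E : comNzRingType) m (f : {rmorphism tower k m -> E}) :
  (forall x y : E, x * y = 0 -> x = 0 \/ y = 0) -> integralRange f ->
  exists d (f' : {rmorphism tower k d -> E}), injective f' /\ integralRange f'.
Proof.
move=> dom; elim: m f => [|m IH] f intf; first by exists 0%N, f; split=> //; exact: fmorph_inj.
have [injf|/existsNP[h /not_implyP[fh /eqP h0]]] := pselect (forall h, f h = 0 -> h = 0).
  exists m.+1, f; split=> // x y fxy; apply/eqP; rewrite -subr_eq0; apply/eqP/injf.
  by rewrite rmorphB fxy subrr.
have uh : h \isn't a GRing.unit.
  apply/negP => /divrr /(congr1 f); rewrite rmorphM fh mul0r rmorph1 => /esym/eqP.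
  by rewrite oner_eq0.
have [g [_ intg gX]] := nagata_normalization h0 uh.
pose w : {rmorphism {poly tower k m} -> E} := f \o g.
have wX : w 'X = 0 by rewrite /w /= gX.
apply: (IH (w \o polyC)); apply: integral_poly_X0 => // x.
exact: integral_trans.
Qed.

Lemma norm_rank_exists m (f : {rmorphism tower k m -> B}) P : integralRange f ->
  is_prime_ideal P -> exists d, norm_rank P d.
Proof.
move=> intf pP.
have [E [p [sp kp]]] := nz_quotient (prime_is_ideal pP) (prime_neq1 pP).
have [x|d [f' [injf intf']]] := @norm_rank_domain E m (p \o f) (quotient_domain pP sp kp).
  by have [b <-] := sp x; apply: integral_rmorph.
by exists d, E, p, f'.
Qed.

Lemma norm_rank0 P Q : is_prime_ideal P -> norm_rank P 0 -> is_prime_ideal Q -> P `<=` Q -> Q `<=` P.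
Proof.
move=> pP [E [p [f [sp kp injf intf]]]] pQ PQ x Qx; apply/kp; apply: contrapT => px0.
have [t t0 [e te]] := integral_multiple (quotient_domain pP sp kp) injf (intf (p x)) px0.
have [b be] := sp e; have [b' b'E] := sp (f t^-1).
apply: (prime_neq1 pQ); have iQ := prime_is_ideal pQ.
have : P (x * b * b' - 1).
  apply/kp; rewrite rmorphB !rmorphM be b'E -te -rmorphM mulfV // !rmorph1.
  exact: subrr.
move=> /PQ Qd; have -> : 1 = x * b * b' - (x * b * b' - 1) by ring.
by apply: idealB => //; rewrite -mulrA; apply: idealMr.
Qed.

Lemma norm_rankS_not_maximal P d : is_prime_ideal P -> norm_rank P d.+1 ->
  exists Q, is_prime_ideal Q /\ P `<` Q.
Proof.
move=> pP [E [p [f [sp kp injf intf]]]]; have iP := prime_is_ideal pP.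
have [x xE] := sp (f 'X).
pose I := add_ideal P (principal x).
have iI : is_ideal I by apply: add_ideal_ideal => //; apply: principal_ideal.
have I1 : ~ I 1.
  move=> [y [_ [Py [b ->] yE]]]; apply: (integral_field_dim0 injf intf); exists (p b).
  have /(congr1 p) := yE; rewrite rmorph1 rmorphD rmorphM (proj2 (kp y) Py) add0r xE.
  by move=> ->.
have [Q [pQ IQ]] := prime_over nB iI I1; exists Q; split=> //; split.
  by move=> y Py; apply: IQ; apply: add_ideall => //; apply: principal_ideal.
move=> QP; have : f 'X = 0.
  rewrite -xE; apply/kp/QP/IQ; apply: add_idealr => //; exact: principal_gen.
by rewrite -(rmorph0 f) => /injf /eqP; rewrite polyX_eq0.
Qed.

Definition successor (P P' : set B) := [/\ is_prime_ideal P', P `<` P' &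
  forall Q, is_prime_ideal Q -> P `<=` Q -> Q `<` P' -> Q `<=` P].

Lemma successor_exists P Q : is_prime_ideal P -> is_prime_ideal Q -> P `<` Q ->
  exists P', successor P P' /\ P' `<=` Q.
Proof.
move=> pP pQ [PQ /existsNP[f /not_implyP[Qf Pf]]].
have [P' [pP' PP' P'f P'Q mP']] := minimal_prime_below nB pP pQ PQ Qf.
exists P'; split=> //; split=> //; first by split=> // sub; apply: Pf; apply: sub.
by apply: (krull_pit nB pP pP' PP' P'f) => T pT PT Tf; apply: mP'.
Qed.

(** A nonzero [h] of the polynomial ring falls into [P'] modulo [P]. Normalizing again with [h] as a
    variable makes [P'] minimal over it, and [going_down_X] shows that the contraction of [P'] is
    generated by that variable; the remaining variables normalize the quotient by [P']. *)
Lemma norm_rank_successor P P' d : is_prime_ideal P -> norm_rank P d.+1 -> successor P P' ->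
  norm_rank P' d.
Proof.
move=> pP [E [p [f [sp kp injf intf]]]] [pP' [PP' P'P] minP'].
have dom := quotient_domain pP sp kp; have fp := surj_fracmap sp.
have nE : noetherian E := fracmap_noetherian fp nB.
have iP' := prime_is_ideal pP'.
have okP' : frac_ok p P'.
  split=> [s u su P's|x /kp /PP' //]; apply: (prime_neq1 pP').
  have [b bu] := sp u; have -> : 1 = s * b - (s * b - 1) by ring.
  apply: idealB => //; [exact: idealMr|apply: PP'; apply/kp].
  by rewrite rmorphB rmorphM bu su rmorph1 subrr.
pose Q := frac_ext p P'.
have pQ : is_prime_ideal Q := frac_ext_prime fp pP' okP'.
have QK : p @^-1` Q = P' := frac_extK pP' okP'.
have Qp b : Q (p b) <-> P' b.
  have -> : Q (p b) = P' b := congr1 (fun S : set B => S b) QK.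
  by [].
have /existsNP[x /not_implyP[P'x Px]] := P'P.
have px0 : p x <> 0 by move/kp.
have [h h0 [e he]] := integral_multiple dom injf (intf (p x)) px0.
have Qh : Q (f h) by rewrite he; apply: idealMr; [exact: prime_is_ideal|apply/Qp].
have uh : h \isn't a GRing.unit.
  apply/negP => /divrr hh; apply: (prime_neq1 pQ); rewrite -(rmorph1 f) -hh rmorphM.
  by apply: idealMr => //; apply: prime_is_ideal.
have [g [injg intg gX]] := nagata_normalization h0 uh.
pose w : {rmorphism {poly tower k d} -> E} := f \o g.
have injw : injective w := inj_comp injf injg.
have intw : integralRange w by move=> y; apply: integral_trans.
have QX : Q (w 'X) by rewrite /w /= gX.
have minQ T : is_prime_ideal T -> T (w 'X) -> T `<=` Q -> Q `<=` T.
  move=> pT TX TQ; apply: (fracmap_sub fp); [exact: prime_is_ideal|exact: prime_is_ideal|].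
  rewrite QK; apply: contrapT => P'T.
  have PT : P `<=` p @^-1` T by move=> b /kp pb; rewrite /= pb; apply: ideal0; apply: prime_is_ideal.
  have TP' : p @^-1` T `<` P' by split=> // b /TQ /Qp.
  have [y yE] := sp (w 'X).
  have : P y by apply: (minP' _ (preim_prime p pT) PT TP'); rewrite /= yE.
  by move/kp; rewrite yE -(rmorph0 w) => /injw /eqP; rewrite polyX_eq0.
have [E' [s [ss ks]]] := nz_quotient (prime_is_ideal pQ) (prime_neq1 pQ).
exists E', (s \o p), ((s \o w) \o polyC); split.
- by move=> y; have [z <-] := ss y; have [b <-] := sp z; exists b.
- by move=> b; rewrite /= ks.
- move=> a b /= /eqP; rewrite -subr_eq0 -!rmorphB => /eqP/ks Qab.
  have := going_down_X dom injw nE intw pQ QX minQ Qab.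
  by rewrite coefC => /eqP; rewrite subr_eq0 => /eqP.
- apply: integral_poly_X0 => [|y]; first by apply/ks.
  by have [z <-] := ss y; apply: integral_rmorph.
Qed.

(** Replacing the bottom by a successor [P1] below the next prime lowers the rank by one and costs
    the chain at most one link. The same descent first shows that the rank is well defined. *)
Lemma norm_rank_chain_le P Q m d e : norm_rank P d -> norm_rank Q e -> chain m P Q -> (m + e <= d)%N.
Proof.
have unique : forall d e P, is_prime_ideal P -> norm_rank P d -> norm_rank P e -> (e <= d)%N.
  elim=> [|d' IH] [|e'] P' // pP' rd re.
    have [Q' [pQ' [PQ QP]]] := norm_rankS_not_maximal pP' re.
    by case: QP; apply: norm_rank0 rd _ _.
  have [Q' [pQ' lt]] := norm_rankS_not_maximal pP' re.
  have [P1 [sP1 _]] := successor_exists pP' pQ' lt.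
  by rewrite ltnS; apply: (IH _ P1); [case: sP1|exact: norm_rank_successor rd sP1|exact: norm_rank_successor re sP1].
elim: d m P => [|d IH] m P rP rQ c; have pP := chain_primel c.
  have QP := norm_rank0 pP rP (chain_primer c) (chain_sub c).
  have m0 := chain_le0 c QP; rewrite m0 add0n.
  apply: (unique 0%N e P) => //; have -> : P = Q by apply/seteqP; split; [exact: chain_sub c|].
  exact: rQ.
case: m c => [|m] c.
  rewrite add0n; apply: (unique _ _ P) => //; by rewrite (chain0_eq c).
have [P' [lt c']] := chain_lconsP c.
have [P1 [sP1 P1P']] := successor_exists pP (chain_primel c') lt.
have rP1 := norm_rank_successor pP rP sP1; have [pP1 _ _] := sP1.
have [P'P1|P'P1] := pselect (P' `<=` P1).
  have e1 : P1 = P' by apply/seteqP.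
  by rewrite addSn ltnS; apply: (IH _ P1) => //; rewrite e1.
have c1 : chain m.+1 P1 Q by apply: chain_cons c'.
by rewrite (leq_trans (IH _ _ rP1 rQ c1)).
Qed.

Lemma norm_rank_chain P Q d : norm_rank P d -> is_prime_ideal P -> is_prime_ideal Q -> P `<=` Q ->
  exists e m, [/\ norm_rank Q e, chain m P Q & d = (m + e)%N].
Proof.
elim: d P => [|d IH] P rP pP pQ PQ.
  have QP := norm_rank0 pP rP pQ PQ; have -> : Q = P by apply/seteqP.
  by exists 0%N, 0%N; split=> //; apply: chain_nil.
have [QP|QP] := pselect (Q `<=` P).
  have -> : Q = P by apply/seteqP.
  by exists d.+1, 0%N; split=> //; apply: chain_nil.
have [P1 [sP1 P1Q]] := successor_exists pP pQ (conj PQ QP).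
have rP1 := norm_rank_successor pP rP sP1; have [pP1 lt _] := sP1.
have [e [m [rQ c ->]]] := IH P1 rP1 pP1 pQ P1Q.
by exists e, m.+1; split=> //; apply: chain_cons c.
Qed.

Lemma catenary m0 (f0 : {rmorphism tower k m0 -> B}) : integralRange f0 ->
  forall m (P Q Q' : set B), chain m P Q' -> is_prime_ideal Q -> P `<=` Q -> Q `<=` Q' ->
  exists a b, [/\ chain a P Q, chain b Q Q' & (m <= a + b)%N].
Proof.
move=> intf m P Q Q' c pQ PQ QQ'; have pP := chain_primel c; have pQ' := chain_primer c.
have [d rP] := norm_rank_exists intf pP.
have [e [a [rQ ca dE]]] := norm_rank_chain rP pP pQ PQ.
have [e' [b [rQ' cb eE]]] := norm_rank_chain rQ pQ pQ' QQ'.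
exists a, b; split=> //.
by rewrite -(leq_add2r e') -addnA -eE -dE; apply: norm_rank_chain_le rP rQ' c.
Qed.

End Normalization.

(** * One step of the ind-pro completion *)

Section ConcreteCompletion.
Variables (X : comPzRingType) (F : filtration X).

Definition component l (x : completion F) : quot_ring (F l) := x l.

Lemma component_zmod l : zmod_morphism (component l). Proof. by []. Qed.
Lemma component_monoid l : monoid_morphism (component l). Proof. by split. Qed.
HB.instance Definition _ l := GRing.isZmodMorphism.Build (completion F) (quot_ring (F l))
  (component l) (component_zmod l).
HB.instance Definition _ l := GRing.isMonoidMorphism.Build (completion F) (quot_ring (F l))
  (component l) (component_monoid l).

Definition comp_ker l : set (completion F) := component l @^-1` [set 0].

Lemma comp_ker_ideal l : is_ideal (comp_ker l).
Proof. exact/preim_ideal/set0_ideal. Qed.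

Lemma comp_ker_embed l a : comp_ker l (completion_embed F a) <-> (F l : set X) a.
Proof. exact: quot_pi_eq0. Qed.

Lemma comp_ker_decr l : comp_ker l.+1 `<=` comp_ker l.
Proof.
move=> x x0; have [a [xS xl]] := completion_repr x l.
apply: (eq_trans xl); apply/quot_pi_eq0/filtration_decr/quot_pi_eq0.
exact: eq_trans (esym xS) x0.
Qed.

Lemma comp_ker_approx l x : exists a, comp_ker l (x - completion_embed F a).
Proof.
exists (repr (x l)).
change (x l - quot_pi (F l) (repr (x l)) = 0).
by rewrite /quot_pi reprK subrr.
Qed.

Lemma comp_ker_sep x : (forall l, comp_ker l x) -> x = 0.
Proof. by move=> x0; apply: completionE => l; apply: etrans (x0 l) (esym (rmorph0 (component l))). Qed.

Lemma comp_ker_complete (a : nat -> X) : (forall l, (F l : set X) (a l)) ->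
  exists y, forall m, comp_ker m (y - completion_embed F (\sum_(l < m) a l)).
Proof.
move=> Fa; pose y l : quot_ring (F l) := quot_pi (F l) (\sum_(j < l) a j).
have cy : `[< coherent y >].
  apply: coherentP => l; exists (\sum_(j < l.+1) a j); split=> //.
  by apply/quot_ringP; rewrite big_ord_recr opprD addNKr /=; apply: idealN => //; apply: idealP.
exists (Completion cy) => m; exact: subrr.
Qed.

End ConcreteCompletion.

Section AdicPowers.
Variables (R X : comPzRingType) (f : {rmorphism R -> X}) (P : set R) (s : seq R).
Hypothesis iP : is_ideal P.
Hypothesis sP : forall x, x \in s -> P x.
Hypothesis Ps : P `<=` span s.

Lemma ext_ideal_pow l : ext_ideal f (ideal_pow P l) = pw [seq f x | x <- s] l.
Proof.
have iE l' := ext_ideal_ideal f (ideal_pow P l').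
have iI l' := idealP (ideal_pow P l').
elim: l => [|l IH]; apply/seteqP; split.
- by [].
- move=> x _; rewrite -[x]mulr1 -(rmorph1 f); apply: (idealMl _ (iE 0%N)).
  by apply: ext_ideal_gen => J [_ JT]; apply: JT.
- apply: ext_ideal_sub; first exact: pw_ideal.
  have ip : is_ideal (f @^-1` pw [seq f x | x <- s] l.+1) by apply/preim_ideal/pw_ideal.
  move=> z /= Iz; apply: (Iz (f @^-1` pw [seq f x | x <- s] l.+1)); split=> // _ [x [y [Px ly ->]]].
  change (pw [seq f x | x <- s] (1 + l) (f (x * y))); rewrite rmorphM; apply: pwD.
    have [c ->] := Ps Px; rewrite /lin rmorph_sum; apply: ideal_sum; first exact: pw_ideal.
    move=> i _; rewrite rmorphM; apply: idealMl; first exact: pw_ideal.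
    by apply: pw_gen; apply: (map_f f); apply: mem_nth.
  by rewrite -IH; apply: ext_ideal_gen.
- move=> _ [c [lc ->]]; apply: ideal_sum => // i _; rewrite mulrC.
  have /mapP[x xs ->] := mem_nth 0 (ltn_ord i).
  move: (lc i); rewrite -/(pw _ l) -IH; apply: (ext_ideal_sub (J := [set z | ext_ideal f (ideal_pow P l.+1) (f x * z)])).
    split=> [|y z|y z] /=.
    + by rewrite mulr0; apply: (ideal0 (iE l.+1)).
    + by rewrite mulrDr; apply: (idealD (iE l.+1)).
    + by rewrite mulrCA; apply: (idealMl _ (iE l.+1)).
  move=> y ly /=; rewrite -rmorphM; apply: ext_ideal_gen => J [_ JT]; apply: JT.
  by exists x, y; split=> //; apply: sP.
Qed.

End AdicPowers.

Lemma ext_ideal_comp (A B C : comPzRingType) (e : {rmorphism A -> B}) (f : {rmorphism B -> C}) I :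
  ext_ideal (f \o e) I = ext_ideal f (ext_ideal e I).
Proof.
apply/seteqP; split; apply: ext_ideal_sub; try exact: ext_ideal_ideal.
  by move=> x Ix; apply: (@ext_ideal_gen _ _ f); apply: ext_ideal_gen.
apply: ext_ideal_sub; first exact/preim_ideal/ext_ideal_ideal.
by move=> x Ix; apply: (@ext_ideal_gen _ _ (f \o e)).
Qed.

(* Nonzerodivisors modulo a prime of the base stay nonzerodivisors modulo its
   extension: the only consequence of flatness that is needed. *)
Definition flat_at (R M : comPzRingType) (f : R -> M) (P : set R) :=
  forall t x, ~ P t -> ext_ideal f P (f t * x) -> ext_ideal f P x.

Section Steps.
Variable R : comPzRingType.
Hypothesis nR : noetherian R.
Implicit Types (p : prime_ideal R) (M : pz_algebra R).

Definition step p M := complete_along p (localize_at p M).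

Lemma localize_flat p M P : flat_at (pz_algebra_map M) P -> flat_at (pz_algebra_map (localize_at p M)) P.
Proof.
move=> fl t x Pt.
pose e : {rmorphism M -> localization (compl_image p M)} := @loc_embed M (compl_image p M).
have eF d : exists a s, (compl_image p M : set M) s /\ d * e s = e a := loc_embed_fracP d.
have eU s : (compl_image p M : set M) s -> exists u, e s * u = 1 := @loc_embed_unit _ _ s.
rewrite [ext_ideal _ _](ext_ideal_comp (pz_algebra_map M) e P) /=.
set I := ext_ideal (pz_algebra_map M) P => Itx; have iI : is_ideal I by exact: ext_ideal_ideal.
have [_ SM] := mult_setP (compl_image p M).
have [S1 _] := mult_setP (compl_image p M).
have spec b : ext_ideal e I (e b) -> exists s, (compl_image p M : set M) s /\ I (s * b).
  move=> Ib; have : [set d | exists b s, [/\ I b, (compl_image p M : set M) s & d * e s = e b]] (e b).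
    apply: (ext_ideal_sub (e := e) _ _ Ib); last first.
      by move=> y Iy; exists y, 1; split=> //; rewrite rmorph1 mulr1.
    split.
    - by exists 0, 1; split=> //; [exact: (ideal0 iI)|rewrite rmorph0 mul0r].
    - move=> y z [b1 [s1 [I1 s1S E1]]] [b2 [s2 [I2 s2S E2]]].
      exists (b1 * s2 + b2 * s1), (s1 * s2); split; last by rewrite rmorphD !rmorphM -E1 -E2; ring.
        by apply: (idealD iI); apply: (idealMr _ iI).
      exact: SM.
    - move=> a z [b1 [s1 [I1 s1S E1]]]; have [c [s2 [s2S E2]]] := eF a.
      exists (c * b1), (s2 * s1); split; [exact: (idealMl _ iI)|exact: SM|].
      by rewrite !rmorphM -E1 -E2; ring.
  move=> [c [s [Ic sS E]]].
  have /loc_embed_eq0[u [uS uE]] : e (b * s - c) = 0 by rewrite rmorphB rmorphM E subrr.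
  exists (u * s); split; first exact: SM.
  have -> : u * s * b = u * c + u * (b * s - c) by ring.
  by rewrite uE addr0; apply: (idealMl _ iI).
have [a [s [sS xs]]] := eF x; have [u su] := eU _ sS.
have iE : is_ideal (ext_ideal e I) by exact: ext_ideal_ideal.
have -> : x = u * e a by rewrite -xs -{1}[x]mulr1 -su; ring.
apply: (idealMl _ iE).
have [|v [vS vI]] := spec (pz_algebra_map M t * a).
  by rewrite rmorphM -xs mulrA; apply: (idealMr _ iE).
have [w vw] := eU _ vS.
have -> : e a = w * e (v * a) by rewrite rmorphM -{1}[e a]mul1r -vw; ring.
apply: (idealMl _ iE); apply: ext_ideal_gen; apply: (fl t) => //.
by rewrite mulrCA.
Qed.

Lemma localize_noetherian p M : noetherian M -> noetherian (localize_at p M).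
Proof.
pose e : {rmorphism M -> localization (compl_image p M)} := @loc_embed M (compl_image p M).
exact: (@fracmap_noetherian _ _ e (@loc_embed_frac M (compl_image p M))).
Qed.

Lemma localize_unit p M t : ~ (p : set R) t ->
  exists u, pz_algebra_map (localize_at p M) t * u = 1.
Proof. by move=> pt; apply: loc_embed_unit; exists t. Qed.

Lemma complete_along_adic p M : noetherian M -> exists (s : seq R) K,
  [/\ forall x, x \in s -> (p : set R) x, (p : set R) `<=` span s &
   adic_completion (@completion_embed M (adic_filtration p M))
     [seq pz_algebra_map M x | x <- s] K].
Proof.
move=> nM; have iP := prime_is_ideal (prime_idealP p).
have [s [sP Ps]] := nR iP.
have FE l : (adic_filtration p M l : set M) = pw [seq pz_algebra_map M x | x <- s] l.
  exact: (ext_ideal_pow (pz_algebra_map M) sP Ps).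
exists s, (@comp_ker M (adic_filtration p M)); split=> //; split=> //.
- exact: comp_ker_ideal.
- move=> x; rewrite /comp_ker /=; have [a <-] := quot_pi_surj (component 0 x).
  by apply/quot_pi_eq0; rewrite FE.
- exact: comp_ker_decr.
- exact: comp_ker_approx.
- by move=> l a; rewrite -FE; apply: comp_ker_embed.
- exact: comp_ker_sep.
- by move=> a la; apply: comp_ker_complete => l; rewrite FE.
Qed.

End Steps.

(** * Primes in the stages of the tower *)

Section CompletionPrimes.
Variables (X C : comPzRingType) (i : {rmorphism X -> C}) (g : seq X) (K : nat -> set C).
Hypothesis ac : adic_completion i g K.

Lemma ac_prime_down m P Q : chain m P Q -> K 1 `<=` P -> chain m (i @^-1` P) (i @^-1` Q).
Proof.
move=> c KP; apply: (chain_map (F := fun Q => i @^-1` Q) c) => [Q' pQ' _ _|Q1 Q2 p1 p2 PQ1 _ [Q12 Q21]].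
  exact: preim_prime.
split=> [x /Q12 //|sub]; apply: Q21 => x Q2x; have [a xa] := ac_approx ac 1 x.
have Q1xa := PQ1 _ (KP _ xa).
have i1 := prime_is_ideal p1; have i2 := prime_is_ideal p2.
have Q1a : Q1 (i a).
  apply: (sub a); rewrite /= -[i a](subKr x); apply: idealB => //; exact: Q12.
by rewrite -[x](subrK (i a)); apply: idealD.
Qed.

(** [C / K 1] and [X / (g)] are the same ring; on primes over [(g)] this inverts contraction. *)
Definition ac_lift (Q : set X) : set C := [set x | exists2 a, Q a & K 1 (x - i a)].

Lemma ac_liftE Q a x : is_ideal Q -> span g `<=` Q -> K 1 (x - i a) -> ac_lift Q x <-> Q a.
Proof.
move=> iQ gQ xa; split=> [[b Qb xb]|Qa]; last by exists a.
rewrite -(subrK b a); apply: idealD => //; apply: gQ; rewrite -pw1E; apply/(ac_pre ac).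
have -> : i (a - b) = (x - i b) - (x - i a) by rewrite rmorphB; ring.
by apply: idealB => //; apply: ac_ideal ac _.
Qed.

Lemma ac_lift_embed Q a : is_ideal Q -> span g `<=` Q -> ac_lift Q (i a) <-> Q a.
Proof.
move=> iQ gQ; apply: ac_liftE => //; rewrite subrr; exact: (ideal0 (ac_ideal ac 1)).
Qed.

Lemma ac_lift_prime Q : is_prime_ideal Q -> span g `<=` Q -> is_prime_ideal (ac_lift Q).
Proof.
move=> pQ gQ; have iQ := prime_is_ideal pQ; have iK := ac_ideal ac 1.
have mulE x y a b : K 1 (x - i a) -> K 1 (y - i b) -> K 1 (x * y - i (a * b)).
  move=> xa yb; have -> : x * y - i (a * b) = y * (x - i a) + i a * (y - i b) by rewrite rmorphM; ring.
  by apply: idealD => //; apply: idealMl.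
split; first split.
- by rewrite -(rmorph0 i); apply/ac_lift_embed => //; apply: ideal0.
- move=> x y [a Qa xa] [b Qb yb]; exists (a + b); first exact: idealD.
  by rewrite rmorphD opprD addrACA; apply: idealD.
- move=> x y [b Qb yb]; have [a xa] := ac_approx ac 1 x.
  by exists (a * b); [exact: idealMl|exact: mulE].
- by rewrite -(rmorph1 i) => /(ac_lift_embed _ iQ gQ); apply: prime_neq1.
- move=> x y; have [a xa] := ac_approx ac 1 x; have [b yb] := ac_approx ac 1 y.
  move=> /(ac_liftE iQ gQ (mulE _ _ _ _ xa yb)) /(primeM pQ)[Qa|Qb]; [left|right].
    by exists a.
  by exists b.
Qed.

Lemma ac_prime_up m P Q : chain m P Q -> span g `<=` P -> chain m (ac_lift P) (ac_lift Q).
Proof.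
move=> c gP; apply: (chain_map c) => [Q' pQ' PQ' _|Q1 Q2 p1 p2 PQ1 _ [Q12 Q21]].
  by apply: ac_lift_prime => // x /gP /PQ'.
have g1 : span g `<=` Q1 by move=> x /gP /PQ1.
split=> [x [a /Q12 Q2a xa]|sub]; first by exists a.
have i1 := prime_is_ideal p1; have i2 := prime_is_ideal p2.
apply: Q21 => x Q2x; apply/(ac_lift_embed _ i1 g1)/sub/ac_lift_embed => // y /g1 /Q12 //.
Qed.

End CompletionPrimes.

Section TowerAlgebras.
Variable R : comPzRingType.
Hypothesis nR : noetherian R.
Implicit Types (p q : prime_ideal R) (M : pz_algebra R).

(** The properties of a stage last completed along [p]: flatness enough for going-down, contraction
    of its primes into [p], [p] inside the Jacobson radical, and lacunary series in elements of
    [p]. *)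
Record tower_algebra p M : Prop := TowerAlgebra {
  ta_noeth : noetherian M;
  ta_flat : forall P, is_prime_ideal P -> flat_at (pz_algebra_map M) P;
  ta_unit : forall t, ~ (p : set R) t -> exists u, pz_algebra_map M t * u = 1;
  ta_jac : forall x, ext_ideal (pz_algebra_map M) p x -> exists u, (1 - x) * u = 1;
  ta_gap : forall a (m : nat -> nat), (p : set R) a -> (forall j, (m j < m j.+1)%N) ->
    exists y, forall j, exists d,
      y - \sum_(n < j) pz_algebra_map M a ^+ m n = pz_algebra_map M a ^+ m j * d
}.

Lemma step_tower_algebra p M : noetherian M ->
  (forall P, is_prime_ideal P -> flat_at (pz_algebra_map M) P) -> tower_algebra p (step p M).
Proof.
move=> nM flM; set X := localize_at p M.
have nX : noetherian X := localize_noetherian (p := p) nM.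
have [s [K [sp ps ac]]] := complete_along_adic nR (M := X) p nX.
have iK := ac_ideal ac; have preK := ac_pre ac.
set f := pz_algebra_map X in ac preK *.
set i : {rmorphism X -> completion _} := @completion_embed X _ in ac preK *.
have Kp a : (p : set R) a -> K 1 (i (f a)).
  move=> /ps[c ->]; apply/preK; rewrite /lin rmorph_sum; apply: ideal_sum; first exact: pw_ideal.
  move=> j _; rewrite rmorphM; apply: idealMl; first exact: pw_ideal.
  by apply: pw_gen; apply: (map_f f); apply: mem_nth.
split.
- exact: (completion_noetherian ac).
- move=> P pP t x Pt.
  rewrite [ext_ideal _ _](ext_ideal_comp f i P) => fx.
  apply: (completion_nonzerodivisor ac (f := f t)) fx.
    exact: ext_ideal_ideal.
  by move=> y; apply: (localize_flat (flM P pP)).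
- move=> t /(localize_unit M)[u fu]; exists (i u).
  by rewrite -[1](rmorph1 i) -fu rmorphM.
- move=> x px.
  have Kx : K 1 x by apply: (ext_ideal_sub (e := i \o f) (iK 1%N) _ px); exact: Kp.
  exact: (completion_jacobson ac Kx).
- move=> a m pa mS.
  exact: (completion_gap_series ac (Kp a pa) mS).
Qed.

Lemma ta_contract p M Q : tower_algebra p M -> is_prime_ideal Q ->
  pz_algebra_map M @^-1` Q `<=` (p : set R).
Proof.
move=> tM pQ t Qt; apply: contrapT => /(ta_unit tM)[u tu]; apply: (prime_neq1 pQ).
by rewrite -tu; apply: idealMr => //; apply: prime_is_ideal.
Qed.

Lemma step_chain_down p M m (Q1 Q2 : set (step p M)) : noetherian M -> chain m Q1 Q2 ->
  (p : set R) `<=` pz_algebra_map (step p M) @^-1` Q1 ->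
  exists Q1' Q2' : set M, [/\ chain m Q1' Q2', pz_algebra_map M @^-1` Q1' = pz_algebra_map (step p M) @^-1` Q1 &
    pz_algebra_map M @^-1` Q2' = pz_algebra_map (step p M) @^-1` Q2].
Proof.
move=> nM c pQ1; set X := localize_at p M.
have nX : noetherian X := localize_noetherian (p := p) nM.
have [s [K [sp ps ac]]] := complete_along_adic nR (M := X) p nX.
have iQ1 := prime_is_ideal (chain_primel c).
have KQ : K 1 `<=` Q1.
  move=> x Kx.
  have := completion_K1_ext ac Kx.
  rewrite pw1E; apply: (span_sub iQ1) => _ /mapP[_ /mapP[a sa ->] ->].
  exact: (pQ1 _ (sp _ sa)).
have c' := chain_preim (@loc_embed_frac M (compl_image p M)) (ac_prime_down ac c KQ).
by do 2 eexists; split; first exact: c'.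
Qed.

(** The chain survives localization because its top, hence each member, contracts into [p]; it
    survives completion because its bottom contains [p]. *)
Lemma step_chain_up p M m (Q1 Q2 : set M) : noetherian M -> chain m Q1 Q2 ->
  (p : set R) `<=` pz_algebra_map M @^-1` Q1 -> pz_algebra_map M @^-1` Q2 `<=` (p : set R) ->
  exists Q1' Q2' : set (step p M), chain m Q1' Q2' /\
    (p : set R) `<=` pz_algebra_map (step p M) @^-1` Q1'.
Proof.
move=> nM c pQ1 Q2p; set X := localize_at p M.
pose e : {rmorphism M -> X} := @loc_embed M (compl_image p M).
have fe : fracmap e := @loc_embed_frac M (compl_image p M).
have nX : noetherian X := localize_noetherian (p := p) nM.
have [s [K [sp ps ac]]] := complete_along_adic nR (M := X) p nX.
have p1 := chain_primel c; have p2 := chain_primer c.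
have nu x u : e x * u = 1 -> ~ Q2 x.
  move=> /loc_embed_unitP[y [t pt tE]] Q2x; apply: pt; apply: Q2p.
  by rewrite /= tE; apply: idealMr => //; apply: prime_is_ideal.
have ker x : e x = 0 -> Q1 x.
  move=> /loc_embed_eq0[_ [[t pt <-] tx]].
  have : Q1 (pz_algebra_map M t * x) by rewrite tx; apply: ideal0; apply: prime_is_ideal.
  by move/(primeM p1) => [/(chain_sub c) /Q2p /pt|].
have c1 := chain_ext fe c nu ker.
have ok1 : frac_ok e Q1 by split=> [x u /nu h /(chain_sub c)|].
have lift t : (p : set R) t -> frac_ext e Q1 (e (pz_algebra_map M t)).
  move=> /pQ1 Qt; have -> : frac_ext e Q1 (e (pz_algebra_map M t)) = Q1 (pz_algebra_map M t).
    exact: (congr1 (fun S : set M => S (pz_algebra_map M t)) (frac_extK p1 ok1)).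
  exact: Qt.
have i1 := prime_is_ideal (chain_primel c1).
have gQ : span [seq pz_algebra_map X x | x <- s] `<=` frac_ext e Q1.
  by apply: (span_sub i1) => _ /mapP[a sa ->]; apply/lift/sp.
do 2 eexists; split; first exact: (ac_prime_up ac c1 gQ).
by move=> t pt; apply/(ac_lift_embed ac _ i1 gQ); apply: lift.
Qed.

Lemma extend_top q M m Q1 Q2 : tower_algebra q M -> chain m Q1 Q2 ->
  exists Q', [/\ is_prime_ideal Q', Q2 `<=` Q' & pz_algebra_map M @^-1` Q' = q].
Proof.
move=> tM c; have p2 := chain_primer c; have i2 := prime_is_ideal p2.
set f := pz_algebra_map M; have iE := ext_ideal_ideal f q.
have iI : is_ideal (add_ideal Q2 (ext_ideal f q)) by exact: add_ideal_ideal.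
have [|Q' [pQ' IQ']] := prime_over (ta_noeth tM) iI.
  move=> [x [y [Q2x /(ta_jac tM)[u yu] E]]]; apply: (prime_neq1 p2).
  by rewrite -yu E addrK; apply: idealMr.
exists Q'; split=> //; first by move=> x Q2x; apply: IQ'; apply: add_ideall.
apply/seteqP; split; first exact: ta_contract.
move=> t qt; apply: IQ'; apply: (add_idealr i2); exact: ext_ideal_gen.
Qed.

(** The new prime contains the extension of [P] and avoids all products of an element outside [P]
    with an element outside [Q]; flatness at [P] keeps these products out of the extension. *)
Lemma going_down M (P P' : set R) (Q : set M) : noetherian M -> is_prime_ideal P ->
  flat_at (pz_algebra_map M) P -> is_prime_ideal Q -> pz_algebra_map M @^-1` Q = P' -> P `<` P' ->
  exists Q', [/\ is_prime_ideal Q', Q' `<` Q & pz_algebra_map M @^-1` Q' = P].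
Proof.
move=> nM pP fl pQ QP [PP' P'P]; set f := pz_algebra_map M in fl QP *.
have iE := ext_ideal_ideal f P; have iQ := prime_is_ideal pQ.
have EQ : ext_ideal f P `<=` Q by apply: ext_ideal_sub => //; rewrite QP.
pose S := [set x : M | exists t y, [/\ ~ P t, ~ Q y & x = f t * y]].
have mS : is_mult_closed S.
  split; first by exists 1, 1; rewrite rmorph1 mulr1; split=> //; apply: prime_neq1.
  move=> _ _ [t [y [Pt Qy ->]]] [t' [y' [Pt' Qy' ->]]]; exists (t * t'), (y * y').
  by split; [exact: primeMn|exact: primeMn|rewrite rmorphM; ring].
have [|Q' [pQ' EQ' QS]] := prime_exists nM iE mS.
  by move=> x Ex [t [y [Pt Qy xE]]]; apply: Qy; apply: EQ; apply: (fl t) => //; rewrite -xE.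
have Q'Q : Q' `<=` Q.
  move=> y Q'y; apply: contrapT => Qy; apply: (QS y Q'y); exists 1, y.
  by rewrite rmorph1 mul1r; split=> //; apply: prime_neq1.
have Q'P : f @^-1` Q' = P.
  apply/seteqP; split=> t; last by move=> Pt; apply: EQ'; apply: ext_ideal_gen.
  move=> Q't; apply: contrapT => Pt; apply: (QS _ Q't); exists t, 1.
  by rewrite mulr1; split=> //; apply: prime_neq1.
exists Q'; split=> //; split=> // QQ'; apply: P'P; rewrite -QP -Q'P => t; exact: QQ'.
Qed.

Lemma going_down_chain M m (P P' : set R) (Q : set M) : noetherian M ->
  (forall P, is_prime_ideal P -> flat_at (pz_algebra_map M) P) ->
  chain m P P' -> is_prime_ideal Q -> pz_algebra_map M @^-1` Q = P' ->
  exists Q', chain m Q' Q /\ pz_algebra_map M @^-1` Q' = P.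
Proof.
move=> nM fl; elim: m P' Q => [|m IH] P' Q c pQ QP.
  by exists Q; rewrite (chain0_eq c); split=> //; apply: chain_nil.
have [P1 [c1 pP' lt]] := chain_rconsP c; have pP1 := chain_primer c1.
have [Q1 [pQ1 Q1Q Q1P]] := going_down nM pP1 (fl _ pP1) pQ QP lt.
have [Q' [c' Q'P]] := IH _ _ c1 pQ1 Q1P.
by exists Q'; split=> //; apply: chain_rcons Q1Q.
Qed.

End TowerAlgebras.

Section GenericFibre.
Variables (k : fieldType) (B : comPzRingType) (kB : {rmorphism k -> B}) (b : nat -> B).
Variables (R : comPzRingType) (beta : {rmorphism B -> R}).
Hypothesis spanB : forall x, exists n, kspan kB b n x.
Hypothesis fracR : fracmap beta.

(** [R] may have uncountable dimension over [k], as $k(x)$ has for uncountable [k]. Up to units,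
    though, its elements come from [B], and ideals do not see units. *)
Lemma frac_mem (M : comPzRingType) (f : {rmorphism R -> M}) r :
  exists x, forall Q : set M, is_ideal Q -> Q (f r) <-> Q (f (beta x)).
Proof.
have [x [s [u [su rs]]]] := fracR r; exists x => Q iQ; rewrite -rs rmorphM.
split=> [Qr|Qrs]; first exact: idealMr.
have -> : f r = f r * f (beta s) * f u by rewrite -mulrA -rmorphM su rmorph1 mulr1.
exact: idealMr.
Qed.

(** The chain is rebuilt from the bottom, each new prime [Q'] staying strictly below the old prime
    [Q3] of the next level. Either [Q3] already has the right contraction, or a prime between [Q']
    and [Q2] replaces it. The old top is the link lost. *)
Lemma generic_fibre_chain (q : prime_ideal R) (M : pz_algebra R) m Q1 Q2 :
  tower_algebra q M -> chain m.+1 Q1 Q2 ->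
  exists Q', [/\ chain m Q1 Q', Q' `<` Q2 & pz_algebra_map M @^-1` Q' = pz_algebra_map M @^-1` Q1].
Proof.
move=> tM; set f := pz_algebra_map M.
elim: m Q2 => [|m IH] Q2 c; have [Q3 [c3 pQ2 lt]] := chain_rconsP c.
  rewrite -(chain0_eq c3) in lt; exists Q1; split=> //; apply: chain_nil; exact: chain_primel c.
have [Q' [c' lt' Q'E]] := IH _ c3; have pQ' := chain_primer c'; have pQ3 := chain_primer c3.
have iQ' := prime_is_ideal pQ'; have iQ3 := prime_is_ideal pQ3.
have [same|/existsNP[r /not_implyP[Q3r Q'r]]] := pselect (f @^-1` Q3 `<=` f @^-1` Q').
  exists Q3; split=> //; rewrite -Q'E; apply/seteqP; split=> // r; exact: lt'.1.
have [x xP] := frac_mem f r.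
have Q'x : ~ Q' (f (beta x)) by move=> h; apply: Q'r; apply/xP.
have Q3x : Q3 (f (beta x)) by apply/xP.
have qx : (q : set R) (beta x) by apply: (ta_contract tM pQ2); apply/lt.1.
pose S := [set f (beta y) | y in [set: B]].
have spanS y : S y -> exists n, kspan ((f \o beta) \o kB) (f \o beta \o b) n y.
  move=> [z _ <-]; have [n [d ->]] := spanB z; exists n, d.
  by rewrite !rmorph_sum; apply: eq_bigr => j _; rewrite /= !rmorphM.
have mS : is_mult_closed S.
  split; first by exists 1; rewrite ?rmorph1.
  by move=> _ _ [y _ <-] [z _ <-]; exists (y * z); rewrite ?rmorphM.
have Sx : S (f (beta x)) by exists x.
have [Q [pQ Q'Q QQ2 QS]] := prime_avoiding_subalgebra (ta_noeth tM) spanS mS pQ' pQ3 pQ2 lt' lt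
  Sx Q3x Q'x (fun l lS => ta_gap tM qx lS).
exists Q; split=> //; first exact: chain_rcons Q'Q.
have iQ := prime_is_ideal pQ.
rewrite -Q'E; apply/seteqP; split=> [t Qt|t]; last exact: Q'Q.1.
have [y yP] := frac_mem f t; apply/(yP _ iQ'); apply: QS; first by exists y.
exact/(yP _ iQ).
Qed.

End GenericFibre.

(** * Chains of primes in the tower *)

Lemma fracmap_preimK (A B : comPzRingType) (e : {rmorphism A -> B}) (P : set B) :
  fracmap e -> is_ideal P -> frac_ext e (e @^-1` P) = P.
Proof.
move=> fe iP; apply/seteqP; split=> d.
  move=> [a [s [u [Pa su ds]]]]; have -> : d = u * e a by rewrite -ds -{1}[d]mulr1 -su; ring.
  exact: idealMl.
move=> Pd; have [a [s [u [su ds]]]] := fe d; exists a, s, u; split=> //=.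
by rewrite -ds; apply: idealMr.
Qed.

Definition catenary_ring (A : comPzRingType) := forall m (P Q Q' : set A), chain m P Q' ->
  is_prime_ideal Q -> P `<=` Q -> Q `<=` Q' ->
  exists a b, [/\ chain a P Q, chain b Q Q' & (m <= a + b)%N].

Lemma fracmap_catenary (A B : comPzRingType) (e : {rmorphism A -> B}) :
  fracmap e -> catenary_ring A -> catenary_ring B.
Proof.
move=> fe cA m P Q Q' c pQ PQ QQ'.
have pP := chain_primel c; have pQ' := chain_primer c.
have [||a [b [ca cb le]]] := cA _ _ _ _ (chain_preim fe c) (preim_prime e pQ).
- by move=> x; apply: PQ.
- by move=> x; apply: QQ'.
have nu T s u : is_prime_ideal T -> e s * u = 1 -> ~ (e @^-1` T) s.
  move=> pT su Ts; apply: (prime_neq1 pT); rewrite -su.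
  by apply: idealMr => //; apply: prime_is_ideal.
have ker T x : is_prime_ideal T -> e x = 0 -> (e @^-1` T) x.
  by move=> pT x0; rewrite /= x0; apply: ideal0; apply: prime_is_ideal.
exists a, b; split=> //.
- rewrite -(fracmap_preimK fe (prime_is_ideal pP)) -(fracmap_preimK fe (prime_is_ideal pQ)).
  by apply: chain_ext => // [s u|x]; [apply: nu|apply: ker].
- rewrite -(fracmap_preimK fe (prime_is_ideal pQ)) -(fracmap_preimK fe (prime_is_ideal pQ')).
  by apply: chain_ext => // [s u|x]; [apply: nu|apply: ker].
Qed.

Section Tower.
Variables (R : comPzRingType) (D : nat -> prime_ideal R).
Hypothesis nR : noetherian R.

(** The ring obtained from the [m] primes [D j], ..., [D (j + m - 1)], with [D j] applied last;
    increasing [j] and lowering [m] peels off the outermost step. *)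
Definition tower_at j m : pz_algebra R :=
  foldr (@step R) (base_algebra R) [seq D i | i <- iota j m].

Notation str M := (pz_algebra_map M).

Lemma tower_at_flat j m : noetherian (tower_at j m) /\
  forall P, is_prime_ideal P -> flat_at (str (tower_at j m)) P.
Proof.
elim: m j => [|m IH] j.
  split=> // P pP t x Pt; have iP := prime_is_ideal pP.
  move=> /(ext_ideal_sub (e := @idfun R) iP (fun y Py => Py)) /(primeM pP)[//|Px].
  exact: (@ext_ideal_gen _ _ (@idfun R)).
have [nM flM] := IH j.+1; have tM := step_tower_algebra nR (D j) nM flM.
by split; [exact: ta_noeth tM|exact: ta_flat tM].
Qed.

Lemma tower_atP j m : tower_algebra (D j) (tower_at j m.+1).
Proof. by have [nM flM] := tower_at_flat j.+1 m; apply: step_tower_algebra. Qed.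

Lemma tower_chain_fibre j m r (Q1 Q2 : set (tower_at j m.+1)) :
  (forall i, (j <= i < j + m)%N -> (D i : set R) `<` D i.+1) ->
  chain r Q1 Q2 -> (D j : set R) `<=` str (tower_at j m.+1) @^-1` Q1 ->
  exists g, chain g (D j : set R) (D (j + m)%N) /\ (r + m <= g)%N.
Proof.
elim: m j r Q1 Q2 => [|m IH] j r Q1 Q2 incD c DQ1.
  have tj := tower_atP j 0; have [nM flM] := tower_at_flat j.+1 0.
  have [Q1' [Q2' [c' Q1E Q2E]]] := step_chain_down nR nM c DQ1.
  exists 0%N; rewrite !addn0; split; first exact: (chain_nil (prime_idealP (D j))).
  (* In the base algebra the fibre over [D j] is a single prime. *)
  rewrite leqn0; apply/eqP/(chain_le0 c') => t Q2't.
  suff Q1t : (str (base_algebra R) @^-1` Q1') t by exact: Q1t.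
  rewrite Q1E; apply: DQ1; apply: (ta_contract tj (chain_primer c)).
  by rewrite -Q2E.
have tj := tower_atP j m.+1; have [nM flM] := tower_at_flat j.+1 m.+1.
have [Q1' [Q2' [c' Q1E Q2E]]] := step_chain_down nR nM c DQ1.
have ltj : (D j : set R) `<` D j.+1 by apply: incD; rewrite leqnn addnS ltnS leq_addr.
have tS := tower_atP j.+1 m.
have [Q' [pQ' Q2Q' Q'E]] := extend_top tS c'.
have Q'Q2 : ~ Q' `<=` Q2'.
  move=> sub; apply: ltj.2; rewrite -Q'E => t /sub Q2t.
  by apply: (ta_contract tj (chain_primer c)); rewrite -Q2E.
have cQ' : chain r.+1 Q1' Q' by apply: chain_rcons c' pQ' _.
have [s [h [sD cs sh mins]]] := parameters nR (prime_idealP (D j)) (prime_idealP (D j.+1)) ltj.1.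
have [|P' [m' [Q1P' sP' cP' le]]] := chain_through_seq nM cQ' (s := [seq str (tower_at j.+1 m.+1) x | x <- s]).
  by move=> _ /mapP[x /sD xD ->]; move: xD; rewrite -Q'E.
have pP' := chain_primel cP'.
have DP' : (D j.+1 : set R) `<=` str (tower_at j.+1 m.+1) @^-1` P'.
  apply: mins; first exact: preim_prime.
  - by move=> t Dt; apply: Q1P'; have := DQ1 _ Dt; rewrite -[_ t]/((str (tower_at j m.+2) @^-1` Q1) t) -Q1E.
  - by move=> x xs; apply: sP'; apply: map_f.
  - exact: ta_contract tS pP'.
have [|g [cg le']] := IH j.+1 m' P' Q' _ cP' DP'.
  by move=> i /andP[ji im]; apply: incD; rewrite ltnW //= addnS -addSn.
exists (h + g)%N; rewrite addnS -addSn; split; first exact: chain_cat cs cg.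
rewrite size_map in le; rewrite -addSnnS (leq_trans (leq_add le (leqnn m))) //.
by rewrite addnAC addnC leq_add.
Qed.

(** One more exchange, from the contraction [P] of the bottom to [D 0], produces the height summand.
    A link possibly gained at the top is not counted here, so the total correction stays [m]. *)
Lemma tower_chain_le m r (Q1 Q2 : set (tower_at 0 m.+1)) :
  (forall i, (i < m)%N -> (D i : set R) `<` D i.+1) -> chain r Q1 Q2 ->
  exists P h g, [/\ chain h P (D 0%N : set R), chain g (D 0%N : set R) (D m) & (r + m <= h + g)%N].
Proof.
move=> incD c; have tM := tower_atP 0 m; have nM := ta_noeth tM.
pose P := str (tower_at 0 m.+1) @^-1` Q1.
have pP : is_prime_ideal P := preim_prime _ (chain_primel c).
have PD : P `<=` (D 0%N : set R) := ta_contract tM (chain_primel c).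
have [Q' [pQ' Q2Q' Q'E]] := extend_top tM c.
have [r' [rr' c']] : exists r', (r <= r')%N /\ chain r' Q1 Q'.
  have [Q'Q2|Q'Q2] := pselect (Q' `<=` Q2).
    by exists r; have -> : Q' = Q2 by apply/seteqP.
  by exists r.+1; split=> //; apply: chain_rcons c pQ' _.
have [s [h [sD cs sh mins]]] := parameters nR pP (prime_idealP (D 0%N)) PD.
have [|P' [m' [Q1P' sP' cP' le]]] := chain_through_seq nM c' (s := [seq str (tower_at 0 m.+1) x | x <- s]).
  by move=> _ /mapP[x /sD xD ->]; move: xD; rewrite -Q'E.
have pP' := chain_primel cP'.
have DP' : (D 0%N : set R) `<=` str (tower_at 0 m.+1) @^-1` P'.
  apply: mins; first exact: preim_prime.
  - by move=> t Pt; apply: Q1P'.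
  - by move=> x xs; apply: sP'; apply: map_f.
  - exact: ta_contract tM pP'.
have [g [cg le']] := tower_chain_fibre (j := 0) incD cP' DP'.
exists P, h, g; split=> //.
rewrite size_map in le; apply: (@leq_trans (m' + h + m)); first by rewrite leq_add2r (leq_trans rr') // (leq_trans le) // leq_add2l.
by rewrite addnAC addnC leq_add2l.
Qed.

Hypothesis cR : catenary_ring R.
Hypothesis gfR : forall (q : prime_ideal R) (M : pz_algebra R) m (Q1 Q2 : set M),
  tower_algebra q M -> chain m.+1 Q1 Q2 ->
  exists Q', [/\ chain m Q1 Q', Q' `<` Q2 & str M @^-1` Q' = str M @^-1` Q1].

Lemma prime_sequence_chain j m : (forall i, (j <= i < j + m)%N -> (D i : set R) `<` D i.+1) ->
  chain m (D j : set R) (D (j + m)%N).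
Proof.
elim: m => [|m IH] incD; first by rewrite addn0; exact: (chain_nil (prime_idealP (D j))).
rewrite addnS; apply: chain_rcons (IH _) (prime_idealP _) _.
  by move=> i /andP[ji im]; apply: incD; rewrite ji addnS ltnW.
by apply: incD; rewrite leq_addr addnS leqnn.
Qed.

(** Catenarity splits the chain at [D j.+1] into [a.+1] and [b] links. Induction converts the upper
    part into [r] links, going-down attaches the lower [a.+1], and lying over [D j] costs one link,
    leaving [a + r]. *)
Lemma tower_chain_ge j m g : (forall i, (j <= i < j + m)%N -> (D i : set R) `<` D i.+1) ->
  chain g (D j : set R) (D (j + m)%N) ->
  exists r (Q1 Q2 : set (tower_at j m.+1)),
    [/\ chain r Q1 Q2, (D j : set R) `<=` str (tower_at j m.+1) @^-1` Q1 & (g <= r + m)%N].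
Proof.
elim: m j g => [|m IH] j g incD c.
  have [nM flM] := tower_at_flat j.+1 0.
  have g0 : g = 0%N by rewrite addn0 in c; apply: chain_le0 c _.
  have c0 : chain 0 (D j : set (tower_at j.+1 0)) (D j) := chain_nil (prime_idealP (D j)).
  have [||Q1 [Q2 [c' DQ1]]] := step_chain_up nR (p := D j) nM c0; [by []|by []|].
  by exists 0%N, Q1, Q2; rewrite g0.
have [nM flM] := tower_at_flat j.+1 m.+1.
have ltj : (D j : set R) `<` D j.+1 by apply: incD; rewrite leqnn addnS ltnS leq_addr.
have incS i : (j.+1 <= i < j.+1 + m)%N -> (D i : set R) `<` D i.+1.
  by move=> /andP[ji im]; apply: incD; rewrite ltnW //= addnS -addSn.
have cS := prime_sequence_chain incS; rewrite addSnnS in cS.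
have [a [b [ca cb gab]]] := cR c (prime_idealP (D j.+1)) ltj.1 (chain_sub cS).
case: a ca gab => [|a] ca gab; first by case: ltj => _ []; rewrite (chain0_eq ca).
have [|r [Q1 [Q2 [c' DQ1 le]]]] := IH j.+1 b incS; first by rewrite addSnnS.
have tS := tower_atP j.+1 m.
have Q1E : str (tower_at j.+1 m.+1) @^-1` Q1 = D j.+1.
  by apply/seteqP; split=> //; apply: ta_contract tS (chain_primel c').
have [Q' [ca' Q'E]] := going_down_chain nM flM ca (chain_primel c') Q1E.
have [Q'' [c'' _ Q''E]] := gfR tS (chain_cat ca' c').
have [||T1 [T2 [cT DT]]] := step_chain_up nR (p := D j) nM c''.
- by rewrite Q'E.
- by rewrite Q''E Q'E.
exists (a + r)%N, T1, T2; split=> //.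
by rewrite (leq_trans gab) // addSnnS -addnA leq_add2l (leq_trans (_ : b.+1 <= (r + m).+1)%N) // -addnS.
Qed.

Lemma tower_chain_full m h g P : (forall i, (i < m)%N -> (D i : set R) `<` D i.+1) ->
  chain h P (D 0%N : set R) -> chain g (D 0%N : set R) (D m) ->
  exists r (Q1 Q2 : set (tower_at 0 m.+1)), chain r Q1 Q2 /\ (h + g <= r + m)%N.
Proof.
move=> incD ch cg; have tM := tower_atP 0 m; have [nM flM] := tower_at_flat 0 m.+1.
have [r [Q1 [Q2 [c DQ1 le]]]] := tower_chain_ge (j := 0) incD cg.
have Q1E : str (tower_at 0 m.+1) @^-1` Q1 = D 0%N.
  by apply/seteqP; split=> //; apply: ta_contract tM (chain_primel c).
have [Q' [ch' _]] := going_down_chain nM flM ch (chain_primel c) Q1E.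
exists (h + r)%N, Q', Q2; split; first exact: chain_cat ch' c.
by rewrite -addnA leq_add2l.
Qed.

End Tower.

(** * The dimension formula *)

Section FiniteType.
Variables (k : fieldType) (B : comAlgType k).

Lemma finite_type_tower : finite_type B ->
  exists m (f : {rmorphism tower k m -> B}), forall b, exists t, f t = b.
Proof.
move=> [xs gen].
have [m [f [fk fx]]] : exists m (f : {rmorphism tower k m -> B}),
    (forall c : k, exists t, f t = c%:A) /\ forall x, x \in xs -> exists t, f t = x.
  elim: {gen}xs => [|x xs [m [f [fk fx]]]].
    by exists 0%N, (in_alg B); split=> // c; exists c.
  pose F : {rmorphism {poly tower k m} -> B} := horner_morph (fun s => mulrC x (f s)).
  have FC s : F s%:P = f s by exact: horner_morphC.
  have FX : F 'X = x by exact: horner_morphX.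
  exists m.+1, F; split=> [c|y]; first by have [t <-] := fk c; exists t%:P.
  rewrite inE => /predU1P[->|/fx[t <-]]; first by exists 'X.
  by exists t%:P.
exists m, f => b; have : [set: B] b by [].
rewrite -gen; apply: (_ : smallest _ _ `<=` [set b | exists t, f t = b]).
apply: smallest_sub; last by move=> x /fx.
split.
- by rewrite in_setE; exists 1; rewrite rmorph1.
- move=> c u v; rewrite !in_setE => -[s <-] [t <-]; have [r rE] := fk c.
  by exists (r * s + t); rewrite rmorphD rmorphM rE mulr_algl.
- move=> u v; rewrite !in_setE => -[s <-] [t <-].
  by exists (s * t); rewrite rmorphM.
Qed.

Lemma finite_type_span : finite_type B ->
  exists b : nat -> B, forall x, exists n, kspan (in_alg B) b n x.
Proof.
move=> [xs gen].
(* Monomials, coded as words of indices into [xs]; a number that codes no word yields 0, which adds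
   nothing to the spans. *)
pose b i : B := if unpickle i is Some w then \prod_(j <- (w : seq nat)) xs`_j else 0.
pose S : set B := [set x | exists n, kspan (in_alg B) b n x].
have widen n m x : (n <= m)%N -> kspan (in_alg B) b n x -> kspan (in_alg B) b m x.
  move=> nm [c ->]; exists (fun i => if (i < n)%N then c i else 0).
  rewrite (big_ord_widen _ (fun i => in_alg B (c i) * b i) nm) [LHS]big_mkcond /=.
  by apply: eq_bigr => i _; case: ifP => // _; rewrite scale0r mul0r.
have S0 : S 0 by exists 0%N, (fun=> 0); rewrite big_ord0.
have SD x y : S x -> S y -> S (x + y).
  move=> [n nx] [m my]; exists (maxn n m).
  have [c xE] := widen _ _ _ (leq_maxl n m) nx; have [d yE] := widen _ _ _ (leq_maxr n m) my.
  exists (fun i => c i + d i); rewrite xE yE -big_split /=.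
  by apply: eq_bigr => i _; rewrite scalerDl mulrDl.
have SZ a x : S x -> S (a *: x).
  move=> [n [c ->]]; exists n, (fun i => a * c i); rewrite scaler_sumr.
  by apply: eq_bigr => i _; rewrite /= !mulr_algl scalerA.
have Sb i : S (b i).
  exists i.+1, (fun j => (j == i)%:R); rewrite big_ord_recr big1 => [|j _] /=.
    by rewrite add0r eqxx scale1r mul1r.
  by rewrite ltn_eqF // scale0r mul0r.
have Ssum n (F : 'I_n -> B) : (forall i, S (F i)) -> S (\sum_i F i).
  by move=> SF; elim/big_ind : _.
have Sw (w : seq nat) : S (\prod_(j <- w) xs`_j).
  by have := Sb (pickle w); rewrite /b pickleK.
have SM x y : S x -> S y -> S (x * y).
  move=> [n [c ->]] [m [d ->]]; rewrite mulr_suml; apply: (Ssum) => i.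
  rewrite mulr_sumr; apply: (Ssum) => j; rewrite /= !mulr_algl -scalerAl -scalerAr.
  do 2 apply: (SZ); rewrite /b; case: unpickle => [w|]; last by rewrite mul0r.
  case: unpickle => [w'|]; last by rewrite mulr0.
  by rewrite -big_cat; apply: Sw.
exists b => x; have : [set: B] x by [].
rewrite -gen; apply: (_ : smallest _ _ `<=` S); apply: smallest_sub; last first.
  by move=> y /(nthP 0)[j _ <-]; have := Sw [:: j]; rewrite big_seq1.
split.
- by rewrite in_setE; have := Sw [::]; rewrite big_nil.
- by move=> c u v; rewrite !in_setE => Su Sv; apply: SD => //; apply: SZ.
- by move=> u v; rewrite !in_setE; apply: SM.
Qed.

End FiniteType.

Section PrimeChains.
Variable A : comPzRingType.

Lemma prime_chainP m (P Q : set A) : chain m P Q <->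
  exists p : 'I_m.+1 -> prime_ideal A,
    [/\ prime_chain p, p ord0 = P :> set A & p ord_max = Q :> set A].
Proof.
split=> [c|[p [cp <- <-]]].
  have [p [p0 pm pS]] : exists p : nat -> prime_ideal A,
      [/\ p 0%N = P :> set A, p m = Q :> set A & forall i, (i < m)%N -> (p i : set A) `<` p i.+1].
    elim: c => [{}P pP|{}m {}P {}Q Q' c [p [p0 pm pS]] pQ' lt].
      by exists (fun=> PrimeIdeal pP).
    exists (fun i => if i == m.+1 then PrimeIdeal pQ' else p i); split=> //=; first by rewrite eqxx.
    move=> i; rewrite ltnS leq_eqVlt => /predU1P[->|im].
      by rewrite eqxx ltn_eqF //= pm.
    by rewrite !ltn_eqF ?ltnS // ?(ltnW im) //; apply: pS.
  exists (fun i : 'I_m.+1 => p i); split=> // i j ij.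
  by rewrite ij; apply: pS; rewrite -ltnS -ij.
have pS i : (i < m)%N -> (p (inord i) : set A) `<` p (inord i.+1).
  by move=> im; apply: cp; rewrite !inordK // ltnS ltnW.
have -> : ord0 = inord 0 :> 'I_m.+1 by apply: val_inj; rewrite /= inordK.
have -> : ord_max = inord m :> 'I_m.+1 by apply: val_inj; rewrite /= inordK.
have : forall j, (j <= m)%N -> chain j (p (inord 0) : set A) (p (inord j)).
  elim=> [_|j IH jm]; first exact/chain_nil/prime_idealP.
  by apply: chain_rcons (IH (ltnW jm)) (prime_idealP _) (pS j jm).
exact.
Qed.

End PrimeChains.

Section SupLength.
Implicit Types L : set nat.
Local Open Scope ereal_scope.

Lemma supremumE (A : set (\bar int)) l : A !=set0 -> ubound A l ->
  (forall u, ubound A u -> (l <= u)%O) -> supremum -oo%E A = l.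
Proof.
move=> /set0P A0 ul lu; rewrite /supremum (negbTE A0).
case: xgetP => [y _ [uy ly]|/(_ l)]; last by case; split.
by apply/eqP; rewrite eq_le (ly _ ul) (lu _ uy).
Qed.

Lemma sup_length_max L m : L m -> (forall n, L n -> (n <= m)%N) -> sup_length L = m%:Z%:E.
Proof.
move=> Lm maxm; apply: supremumE.
- by exists m%:Z%:E, m.
- by move=> _ [n Ln <-]; rewrite lee_fin lez_nat; apply: maxm.
- by move=> u uL; apply: uL; exists m.
Qed.

Lemma sup_length_unbounded L : (forall m, exists2 n, L n & (m <= n)%N) -> sup_length L = +oo.
Proof.
move=> ubL; have [n0 Ln0 _] := ubL 0%N; apply: supremumE.
- by exists n0%:Z%:E, n0.
- by move=> x _; rewrite leey.
- move=> u uL; case: u uL => [z|//|] uL; last by have := uL _ (ex_intro2 _ _ n0 Ln0 erefl).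
  have [n Ln zn] := ubL `|z|.+1%N.
  have := uL _ (ex_intro2 _ _ n Ln erefl); rewrite lee_fin => nz.
  exfalso; move: (le_trans nz (lez_abs z)); rewrite lez_nat => /(leq_trans zn).
  by rewrite ltnn.
Qed.

Lemma sup_length_cases L : (exists m, L m) ->
  (exists2 m, L m & forall n, L n -> (n <= m)%N) \/ (forall m, exists2 n, L n & (m <= n)%N).
Proof.
move=> [m0 Lm0]; have [[b bP]|ub] := pselect (exists b, forall n, L n -> (n <= b)%N).
  left; have ex : exists n, `[< L n >] by exists m0; apply/asboolP.
  have bd n : `[< L n >] -> (n <= b)%N by move/asboolP; apply: bP.
  have [m /asboolP Lm mP] := ex_maxnP ex bd.
  by exists m => // n Ln; apply: mP; apply/asboolP.
right=> m; apply: contrapT => no; apply: ub; exists m => n Ln.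
by rewrite leqNgt; apply/negP => mn; apply: no; exists n => //; apply: ltnW.
Qed.

(** Infinite suprema are covered: if [Lh] or [Lr] is unbounded, so is [Ld], by [ge] with the other
    length fixed at [n] or 0. Otherwise the maxima add up exactly. *)
Lemma sup_length_add Ld Lh Lr n : Lh 0%N -> Lr n ->
  (forall r, Ld r -> exists h g, [/\ Lh h, Lr g & (r + n <= h + g)%N]) ->
  (forall h g, Lh h -> Lr g -> exists2 r, Ld r & (h + g <= r + n)%N) ->
  sup_length Ld = sup_length Lh + sup_length Lr - (n%:Z)%:E.
Proof.
move=> Lh0 Lrn le ge.
have [[H LH maxH]|unH] := sup_length_cases (ex_intro _ _ Lh0); last first.
  rewrite (sup_length_unbounded unH) (sup_length_unbounded (L := Ld)); last first.
    move=> m; have [h Lhh mh] := unH m; have [r Ldr hr] := ge h n Lhh Lrn.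
    by exists r => //; rewrite leq_add2r in hr; apply: leq_trans hr.
  have [[G LG maxG]|unG] := sup_length_cases (ex_intro _ _ Lrn).
    by rewrite (sup_length_max LG maxG).
  by rewrite (sup_length_unbounded unG).
have [[G LG maxG]|unG] := sup_length_cases (ex_intro _ _ Lrn); last first.
  rewrite (sup_length_max LH maxH) (sup_length_unbounded unG) (sup_length_unbounded (L := Ld)) //.
  move=> m; have [g Lrg mg] := unG (m + n)%N; have [r Ldr gr] := ge 0%N g Lh0 Lrg.
  by exists r => //; rewrite -(leq_add2r n) (leq_trans mg).
have nG : (n <= G)%N := maxG _ Lrn.
have [r Ldr HGr] := ge H G LH LG.
have bound s : Ld s -> (s + n <= H + G)%N.
  by move=> /le[h [g [Lhh Lrg /leq_trans]]]; apply; rewrite leq_add ?maxH ?maxG.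
have rE : (r + n = H + G)%N by apply/eqP; rewrite eqn_leq bound.
rewrite (sup_length_max LH maxH) (sup_length_max LG maxG) (sup_length_max (m := r) Ldr); last first.
  by move=> s /bound; rewrite -rE leq_add2r.
have -> : r%:Z = (H%:Z + G%:Z - n%:Z)%R by rewrite -PoszD -rE PoszD addrK.
by [].
Qed.

End SupLength.

Local Open Scope ereal_scope.

Theorem theorem3p3 (k : fieldType) (R : comAlgType k) (n : nat)
    (Delta : 'I_n.+1 -> prime_ideal R) :
  ess_finite_type R -> prime_chain Delta ->
  krull_dim (ind_pro_completion Delta) =
    height (Delta ord0) + rel_height (Delta ord0) (Delta ord_max) - (n%:Z)%:E.
Proof.
move=> [B [T [f [ftB [f' fK f'K] _]]]] incDelta.
have [m [w ws]] := finite_type_tower ftB; have [b bB] := finite_type_span ftB.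
have nB : noetherian B := noetherian_surj ws (@noetherian_tower k m).
pose beta : {rmorphism B -> R} := f \o @loc_embed B T.
have frac_beta : fracmap beta.
  apply: (fracmap_comp (@loc_embed_frac B T)) => d.
  by exists (f' d), 1%R, 1%R; rewrite rmorph1 !mulr1 f'K.
have nR : noetherian R := fracmap_noetherian frac_beta nB.
have intw : integralRange w by move=> x; have [t <-] := ws x; apply: integral_id.
have cR : catenary_ring R := fracmap_catenary frac_beta (catenary nB intw).
have gfR := generic_fibre_chain bB frac_beta.
(* Above [n], [inord] falls back to [ord0]; strict inclusions are accordingly claimed for [i < n]
   only. *)
pose D i := Delta (inord i).
have incD i : (i < n)%N -> (D i : set R) `<` D i.+1.
  by move=> lin; apply: incDelta; rewrite !inordK // ltnS ltnW.
have towerE : ind_pro_completion Delta = tower_at D 0 n.+1.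
  rewrite /ind_pro_completion /tower_at; congr foldr.
  rewrite -val_enum_ord -map_comp; apply: eq_map => i.
  by rewrite /D /= inord_val.
have D0 : Delta ord0 = D 0%N by congr Delta; apply: val_inj; rewrite /= inordK.
have Dn : Delta ord_max = D n by congr Delta; apply: val_inj; rewrite /= inordK.
rewrite towerE D0 Dn; apply: sup_length_add.
- exists (fun=> D 0%N); split=> // i j; by rewrite (ord1 i) (ord1 j).
- by apply/prime_chainP; apply: (prime_sequence_chain (j := 0)).
- move=> r [p cp].
  have c : chain r (p ord0 : set _) (p ord_max) by apply/prime_chainP; exists p.
  have [P [h [g [ch cg le]]]] := tower_chain_le nR incD c.
  exists h, g; split=> //; last exact/prime_chainP.
  by move/prime_chainP: ch => [q [cq _ qD]]; exists q.
- move=> h g [p [cp pD]] /prime_chainP cg.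
  have ch : chain h (p ord0 : set R) (D 0%N) by apply/prime_chainP; exists p.
  have [r [Q1 [Q2 [c le]]]] := tower_chain_full nR cR gfR incD ch cg.
  exists r => //; by move/prime_chainP: c => [q [cq _ _]]; exists q.
Qed.
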